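(* Let $W=(W_t)_{t\ge 0}$ and $\tilde W=(\tilde W_t)_{t\ge 0}$ be independent Brownian motions, and let $k\colon\mathbb{R}^2\to\mathbb{R}$ be a deterministic kernel with $k(t,s)=0$ for $s>t$ and $\int_0^t k(t,s)^2\,\mathrm{d}s<\infty$ for all $t\ge 0$. Let $X=(X_t)_{t\ge 0}$ be the Gaussian Volterra process $X_t=\int_0^t k(t,s)\,\mathrm{d}W_s$. Let $a,b\in\mathbb{R}$ with $a^2+b^2>0$, let $W^{a,b}=aW+b\tilde W$, and let $(\mathcal{F}^{a,b}_u)_{u\ge 0}$ be the filtration generated by $W^{a,b}$. Let $u>0$. Then the regular conditional law of the process $X=(X_t)_{t\in[0,\infty)}$ given $\mathcal{F}^{a,b}_u$ is Gaussian with random mean $$ \hat m^{a,b}_t(u)=\frac{a}{a^2+b^2}\int_0^u k(t,s)\,\mathrm{d}W^{a,b}_s,\qquad t\ge 0, $$ and deterministic covariance $$ \hat r^{a,b}(t,s|u)=\int_0^{t\wedge s}\left(1-\frac{a^2}{a^2+b^2}\mathbf{1}_u(v)\right)^2 k(t,v)k(s,v)\,\mathrm{d}v+\frac{a^2b^2}{(a^2+b^2)^2}\int_0^u k(t,v)k(s,v)\,\mathrm{d}v,\qquad t,s\ge 0. $$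
   Context: Notation: $t\wedge s=\min(t,s)$; $\mathbf{1}_u(v)=1$ if $v<u$ and $\mathbf{1}_u(v)=0$ otherwise. For each $t$, the function $k(t,\cdot)$ is measurable and the integrals against $W$ are Wiener integrals of deterministic square-integrable functions; integrals against $W^{a,b}$ are understood by bilinearity, $\int f\,\mathrm{d}W^{a,b}=a\int f\,\mathrm{d}W+b\int f\,\mathrm{d}\tilde W$. The filtration is $\mathcal{F}^{a,b}_u=\sigma(W^{a,b}_v: 0\le v\le u)$ (up to null sets). The regular conditional law of $X$ on $[0,\infty)$ given $\mathcal{F}^{a,b}_u$ is the conditional law (as a probability kernel) of the whole process $(X_t)_{t\ge 0}$ given $\mathcal{F}^{a,b}_u$; all times $t\ge0$ are included, both $t\le u$ (past and present) and $t>u$ (future). Saying that it is Gaussian with random mean $\hat m^{a,b}_t(u)$ and deterministic covariance $\hat r^{a,b}(t,s|u)$ means that, given $\mathcal{F}^{a,b}_u$, $X$ is a Gaussian process with mean function $t\mapsto \hat m^{a,b}_t(u)=\mathbb{E}[X_t\,|\,\mathcal{F}^{a,b}_u]$ (almost surely for each $t$) and covariance function $\hat r^{a,b}(t,s|u)=\mathbb{E}\big[(X_t-\hat m^{a,b}_t(u))(X_s-\hat m^{a,b}_s(u))\,\big|\,\mathcal{F}^{a,b}_u\big]$, which does not depend on the realization; that is, for all $t_1,\dots,t_n\ge 0$ the conditional law of $(X_{t_1},\dots,X_{t_n})$ given $\mathcal{F}^{a,b}_u$ is almost surely the (possibly degenerate) normal law with mean vector $(\hat m^{a,b}_{t_i}(u))_i$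 and covariance matrix $(\hat r^{a,b}(t_i,t_j|u))_{i,j}$. *)

(* Defs.v *)
From HB Require Import structures.
From mathcomp Require Import all_boot all_order all_algebra.
From mathcomp Require Import all_classical all_reals all_analysis.

Set Implicit Arguments.
Unset Strict Implicit.
Unset Printing Implicit Defensive.

Import Order.TTheory GRing.Theory Num.Theory.
Import numFieldNormedType.Exports.

Local Open Scope classical_set_scope.
Local Open Scope ring_scope.

(* A real process is a family of random variables indexed by R, of which only
   the times t >= 0 are ever used. *)

Section Gaussian_laws.
Context {R : realType}.

(* N(m, v) with v the variance; [normal_prob] is parametrized by the standard
   deviation and is not the Dirac mass when that is 0. *)
Definition normal_law (m v : R) (B : set R) : \bar R :=
  if v == 0 then \d_m B else normal_prob m (Num.sqrt v) B.

(* Under mu, the random vector Y is N(m, C), possibly degenerate: each linear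
   combination c . Y has law N(c . m, c^T C c). *)
Definition gaussian_vector {d} {S : measurableType d} (mu : set S -> \bar R)
    (n : nat) (Y : 'I_n -> S -> R) (m : 'I_n -> R) (C : 'I_n -> 'I_n -> R) :=
  forall (c : 'I_n -> R) (B : set R), measurable B ->
    mu [set x | B (\sum_(i < n) c i * Y i x)] =
    normal_law (\sum_(i < n) c i * m i)
      (\sum_(i < n) \sum_(j < n) c i * c j * C i j) B.

End Gaussian_laws.

Section Brownian_motion.
Context {R : realType} {d} {T : measurableType d} (P : probability T R).

Definition mutually_independent (n : nat) (Y : 'I_n -> T -> R) :=
  forall B : 'I_n -> set R, (forall i, measurable (B i)) ->
    P (\bigcap_(i in [set: 'I_n]) (Y i @^-1` B i)) =
    (\prod_(i < n) P (Y i @^-1` B i))%E.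

Definition brownian_motion (W : R -> {RV P >-> R}) :=
  [/\ {ae P, forall w, W 0 w = 0},
      {ae P, forall w, {within `[0, +oo[, continuous (fun t => W t w)}},
      (forall s t, 0 <= s -> s <= t -> forall B, measurable B ->
         P [set w | B (W t w - W s w)] = normal_law 0 (t - s) B)
    & (forall (n : nat) (t : nat -> R), 0 <= t 0%N ->
         (forall i, (i < n)%N -> t i <= t i.+1) ->
         mutually_independent
           (fun (i : 'I_n) w => W (t i.+1) w - W (t i) w))].

(* Generates sigma(Y_v : v in I). *)
Definition process_events (I : set R) (Y : R -> T -> R) : set (set T) :=
  [set A | exists2 v, I v & exists2 B, measurable B & A = Y v @^-1` B].

Definition independent_processes (Y Z : R -> T -> R) :=
  forall A B, <<s process_events `[0, +oo[ Y >> A ->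
    <<s process_events `[0, +oo[ Z >> B -> P (A `&` B) = (P A * P B)%E.

(* sigma(Y_v : 0 <= v <= u), augmented by the null events. *)
Definition natural_filtration (Y : R -> T -> R) (u : R) : set (set T) :=
  <<s process_events `[0, u] Y `|` [set N | measurable N /\ P N = 0%E] >>.

End Brownian_motion.

Section Wiener_integral.
Context {R : realType} {d} {T : measurableType d} (P : probability T R).

(* The list of the (c, (x, y)) stands for the step function
   \sum c * 1_(x, y]. *)
Definition step := seq (R * (R * R)).

Definition step_on (u : R) (s : step) :=
  forall p, p \in s -> 0 <= p.2.1 <= p.2.2 /\ p.2.2 <= u.

Definition step_fun (s : step) (v : R) : R :=
  \sum_(p <- s) p.1 * (p.2.1 < v <= p.2.2)%R%:R.

Definition step_integral (W : R -> T -> R) (s : step) (w : T) : R :=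
  \sum_(p <- s) p.1 * (W p.2.2 w - W p.2.1 w).

(* I is a version of \int_0^u f dW: the L^2(P)-limit of the integrals of step
   functions converging to f in L^2([0, u]). *)
Definition is_wiener_integral (W : R -> T -> R) (u : R) (f : R -> R)
    (I : {RV P >-> R}) :=
  exists s : nat -> step,
    [/\ forall n, step_on u (s n),
        (\int[lebesgue_measure]_(v in `[0%R, u])
           ((f v - step_fun (s n) v) ^+ 2)%:E)%E @[n --> \oo] --> 0%E
      & (\int[P]_w ((I w - step_integral W (s n) w) ^+ 2)%:E)%E
           @[n --> \oo] --> 0%E].

Definition wiener_integral (W : R -> T -> R) (u : R) (f : R -> R) :
    {RV P >-> R} :=
  xget (cst 0 : {mfun T >-> R}) [set I | is_wiener_integral W u f I].

(* \int_0^u f dW^{a,b}, where W^{a,b} = a W + b W'. *)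
Definition wiener_integral_comb (a b : R) (W W' : R -> T -> R) (u : R)
    (f : R -> R) (w : T) : R :=
  a * wiener_integral W u f w + b * wiener_integral W' u f w.

End Wiener_integral.

Section Conditional_law.
Context {R : realType} {d} {T : measurableType d} (P : probability T R).

(* R^[0, oo) with the product sigma-algebra. *)
Definition cylinders : set (set ({nonneg R} -> R)) :=
  [set A | exists t, exists2 B, measurable B & A = [set x | B (x t)]].

Local Notation path_space := (g_sigma_algebraType cylinders).

Definition sample_path (X : R -> T -> R) (w : T) : path_space :=
  fun t => X t%:num w.

(* The type of kappa says that it is an F-measurable kernel of probability
   measures. *)
Definition regular_conditional_law (F : set (set T)) (X : R -> T -> R)
    (kappa : R.-pker (g_sigma_algebraType F) ~> path_space) :=
  forall (A : set path_space) (B : set T),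
    measurable A -> F.-sigma.-measurable B ->
    P (B `&` sample_path X @^-1` A) = (\int[P]_(w in B) kappa w A)%E.

Definition is_conditional_expectation (F : set (set T)) (Y Z : T -> R) :=
  [/\ P.-integrable [set: T] (EFin \o Y),
      P.-integrable [set: T] (EFin \o Z),
      measurable_fun [set: g_sigma_algebraType F] Z
    & forall B : set T, F.-sigma.-measurable B ->
        (\int[P]_(w in B) (Z w)%:E = \int[P]_(w in B) (Y w)%:E)%E].

Definition gaussian_conditional_law (F : set (set T)) (X m : R -> T -> R)
    (r : R -> R -> R) :=
  [/\ exists kappa, @regular_conditional_law F X kappa,
      (forall kappa, @regular_conditional_law F X kappa ->
         forall (n : nat) (t : 'I_n -> {nonneg R}),
         {ae P, forall w, gaussian_vector (kappa w)
           (fun i (x : path_space) => x (t i))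
           (fun i => m (t i)%:num w)
           (fun i j => r (t i)%:num (t j)%:num)}),
      (forall t, 0 <= t -> is_conditional_expectation F (X t) (m t))
    & (forall t s, 0 <= t -> 0 <= s ->
         is_conditional_expectation F
           (fun w => (X t w - m t w) * (X s w - m s w)) (fun=> r t s))].

End Conditional_law.

(* Main.v *)
Require Import Defs.
From HB Require Import structures.
From mathcomp Require Import all_boot all_order all_algebra.
From mathcomp Require Import all_classical all_reals all_analysis.
From mathcomp Require Import measurable_realfun normal_distribution ring lra.

(** Write [c2 = a^2 + b^2], [Y = a W + b W'] for the observed process and
    [V = - b W + a W'] for its orthogonal companion. Then [dW = (a dY - b dV) / c2],
    so that splitting [X_t = \int k(t, v) dW_v] at time [u] gives [X_t = m_t + Z_t]
    with
      m_t = (a / c2) \int_0^u k(t, v) dY_v,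
      Z_t = - (b / c2) \int_0^u k(t, v) dV_v + \int_u^t k(t, v) dW_v,
    the last integral being absent when [t <= u].
    The mean [m] is a functional of the observation up to time [u]. The residual
    [Z] is built from increments of [V] before [u] and of [W] after [u], and is
    independent of the observation: over a time interval the increments of
    [(Y, V)] are, up to a factor, the rotation of the two independent Gaussian
    increments of [(W, W')], hence independent, and increments over disjoint
    intervals are independent. Therefore the conditional law of [X] is the law of
    [m] frozen at the observed value plus a fresh copy of [Z]. Expressed with [W]
    and [W'], the residual is [\int h_t dW + \int g_t dW'] where
    [h_t v = (1 - a^2 / c2 1_(v <= u)) k(t, v)] and
    [g_t v = - (a b / c2) 1_(v <= u) k(t, v)]; the isometry yields the covariance
    [\int h_t h_s + \int g_t g_s], which is the announced one.

    Independence is proved on finite grids. The law of two independent standard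
    normal variables is invariant under rotations ([normal_prob_rotation]), which
    makes linear combinations Gaussian ([centered_gaussian_lin]) and rotated
    increments independent ([indep_rotation]). A finite number of increments
    lives on a common grid, the cells of which are independent, and
    [indep_past_future] concludes with pi-systems, null events included.

    Wiener integrals are mean-square limits of step integrals, along any sequence
    of step functions that converges to the integrand ([wiener_integral_limit];
    existence rests on [step_approx_L2] and [L2_complete]). One sequence thus
    serves for [X_t], for [m_t] and for [Z_t], measurability passes to the limit
    ([L2cvg_measurable]), and so does Gaussianity ([centered_gaussian_limit],
    [is_pair_integral_gaussian]).

    Finally [gaussian_conditional_law_of_decomposition] turns a decomposition
    [X = m + Z] of this kind into a statement on conditional laws. Every version
    of the conditional law has the same finite-dimensional laws almost surely,
    because versions agree on countably many half-spaces with rational bounds,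
    and these generate the finite-dimensional events. *)

Set Implicit Arguments.
Unset Strict Implicit.
Unset Printing Implicit Defensive.

Import Order.TTheory GRing.Theory Num.Theory.
Import numFieldNormedType.Exports.

Local Open Scope classical_set_scope.
Local Open Scope ring_scope.

(** * Image measures and densities *)

Section measure_lemmas.
Context {R : realType}.
Local Open Scope ereal_scope.

Section image_measure.
Context d d' (T1 : measurableType d) (T2 : measurableType d').
Variables (m : {measure set T1 -> \bar R}) (f : T1 -> T2).
Hypothesis mf : measurable_fun [set: T1] f.

Definition image_measure : {measure set T2 -> \bar R} :=
  measure_function_pushforward__canonical__measure_function_Measure m mf.

Lemma image_measureE A : image_measure A = m (f @^-1` A).
Proof. by []. Qed.

Lemma ge0_integral_image_measure (g : T2 -> \bar R) :
  measurable_fun [set: T2] g -> (forall y, 0 <= g y) ->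
  \int[image_measure]_y g y = \int[m]_x g (f x).
Proof. by move=> mg g0; rewrite (ge0_integral_pushforward mf). Qed.

End image_measure.

Import HBNNSimple.

Lemma ge0_integral_density d (T : measurableType d)
    (mu nu : {measure set T -> \bar R}) (p : T -> R) (f : T -> \bar R) :
  measurable_fun [set: T] p -> (forall x, (0 <= p x)%R) ->
  (forall A, measurable A -> nu A = \int[mu]_(x in A) (p x)%:E) ->
  measurable_fun [set: T] f -> (forall x, 0 <= f x) ->
  \int[nu]_x f x = \int[mu]_x (f x * (p x)%:E).
Proof.
move=> mp p0 nuE mf f0; pose f_ := nnsfun_approx measurableT mf.
have f_cvg x : (f_ n x)%:E @[n --> \oo] --> f x.
  by apply: cvg_nnsfun_approx.
transitivity (limn (fun n => \int[nu]_x (f_ n x)%:E)).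
  rewrite -monotone_convergence//.
  - by apply: eq_integral => y _; apply/esym/cvg_lim.
  - by move=> n; exact/measurable_EFinP/measurable_funP.
  - by move=> n y _; rewrite lee_fin.
  - by move=> y _ m n mn; rewrite lee_fin; exact/lefP/nd_nnsfun_approx.
rewrite [X in limn X](_ : _ =
    (fun n => \int[mu]_x ((f_ n x)%:E * (p x)%:E))).
  rewrite -monotone_convergence//; last 3 first.
  - move=> n; apply: emeasurable_funM; last exact/measurable_EFinP.
    exact/measurable_EFinP/measurable_funP.
  - by move=> n x _; rewrite mule_ge0// lee_fin.
  - move=> x _ m n mn; rewrite lee_wpmul2r// lee_fin ?p0//.
    exact/lefP/nd_nnsfun_approx.
  apply: eq_integral => x _; apply/cvg_lim => //.
  by apply: cvgeZr.
apply/funext => n.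
transitivity (\sum_(k \in range (f_ n))
    \int[mu]_x ((k * \1_(f_ n @^-1` [set k]) x)%:E * (p x)%:E)).
  under eq_integral do rewrite fimfunE -fsumEFin//.
  rewrite ge0_integral_fsum//; last 2 first.
  - by move=> y; exact/measurable_EFinP/measurable_funM.
  - by move=> y x _; rewrite nnfun_muleindic_ge0.
  apply: eq_fsbigr => r /set_mem [t _ <-]; rewrite integralZl_indic_nnsfun//.
  rewrite integral_indic// setIT nuE//.
  under [RHS]eq_integral do rewrite EFinM -muleA.
  rewrite ge0_integralZl_EFin//; first last.
  - apply: emeasurable_funM; last exact/measurable_EFinP.
    exact/measurable_EFinP/measurable_indic.
  - by move=> x _; rewrite mule_ge0// lee_fin.
  congr (_ * _); rewrite [LHS]integral_mkcond; apply: eq_integral => x _.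
  rewrite patchE indicE; case: ifPn => _; first by rewrite mul1e.
  by rewrite mul0e.
rewrite -ge0_integral_fsum//.
- apply: eq_integral => x _; rewrite [in RHS]fimfunE -fsumEFin//.
  rewrite ge0_mule_fsuml// => r; exact: nnfun_muleindic_ge0.
- move=> r; apply: emeasurable_funM; last exact/measurable_EFinP.
  exact/measurable_EFinP/measurable_funM.
- by move=> r x _; rewrite mule_ge0 ?nnfun_muleindic_ge0 ?lee_fin.
Qed.

End measure_lemmas.

(** * Normal laws *)

Section affine_lebesgue.
Context {R : realType}.
Notation mu := (@lebesgue_measure R).
Local Open Scope ereal_scope.

Lemma measurable_affine (al be : R) : measurable_fun [set: measurableTypeR R]
  (fun x : R => (al * x + be)%R : measurableTypeR R).
Proof. by apply: measurable_funD => //; apply: measurable_funM. Qed.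

(** By uniqueness of the Lebesgue measure: the right-hand side is a measure that
    agrees with the length on intervals. *)
Lemma lebesgue_measure_affine (al be : R) (A : set R) :
  al != 0%R -> measurable A ->
  mu A = `|al|%:E * mu [set x | A (al * x + be)%R].
Proof.
move=> al0 mA.
pose m := image_measure mu (measurable_affine al be).
have -> : mu [set x | A (al * x + be)%R] = m A by [].
apply: (@lebesgue_measure_unique _ (mscale (`|al|%:nng)%R m)) => //.
move=> _ [[p q] _ <-].
suff -> : mu `]p, q]%classic =
    `|al|%:E * mu [set x | (p < al * x + be <= q)%R] by [].
rewrite lebesgue_measure_itv/= lte_fin.
have := al0; rewrite neq_lt => /orP[aln|alp].
  rewrite (_ : [set t | _] = `[(q - be) / al, (p - be) / al[%classic)%R; last first.
    apply/seteqP; split=> x; rewrite /= in_itv/= ler_ndivrMr// ltr_ndivlMr//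
      lerBrDr ltrBlDr ![(x * _)%R]mulrC andbC//.
  rewrite lebesgue_measure_itv/= lte_fin ltr_nM2r ?invr_lt0// ltrD2r.
  case: ifPn => _; last by rewrite mule0.
  by rewrite ltr0_norm// -!EFinB -EFinM; congr (_%:E); field.
rewrite (_ : [set t | _] = `](p - be) / al, (q - be) / al]%classic)%R; last first.
  apply/seteqP; split=> x; rewrite /= in_itv/= ltr_pdivrMr// ler_pdivlMr//
    lerBrDr ltrBlDr ![(x * _)%R]mulrC//.
rewrite lebesgue_measure_itv/= lte_fin ltr_pM2r ?invr_gt0// ltrD2r.
case: ifPn => _; last by rewrite mule0.
by rewrite gtr0_norm// -!EFinB -EFinM; congr (_%:E); field.
Qed.

Lemma ge0_integral_affine (al be : R) (f : R -> \bar R) :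
  al != 0%R -> measurable_fun [set: R] f -> (forall x, 0 <= f x) ->
  \int[mu]_x f x = `|al|%:E * \int[mu]_x f (al * x + be)%R.
Proof.
move=> al0 mf f0.
rewrite -(ge0_integral_image_measure mu (measurable_affine al be) mf f0).
rewrite -(ge0_integral_mscale _ _ (`|al|%:nng)%R)//=.
apply: eq_measure_integral => A mA _.
exact: lebesgue_measure_affine.
Qed.

End affine_lebesgue.

Section normal.
Context {R : realType}.
Notation mu := (@lebesgue_measure R).
Notation phi := (normal_pdf (0 : R) 1).
Notation gamma := (normal_prob (0 : R) 1).
Local Open Scope ereal_scope.

Lemma ge0_integral_normal (m s : R) (f : R -> \bar R) :
  measurable_fun [set: R] f -> (forall x, 0 <= f x) ->
  \int[normal_prob m s]_x f x = \int[mu]_x (f x * (normal_pdf m s x)%:E).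
Proof.
move=> mf f0; apply: (ge0_integral_density (mu := mu)) => //.
- exact: measurable_normal_pdf.
- by move=> x; exact: normal_pdf_ge0.
Qed.

Lemma normal_probE (m s : R) (D : set R) : measurable D ->
  normal_prob m s D = \int[mu]_x ((\1_D x)%:E * (normal_pdf m s x)%:E).
Proof.
move=> mD; transitivity (\int[normal_prob m s]_x (\1_D x)%:E).
  by rewrite integral_indic// setIT.
apply: ge0_integral_normal => //.
exact/measurable_EFinP/measurable_indic.
Qed.

Lemma normal_pdf_affine (m s x : R) : (0 < s)%R ->
  (s * normal_pdf m s (s * x + m) = phi x)%R.
Proof.
move=> s0; rewrite !normal_pdfE ?gt_eqF// /normal_peak /normal_fun.
rewrite expr1n mul1r -mulrnAr sqrtrM ?sqr_ge0// sqrtr_sqr gtr0_norm//.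
rewrite addrK subr0 invfM !mulrA divff ?gt_eqF// !mul1r; congr (_ * expR _)%R.
rewrite exprMn; field; rewrite gt_eqF//.
Qed.

(** Turns both cases of [normal_law] into an affine image of the standard normal
    law, so that degenerate laws need no separate treatment later. *)
Lemma normal_lawE (m v : R) (B : set R) : (0 <= v)%R -> measurable B ->
  normal_law m v B = gamma [set x | B (m + Num.sqrt v * x)%R].
Proof.
move=> v0 mB; rewrite /normal_law; case: ifPn => [/eqP ->|vn0].
  have -> : [set x | B (m + Num.sqrt 0 * x)%R] = if m \in B then setT else set0.
    apply/seteqP; split=> x /=; rewrite sqrtr0 mul0r addr0.
      by move=> /mem_set ->.
    by case: ifPn => // /set_mem.
  rewrite diracE; case: ifPn => _; last by rewrite measure0.
  by rewrite probability_setT.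
have s0 : (0 < Num.sqrt v)%R by rewrite sqrtr_gt0 lt0r vn0.
set s := Num.sqrt v in s0 *.
have mB' : measurable [set x : R | B (m + s * x)%R].
  rewrite (_ : [set x : R | B (m + s * x)%R] = (fun x => s * x + m)%R @^-1` B).
    by rewrite -[X in measurable X]setTI; exact: measurable_affine.
  by apply/seteqP; split=> x /=; rewrite addrC.
rewrite (normal_probE m s mB) (normal_probE 0%R 1%R mB').
pose f x := ((\1_B x)%:E * (normal_pdf m s x)%:E) : \bar R.
have f0 x : 0 <= f x by rewrite mule_ge0// lee_fin ?normal_pdf_ge0.
have mf : measurable_fun [set: R] f.
  apply: emeasurable_funM; first exact/measurable_EFinP/measurable_indic.
  by apply/measurable_EFinP; exact: measurable_normal_pdf.
rewrite [LHS](ge0_integral_affine m (lt0r_neq0 s0) mf f0) gtr0_norm//.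
rewrite -ge0_integralZl_EFin//; last 2 first.
- exact: (measurableT_comp mf (measurable_affine s m)).
- exact: ltW.
apply: eq_integral => x _; rewrite /f muleCA -EFinM normal_pdf_affine//.
rewrite !indicE EFinM; congr (_ * _); congr ((nat_of_bool _)%:R%:E).
by apply/idP/idP; rewrite !inE /= addrC.
Qed.

End normal.

(** * Second moment of the standard normal law *)

Section normal_moments.
Context {R : realType}.
Notation mu := (@lebesgue_measure R).
Notation phi := (normal_pdf (0 : R) 1).
Notation gamma := (normal_prob (0 : R) 1).
Local Open Scope ereal_scope.

Lemma std_normal_pdfE (x : R) :
  (phi x = normal_peak 1 * expR (- (x ^+ 2) / 2))%R.
Proof. by rewrite normal_pdfE ?oner_neq0// /normal_fun subr0 expr1n. Qed.

Lemma std_normal_pdf_even (x : R) : phi (- x)%R = phi x.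
Proof. by rewrite !std_normal_pdfE sqrrN. Qed.

Lemma continuous_std_normal_pdf : continuous phi.
Proof. by apply: continuous_normal_pdf; rewrite oner_neq0. Qed.

Lemma is_derive_std_normal_pdf (x : R) : is_derive x 1%R phi (- x * phi x)%R.
Proof.
rewrite (_ : phi = fun x => normal_peak 1 * expR (- (x ^+ 2) / 2))%R; last first.
  by apply/funext => y; exact: std_normal_pdfE.
rewrite /=; apply: is_derive_eq.
by rewrite /GRing.scale /=; field.
Qed.

Lemma cvg_std_normal_pdf : phi x @[x --> +oo%R] --> (0 : R)%R.
Proof.
rewrite (_ : phi = fun x => normal_peak 1 * gauss_fun (x * (Num.sqrt 2)^-1))%R; last first.
  apply/funext => y; rewrite std_normal_pdfE /gauss_fun exprMn exprVn.
  by rewrite sqr_sqrtr// mulNr.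
rewrite -[X in _ --> X](mulr0 (normal_peak 1)); apply: cvgM; first exact: cvg_cst.
apply: (cvg_comp _ _ _ (@cvg_gauss_fun R)).
apply: gt0_cvgMly; first by rewrite invr_gt0 sqrtr_gt0.
exact: cvg_id.
Qed.

(** Since [phi' x = - x * phi x]. *)
Lemma std_normal_tail (y : R) : (0 <= y)%R ->
  (phi y)%:E = \int[mu]_(x in `[y, +oo[) (x * phi x)%:E.
Proof.
move=> y0; have cphi := continuous_std_normal_pdf.
rewrite (@ge0_continuous_FTC2y _ (fun x => x * phi x)%R (fun x => - phi x)%R y 0).
- by rewrite -EFinB sub0r opprK.
- by move=> x yx; rewrite mulr_ge0 ?normal_pdf_ge0 ?(le_trans y0).
- apply: continuous_subspaceT => x; apply: cvgM; [exact: cvg_id|exact: cphi].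
- by rewrite -[X in _ --> X]oppr0; apply: cvgN; exact: cvg_std_normal_pdf.
- move=> x _; apply: derivableN.
  by apply: ex_derive; exact: is_derive_std_normal_pdf.
- by apply: cvg_at_right_filter; apply: cvgN; exact: cphi.
- move=> x _; rewrite derive1E deriveN; last first.
    by apply: ex_derive; exact: is_derive_std_normal_pdf.
  have H := is_derive_std_normal_pdf x.
  by rewrite derive_val mulNr opprK.
Qed.

(** By parity it suffices to integrate over [x >= 0]. Writing [x ^+ 2 * phi x] as
    the integral of [x * phi x] over [0 <= y <= x] and exchanging the order of
    integration, the inner integral becomes the tail [phi y]. *)
Lemma integral_sqr_normal : \int[gamma]_x (x ^+ 2)%:E = 1.
Proof.
have cphi := continuous_std_normal_pdf.
have mphi : measurable_fun [set: R] phi by exact: measurable_normal_pdf.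
have m0 : measurable [set x : R | (0 <= x)%R] by rewrite -set_itvcy.
rewrite ge0_integral_normal; [|by apply/measurable_EFinP; exact: measurable_funX
  |by move=> x; rewrite lee_fin sqr_ge0].
under eq_integral do rewrite -EFinM.
rewrite (@ge0_symfun_integralT _ (fun x => x ^+ 2 * phi x)%R); first last.
- by move=> x /=; rewrite sqrrN std_normal_pdf_even.
- by move=> x; apply: cvgM; [exact: sqr_continuous|exact: cphi].
- by move=> x; rewrite mulr_ge0 ?sqr_ge0 ?normal_pdf_ge0.
rewrite -[RHS](integral_normal_pdf (0:R) (1:R)).
rewrite (@ge0_symfun_integralT _ phi); first last.
- by move=> x /=; rewrite std_normal_pdf_even.
- exact: cphi.
- by move=> x; exact: normal_pdf_ge0.
congr (_ * _).
pose S : set (R * R) := [set z | (0 <= z.2 <= z.1)%R].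
have mS : measurable S.
  rewrite (_ : S = ((fun z => z.2) @^-1` `[0%R, +oo[) `&`
     ((fun z => z.1 - z.2)%R @^-1` `[0%R, +oo[)).
    apply: measurableI; rewrite -[X in measurable X]setTI.
      exact: measurable_snd.
    exact: measurable_funB.
  apply/seteqP; split => -[x y]; rewrite /S/= !in_itv/= !andbT subr_ge0.
    by move=> /andP[].
  by move=> [-> ->].
pose g (z : R * R) := ((z.1 * phi z.1)%:E * (\1_S z)%:E).
have g0 z : 0 <= g z.
  rewrite /g indicE; have [/set_mem /andP[z2 z12]|_] := boolP (z \in S).
    by rewrite mule1 lee_fin mulr_ge0 ?normal_pdf_ge0// (le_trans z2).
  by rewrite mule0.
have mg : measurable_fun [set: R * R] g.
  apply: emeasurable_funM; apply/measurable_EFinP; last exact: measurable_indic.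
  apply: measurable_funM; first exact: measurable_fst.
  by apply: measurableT_comp => //; exact: measurable_fst.
have := @fubini_tonelli _ _ _ _ _ mu mu g mg g0.
set L := (X in X = _); set Rr := (X in _ = X).
have -> : L = \int[mu]_(x in [set x | (0 <= x)%R]) (x ^+ 2 * phi x)%:E.
  rewrite /L [RHS]integral_mkcond; apply: eq_integral => x _.
  rewrite /g /= patchE; case: ifPn => [/set_mem /= x0|].
    under eq_integral do rewrite muleC.
    rewrite (_ : (fun _ => _) = (fun y => (\1_(`[0%R, x]) y)%:E * (x * phi x)%:E)); last first.
      apply/funext => y; congr (_ * _); rewrite !indicE; congr ((nat_of_bool _)%:R%:E).
    rewrite ge0_integralZr//; last 2 first.
    - exact/measurable_EFinP/measurable_indic.
    - by rewrite lee_fin mulr_ge0 ?normal_pdf_ge0.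
    rewrite integral_indic//= setIT lebesgue_measure_itv/= lte_fin.
    move: x0; rewrite le_eqVlt => /predU1P[<-|x0].
      by rewrite ltxx mul0e expr0n mul0r.
    by rewrite x0 sube0 -EFinM mulrA expr2.
  rewrite notin_setE/= => /negP; rewrite -ltNge => x0.
  rewrite integral0_eq// => y _; rewrite indicE memNset ?mule0// /S /= => /andP[y0 yx].
  by move: (le_trans y0 yx); rewrite leNgt x0.
move=> ->; rewrite /Rr [RHS]integral_mkcond; apply: eq_integral => y _.
rewrite /g /= patchE; case: ifPn => [/set_mem /= y0|].
  rewrite std_normal_tail// [RHS]integral_mkcond; apply: eq_integral => x _.
  rewrite patchE indicE; case: ifPn => xS.
    by rewrite mem_set ?mule1//; move: xS; rewrite inE /S /= y0 in_itv/= andbT.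
  rewrite memNset ?mule0//; move: xS; rewrite notin_setE /S /= y0 in_itv/= andbT.
  by [].
rewrite notin_setE/= => y0.
by rewrite integral0_eq// => x _; rewrite indicE memNset ?mule0// /S /= => /andP[].
Qed.

End normal_moments.

(** * Rotation invariance of the planar normal law *)

Section rotation.
Context {R : realType}.
Notation mu := (@lebesgue_measure R).
Notation phi := (normal_pdf (0 : R) 1).
Notation gamma := (normal_prob (0 : R) 1).
Local Open Scope ereal_scope.

Let integral2 (f : R * R -> \bar R) := \int[mu]_x \int[mu]_y f (x, y).

Let shear_fst (l : R) (z : R * R) : R * R := ((z.1 + l * z.2)%R, z.2).
Let shear_snd (l : R) (z : R * R) : R * R := (z.1, (z.2 + l * z.1)%R).

Definition rotation (c s : R) (z : R * R) : R * R :=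
  ((c * z.1 - s * z.2)%R, (s * z.1 + c * z.2)%R).

Let measurable_shear_fst l : measurable_fun [set: R * R] (shear_fst l).
Proof.
apply/measurable_fun_pair; last exact: measurable_snd.
by apply: measurable_funD => //; apply: measurable_funM.
Qed.

Let measurable_shear_snd l : measurable_fun [set: R * R] (shear_snd l).
Proof.
apply/measurable_fun_pair; first exact: measurable_fst.
by apply: measurable_funD => //; apply: measurable_funM.
Qed.

Lemma measurable_rotation c s : measurable_fun [set: R * R] (rotation c s).
Proof.
apply/measurable_fun_pair.
  by apply: measurable_funB => //; apply: measurable_funM.
by apply: measurable_funD => //; apply: measurable_funM.
Qed.

Lemma integral_translate (g : R -> \bar R) (be : R) :
  measurable_fun [set: R] g -> (forall x, 0 <= g x) ->
  \int[mu]_x g (x + be)%R = \int[mu]_x g x.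
Proof.
move=> mg g0; rewrite [RHS](ge0_integral_affine be (oner_neq0 R) mg g0).
by rewrite normr1 mul1e; apply: eq_integral => x _; rewrite mul1r.
Qed.

Section invariance.
Variable f : R * R -> \bar R.
Hypotheses (mf : measurable_fun [set: R * R] f) (f0 : forall z, 0 <= f z).

Lemma integral2_shear_snd l : integral2 (f \o shear_snd l) = integral2 f.
Proof.
apply: eq_integral => x _ /=.
rewrite -(@integral_translate (fun y => f (x, y)) (l * x)%R)//.
exact: measurableT_comp.
Qed.

Lemma integral2_shear_fst l : integral2 (f \o shear_fst l) = integral2 f.
Proof.
have mfl := measurableT_comp mf (@measurable_shear_fst l).
have -> : integral2 (f \o shear_fst l) = \int[mu]_y \int[mu]_x (f \o shear_fst l) (x, y).
  exact: (@fubini_tonelli _ _ _ _ _ mu mu _ mfl (fun z => f0 _)).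
have -> : integral2 f = \int[mu]_y \int[mu]_x f (x, y).
  exact: (@fubini_tonelli _ _ _ _ _ mu mu _ mf f0).
apply: eq_integral => y _ /=.
rewrite -(@integral_translate (fun x => f (x, y)) (l * y)%R)//.
exact: measurableT_comp.
Qed.

End invariance.

(** With [l = (c - 1) / s], a rotation is a shear of slope [l], followed by one of
    slope [s] in the other direction, followed again by one of slope [l]. *)
Let integral2_rotation_neq0 f (c s : R) :
  measurable_fun [set: R * R] f -> (forall z, 0 <= f z) ->
  (c ^+ 2 + s ^+ 2 = 1)%R -> s != 0%R -> integral2 (f \o rotation c s) = integral2 f.
Proof.
move=> mf f0 cs s0; set l := ((c - 1) / s)%R.
have -> : f \o rotation c s =
    ((f \o shear_fst l) \o shear_snd s) \o shear_fst l.
  apply/funext => -[x y] /=; congr f; rewrite /rotation /shear_fst /shear_snd/=.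
  have ls : (l * s = c - 1)%R by rewrite /l; field.
  have lc : (l * (c + 1) = - s)%R.
    rewrite /l mulrAC -subr_sqr_1; have -> : (c ^+ 2 - 1 = - (s ^+ 2))%R.
      by rewrite -cs; ring.
    by field.
  have E : (y + s * (x + l * y) = s * x + c * y)%R.
    have -> : (y + s * (x + l * y) = s * x + (1 + l * s) * y)%R by ring.
    by rewrite ls; ring.
  rewrite E; congr (_, _).
  have -> : (x + l * y + l * (s * x + c * y) =
    (1 + l * s) * x + (l * (c + 1)) * y)%R by ring.
  by rewrite ls lc; ring.
have m1 := measurableT_comp mf (@measurable_shear_fst l).
have m2 := measurableT_comp m1 (@measurable_shear_snd s).
rewrite (integral2_shear_fst m2 (fun z => f0 _)) (integral2_shear_snd m1 (fun z => f0 _)).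
exact: integral2_shear_fst.
Qed.

Let integral2_rotation f (c s : R) :
  measurable_fun [set: R * R] f -> (forall z, 0 <= f z) ->
  (c ^+ 2 + s ^+ 2 = 1)%R -> integral2 (f \o rotation c s) = integral2 f.
Proof.
move=> mf f0 cs; have [s0|s0] := eqVneq s 0%R; last exact: integral2_rotation_neq0.
move: cs; rewrite s0 expr0n addr0 => /eqP; rewrite sqrf_eq1 => /orP[]/eqP ->.
  congr integral2; apply/funext => -[x y] /=; congr f; rewrite /rotation/=.
  by congr (_, _); ring.
(* The half-turn has no such factorization: it is the square of a quarter-turn. *)
have q : ((0 : R) ^+ 2 + 1 ^+ 2 = 1)%R by ring.
have -> : f \o rotation (-1) 0 = (f \o rotation 0 1) \o rotation 0 1.
  apply/funext => -[x y] /=; congr f; rewrite /rotation/=.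
  by congr (_, _); ring.
have mr := measurableT_comp mf (@measurable_rotation 0 1).
rewrite (integral2_rotation_neq0 mr (fun z => f0 _) q (oner_neq0 R)).
exact: (integral2_rotation_neq0 mf f0 q (oner_neq0 R)).
Qed.

Let gamma2E (A : set (R * R)) : measurable A ->
  (gamma \x gamma) A = integral2 (fun z => (\1_A z)%:E * (phi z.1 * phi z.2)%:E).
Proof.
move=> mA; rewrite /product_measure1.
rewrite (@ge0_integral_normal R 0 1 (gamma \o xsection A)); last 2 first.
- exact: (@measurable_fun_xsection _ _ (measurableTypeR R) (measurableTypeR R) R gamma A mA).
- by move=> x; exact: measure_ge0.
apply: eq_integral => x _ /=.
have mAx := measurable_xsection x mA.
rewrite (normal_probE 0 1 mAx) -ge0_integralZr//; last 3 first.
- apply: emeasurable_funM; apply/measurable_EFinP; first exact: measurable_indic.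
  exact: measurable_normal_pdf.
- by move=> y _; rewrite mule_ge0// lee_fin ?normal_pdf_ge0.
- by rewrite lee_fin normal_pdf_ge0.
apply: eq_integral => y _.
rewrite [(phi x * _)%R]mulrC EFinM muleA; congr (_ * _ * _).
by rewrite !indicE mem_xsection.
Qed.

(** The joint density only depends on the norm, and a rotation is a product of
    shears, each of which preserves the Lebesgue measure by Tonelli and
    invariance under translations. *)
Lemma normal_prob_rotation (c s : R) (A : set (R * R)) :
  (c ^+ 2 + s ^+ 2 = 1)%R -> measurable A ->
  (gamma \x gamma) (rotation c s @^-1` A) = (gamma \x gamma) A.
Proof.
move=> cs mA.
have mrA : measurable (rotation c s @^-1` A).
  by rewrite -[X in measurable X]setTI; exact: measurable_rotation.
rewrite (gamma2E mrA) (gamma2E mA).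
pose F (z : R * R) := (\1_A z)%:E * (phi z.1 * phi z.2)%:E.
have mF : measurable_fun [set: R * R] F.
  apply: emeasurable_funM; apply/measurable_EFinP; first exact: measurable_indic.
  apply: measurable_funM.
    exact: (measurableT_comp (measurable_normal_pdf 0 1) measurable_fst).
  exact: (measurableT_comp (measurable_normal_pdf 0 1) measurable_snd).
have F0 z : 0 <= F z.
  by rewrite /F -EFinM lee_fin mulr_ge0// mulr_ge0//; exact: normal_pdf_ge0.
transitivity (integral2 (F \o rotation c s)); last exact: integral2_rotation.
congr integral2; apply/funext => z; rewrite /F /comp; congr (_ * _); congr (_%:E).
rewrite !std_normal_pdfE mulrACA [RHS]mulrACA -!expRD.
congr (_ * expR _)%R; rewrite /rotation/=.
rewrite -!mulrDl -!opprD; congr (- _ / _)%R.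
transitivity ((c ^+ 2 + s ^+ 2) * (z.1 ^+ 2 + z.2 ^+ 2))%R; last by ring.
by rewrite cs mul1r.
Qed.

End rotation.

(** * Independence and null events *)

Section independence.
Context {R : realType} d (T : measurableType d) (P : probability T R).
Local Open Scope ereal_scope.
Implicit Types (G H : set (set T)).

Definition indep_sets G H :=
  forall A B, G A -> H B -> P (A `&` B) = P A * P B.

Lemma indep_setsC G H : indep_sets G H -> indep_sets H G.
Proof. by move=> GH A B HA GB; rewrite setIC GH// muleC. Qed.

Lemma sigma_measurable G : G `<=` measurable -> <<s G >> `<=` measurable.
Proof. by apply: smallest_sub; exact: sigma_algebra_measurable. Qed.

Lemma eq_prob_sigma (m1 m2 : {measure set T -> \bar R}) G :
  setI_closed G -> G setT -> G `<=` measurable ->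
  (forall A, G A -> m1 A = m2 A) -> m1 setT < +oo ->
  forall A, <<s G >> A -> m1 A = m2 A.
Proof.
move=> GI GT Gm m12 m1T.
apply: (g_sigma_algebra_measure_unique G Gm (fun=> setT)) => //.
by rewrite bigcup_const.
Qed.

(** For fixed [B], both [A |-> P (A `&` B)] and [A |-> P A * P B] are finite
    measures, so they agree as soon as they do on a generating pi-system. *)
Lemma indep_sigmal G H : setI_closed G -> G setT ->
  G `<=` measurable -> H `<=` measurable ->
  indep_sets G H -> indep_sets <<s G >> H.
Proof.
move=> GI GT Gm Hm GH A B sA HB.
have mB : measurable B := Hm _ HB.
have PBf : P B = (fine (P B))%:E by rewrite fineK// fin_num_measure.
have PB0 : (0 <= fine (P B))%R by rewrite fine_ge0.
rewrite muleC PBf.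
apply: (@eq_prob_sigma (mrestr P mB) (mscale (NngNum PB0) P) G) => //.
- by move=> C GC; transitivity (P C * P B); [exact: GH|rewrite muleC {1}PBf].
- suff: P (setT `&` B) < +oo by [].
  by rewrite setTI ltey_eq fin_num_measure.
Qed.

Lemma indep_sigma G H : setI_closed G -> G setT -> G `<=` measurable ->
  setI_closed H -> H setT -> H `<=` measurable ->
  indep_sets G H -> indep_sets <<s G >> <<s H >>.
Proof.
move=> GI GT Gm HI HT Hm GH.
apply: indep_sigmal => //; first exact: sigma_measurable.
by apply/indep_setsC/indep_sigmal => //; exact: indep_setsC.
Qed.

(** Inductive, so that the finitely many times on which an intersection of
    increment events depends can be collected by induction. *)
Inductive pi_closure G : set T -> Prop :=
| pi_closureT : pi_closure G setT
| pi_closureI A B : G A -> pi_closure G B -> pi_closure G (A `&` B).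

Lemma pi_closure_setI G : setI_closed (pi_closure G).
Proof.
move=> A B + pB; elim=> [|C D GC _ IH]; first by rewrite setTI.
by rewrite -setIA; exact: pi_closureI.
Qed.

Lemma sub_pi_closure G : G `<=` pi_closure G.
Proof. by move=> A GA; rewrite -(setIT A); apply: pi_closureI => //; exact: pi_closureT. Qed.

Lemma pi_closure_measurable G : G `<=` measurable -> pi_closure G `<=` measurable.
Proof. by move=> Gm A; elim=> [//|C D GC _ IH]; apply: measurableI => //; exact: Gm. Qed.

Definition null_events : set (set T) := [set N | measurable N /\ P N = 0].

(** It suffices to intersect the members of a generating pi-system with null or
    conull events, and such an intersection either has probability zero or that
    of the original event. *)
Lemma indep_sigma_null G H : G `<=` measurable -> H `<=` measurable ->
  indep_sets (pi_closure G) (pi_closure H) ->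
  indep_sets <<s G `|` null_events >> <<s H `|` null_events >>.
Proof.
move=> Gm Hm GH.
pose triv M := measurable M /\ (P M = 0 \/ P (~` M) = 0).
pose ext K := [set A | exists B M, [/\ pi_closure K B, triv M & A = B `&` M]].
have trivT : triv setT by split => //; right; rewrite setCT measure0.
have trivI M N : triv M -> triv N -> triv (M `&` N).
  move=> [mM M01] [mN N01]; split; first exact: measurableI.
  case: M01 => [M0|M0].
    left; apply: (subset_measure0 _ mM _ M0) => //; exact: measurableI.
  case: N01 => [N0|N0].
    left; apply: (subset_measure0 _ mN _ N0) => //; exact: measurableI.
  right; rewrite setCI; apply/eqP; rewrite eq_le measure_ge0 andbT.
  rewrite (le_trans (measureU2 _ _ _))//; [exact: measurableC|exact: measurableC|].
  by rewrite [X in X + _]M0 [X in _ + X]N0 adde0.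
have extI K : setI_closed (ext K).
  move=> _ _ [A [M [KA tM ->]]] [B [N [KB tN ->]]].
  exists (A `&` B), (M `&` N); split; rewrite 1?setIACA//.
    exact: pi_closure_setI.
  exact: trivI.
have extT K : ext K setT.
  by exists setT, setT; split; rewrite ?setIT//; exact: pi_closureT.
have extm K : K `<=` measurable -> ext K `<=` measurable.
  move=> mK _ [A [M [KA [mM _] ->]]]; apply: measurableI => //.
  exact: pi_closure_measurable KA.
have sub K : K `<=` measurable -> <<s K `|` null_events >> `<=` <<s ext K >>.
  move=> mK; apply: smallest_sub; first exact: smallest_sigma_algebra.
  move=> A [KA|[mA A0]]; apply: sub_sigma_algebra.
    by exists A, setT; split; rewrite ?setIT//; exact: sub_pi_closure.
  exists setT, A; split; rewrite ?setTI//; first exact: pi_closureT.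
  by split => //; left.
have PI A M : measurable A -> triv M ->
    P (A `&` M) = if P M == 0 then 0 else P A.
  move=> mA [mM [M0|M0]].
    rewrite M0 eqxx; apply: (subset_measure0 _ mM _ M0) => //.
    exact: measurableI.
  have PM : P M = 1.
    by have := probability_setC P mM; rewrite M0 => /esym/eqP;
       rewrite sube_eq ?fin_num_measure// add0e => /eqP.
  rewrite PM onee_eq0; apply/eqP; rewrite eq_le measureIl//=.
  rewrite -[X in P X <= _](setIT A) -(setUv M) setIUr.
  rewrite (le_trans (measureU2 _ _ _))//; [exact: measurableI|
    by apply: measurableI => //; exact: measurableC|].
  rewrite [X in _ + X](subset_measure0 (A := A `&` ~` M) (B := ~` M))// ?adde0//.
    by apply: measurableI => //; exact: measurableC.
  exact: measurableC.
suff : indep_sets <<s ext G >> <<s ext H >>.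
  by move=> I A B /(sub _ Gm) sA /(sub _ Hm) sB; exact: I.
apply: indep_sigma; [exact: extI|exact: extT|exact: extm|exact: extI|
  exact: extT|exact: extm|].
move=> _ _ [A [M [GA tM ->]]] [B [N [HB tN ->]]].
have mA := pi_closure_measurable Gm GA.
have mB := pi_closure_measurable Hm HB.
rewrite setIACA (PI _ _ (measurableI _ _ mA mB) (trivI _ _ tM tN)).
rewrite (PI _ _ tM.1 tN) (PI _ _ mA tM) (PI _ _ mB tN).
have [PN|PN] := eqVneq (P N) 0; first by rewrite eqxx mule0.
have [PM|PM] := eqVneq (P M) 0; first by rewrite mul0e.
by rewrite GH.
Qed.

End independence.

(** * Independent families *)

Section independent_families.
Context {R : realType} d (T : measurableType d) (P : probability T R).
Local Open Scope ereal_scope.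
Implicit Types (C L K : nat -> set (set T)).

Definition indep_family n C := forall A : nat -> set T,
  (forall i, (i < n)%N -> C i (A i)) ->
  P (\big[setI/setT]_(i < n) A i) = \prod_(i < n) P (A i).

(** The generators are replaced by the sigma-algebras one index at a time, the
    other factors being kept fixed. *)
Lemma indep_family_sigma n C : (forall i, setI_closed (C i)) ->
  (forall i, C i setT) -> (forall i, C i `<=` measurable) ->
  indep_family n C -> indep_family n (fun i => <<s C i >>).
Proof.
move=> CI CT Cm indC.
suff H : forall j, (j <= n)%N ->
    indep_family n (fun i => if (i < j)%N then <<s C i >> else C i).
  by move=> A sA; apply: (H n) => // i ni; rewrite ni; exact: sA.
elim=> [_|j IH jn]; first by [].
move=> A sA; pose j' := Ordinal jn.
have mA i : (i < n)%N -> measurable (A i).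
  move=> /sA; case: ifP => _; last exact: Cm.
  exact: sigma_measurable.
pose rest := \big[setI/setT]_(i < n | i != j') A i.
have mrest : measurable rest by apply: bigsetI_measurable => i _; exact: mA.
pose c := \prod_(i < n | i != j') P (A i).
have c0 : 0 <= c by apply: prode_ge0 => i _.
have cf : c \is a fin_num.
  rewrite /c; apply: (big_ind (fun x : \bar R => x \is a fin_num)) => //.
    by move=> x y; exact: fin_numM.
  by move=> i _; apply: fin_num_measure; exact: mA.
rewrite (bigD1 j')//= [in RHS](bigD1 j')//= -/rest -/c.
have fc0 : (0 <= fine c)%R by exact: fine_ge0.
rewrite [RHS]muleC -[in RHS](fineK cf).
apply: (@eq_prob_sigma _ _ _ (mrestr P mrest) (mscale (NngNum fc0) P) (C j)) => //.
- move=> X CX; suff: P (X `&` rest) = c * P X by rewrite -{1}(fineK cf).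
  pose A' i := if i == j then X else A i.
  have : P (\big[setI/setT]_(i < n) A' i) = \prod_(i < n) P (A' i).
    apply: (IH (ltnW jn)) => i ni; rewrite /A'.
    case: eqVneq => [->|ij]; first by rewrite ltnn.
    by have := sA i ni; rewrite ltnS leq_eqVlt (negbTE ij).
  rewrite (bigD1 j')//= [X in _ = X -> _](bigD1 j')//=.
  have -> : A' j = X by rewrite /A' eqxx.
  have -> : \big[setI/setT]_(i < n | i != j') A' i = rest.
    by apply: eq_bigr => i; rewrite /A' -val_eqE/= => /negbTE ->.
  have -> : \prod_(i < n | i != j') P (A' i) = c.
    by apply: eq_bigr => i; rewrite /A' -val_eqE/= => /negbTE ->.
  by rewrite muleC.
- suff: P (setT `&` rest) < +oo by [].
  by rewrite setTI ltey_eq fin_num_measure.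
- by have := sA j jn; rewrite ltnSn.
Qed.

Definition rectangles n C : set (set T) :=
  [set X | exists2 A : nat -> set T, (forall i, (i < n)%N -> C i (A i)) &
     X = \big[setI/setT]_(i < n) A i].

Lemma rectangles_setI n C : (forall i, setI_closed (C i)) -> setI_closed (rectangles n C).
Proof.
move=> CI _ _ [A CA ->] [B CB ->]; exists (fun i => A i `&` B i).
  by move=> i ni; apply: CI; [exact: CA|exact: CB].
by rewrite big_split.
Qed.

Lemma rectangles_setT n C : (forall i, C i setT) -> rectangles n C setT.
Proof. by move=> CT; exists (fun=> setT) => //; rewrite big1. Qed.

Lemma rectangles_measurable n C :
  (forall i, C i `<=` measurable) -> rectangles n C `<=` measurable.
Proof.
by move=> Cm _ [A CA ->]; apply: bigsetI_measurable => i _; apply/Cm/CA.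
Qed.

Lemma sub_rectangles n C i : (forall i, C i setT) -> (i < n)%N -> C i `<=` rectangles n C.
Proof.
move=> CT ni A CA; exists (fun j => if j == i then A else setT).
  by move=> j _; case: eqVneq => [->//|_]; exact: CT.
rewrite (bigD1 (Ordinal ni))//= eqxx big1 ?setIT// => j.
by rewrite -val_eqE/= => /negbTE ->.
Qed.

(** The rectangles form pi-systems, and the probability of the intersection of
    two rectangles factorizes first over the indices, then inside each of them. *)
Lemma indep_family_split n K L M :
  (forall i, setI_closed (K i)) -> (forall i, K i `<=` measurable) ->
  (forall i, L i `<=` K i) -> (forall i, M i `<=` K i) ->
  (forall i, setI_closed (L i)) -> (forall i, setI_closed (M i)) ->
  (forall i, L i setT) -> (forall i, M i setT) ->
  (forall i, (i < n)%N -> indep_sets P (L i) (M i)) ->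
  indep_family n K -> indep_sets P <<s rectangles n L >> <<s rectangles n M >>.
Proof.
move=> KI Km LK MK LI MI LT MT LM indK.
apply: indep_sigma.
- exact: rectangles_setI.
- exact: rectangles_setT.
- by apply: rectangles_measurable => i; exact: (subset_trans (LK i)).
- exact: rectangles_setI.
- exact: rectangles_setT.
- by apply: rectangles_measurable => i; exact: (subset_trans (MK i)).
move=> _ _ [A LA ->] [B MB ->].
rewrite -big_split/= (indK (fun i => A i `&` B i)); last first.
  by move=> i ni; apply: KI; [exact/LK/LA|exact/MK/MB].
rewrite (indK A); last by move=> i ni; exact/LK/LA.
rewrite (indK B); last by move=> i ni; exact/MK/MB.
rewrite -big_split/=; apply: eq_bigr => i _.
by apply: LM => //; [exact: LA|exact: MB].
Qed.

End independent_families.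

(** * Gaussian variables *)

Section gaussian_variables.
Context {R : realType} d (T : measurableType d) (P : probability T R).
Notation gamma := (normal_prob (0 : R) 1).
Local Open Scope ereal_scope.
Implicit Types (U V X : T -> R) (D E : set R).

Definition centered_gaussian X (v : R) :=
  forall D, measurable D -> P (X @^-1` D) = normal_law 0 v D.

Definition indep_vars U V := forall D E, measurable D -> measurable E ->
  P (U @^-1` D `&` V @^-1` E) = P (U @^-1` D) * P (V @^-1` E).

Lemma centered_gaussianE X (v : R) D : (0 <= v)%R -> measurable D ->
  centered_gaussian X v ->
  P (X @^-1` D) = gamma [set x | D (Num.sqrt v * x)%R].
Proof.
move=> v0 mD /(_ D mD) ->; rewrite normal_lawE//.
by congr (gamma _); apply/seteqP; split=> x /=; rewrite add0r.
Qed.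

Lemma measurable_scale_preimage (r : R) D : measurable D ->
  measurable [set x : R | D (r * x)%R].
Proof.
move=> mD; rewrite (_ : [set x | _] = (fun x => r * x)%R @^-1` D)//.
rewrite -[X in measurable X]setTI.
have mr : measurable_fun [set: R] (fun x : R => r * x)%R.
  exact: measurable_funM.
exact: mr.
Qed.

Lemma normal_prob2E D E : measurable D -> measurable E ->
  (gamma \x gamma) (D `*` E) = gamma D * gamma E.
Proof. by move=> mD mE; rewrite product_measure1E. Qed.

(** Independent variables have a product law, which rectangles determine. *)
Lemma indep_gaussian_joint U V (u v : R) (A : set (R * R)) :
  measurable_fun [set: T] U -> measurable_fun [set: T] V ->
  (0 <= u)%R -> (0 <= v)%R ->
  centered_gaussian U u -> centered_gaussian V v -> indep_vars U V ->
  measurable A ->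
  P [set w | A (U w, V w)] =
  (gamma \x gamma) [set z | A (Num.sqrt u * z.1, Num.sqrt v * z.2)%R].
Proof.
move=> mU mV u0 v0 Uu Vv UV mA.
have mUV : measurable_fun [set: T] (fun w => (U w, V w)) by apply/measurable_fun_pair.
pose sc (z : R * R) := (Num.sqrt u * z.1, Num.sqrt v * z.2)%R.
have msc : measurable_fun [set: R * R] sc.
  by apply/measurable_fun_pair; apply: measurable_funM.
pose G : set (set (R * R)) :=
  [set X | exists D E, [/\ measurable D, measurable E & X = D `*` E]].
have GI : setI_closed G.
  move=> _ _ [D [E [mD mE ->]]] [D' [E' [mD' mE' ->]]].
  exists (D `&` D'), (E `&` E'); split; [exact: measurableI|exact: measurableI|].
  by rewrite setXI.
have GT : G setT by exists setT, setT; rewrite setXTT.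
have Gm : G `<=` measurable.
  by move=> _ [D [E [mD mE ->]]]; exact: measurableX.
have := @eq_prob_sigma R _ _ (image_measure P mUV)
  (image_measure (gamma \x gamma) msc) G GI GT Gm.
apply.
- move=> _ [D [E [mD mE ->]]]; rewrite !image_measureE.
  transitivity (P (U @^-1` D `&` V @^-1` E)); first by [].
  rewrite UV// (centered_gaussianE u0)// (centered_gaussianE v0)//.
  by rewrite -normal_prob2E//; exact: measurable_scale_preimage.
- rewrite image_measureE preimage_setT -[X in X < _]/(P setT).
  by rewrite probability_setT ltey.
- move: mA; rewrite measurable_prod_measurableType.
  apply: sub_sigma_algebra2 => _ [D mD [E mE <-]]; by exists D, E.
Qed.

Lemma measurable_joint_lin (p q : R) D : measurable D ->
  measurable [set z : R * R | D (p * z.1 + q * z.2)%R].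
Proof.
move=> mD.
have mf : measurable_fun [set: R * R] (fun z : R * R => p * z.1 + q * z.2)%R.
  by apply: measurable_funD; apply: measurable_funM.
by rewrite -[X in measurable X]setTI; exact: mf.
Qed.

Lemma measurable_fun_lin U V (p q : R) :
  measurable_fun [set: T] U -> measurable_fun [set: T] V ->
  measurable_fun [set: T] (fun w => p * U w + q * V w)%R.
Proof. by move=> mU mV; apply: measurable_funD; apply: measurable_funM. Qed.

(** Up to the factor [r], [p * z.1 + q * z.2] is the first coordinate of a
    rotated point. *)
Lemma normal_prob2_proj1 (r p q : R) D : (p ^+ 2 + q ^+ 2 = r ^+ 2)%R -> (0 <= r)%R ->
  measurable D ->
  (gamma \x gamma) [set z | D (p * z.1 + q * z.2)%R] = gamma [set x | D (r * x)%R].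
Proof.
move=> pqr r0 mD.
have mrD := measurable_scale_preimage r mD.
have E : (gamma \x gamma) ([set x | D (r * x)%R] `*` setT) = gamma [set x | D (r * x)%R].
  have gT : gamma setT = 1 by exact: probability_setT.
  transitivity (gamma [set x | D (r * x)%R] * gamma setT).
    exact: normal_prob2E.
  by rewrite gT mule1.
rewrite -E; have [rn0|rn0] := eqVneq r 0%R.
  have [-> ->] : p = 0%R /\ q = 0%R.
    move/eqP: pqr; rewrite rn0 expr0n paddr_eq0 ?sqr_ge0// !sqrf_eq0.
    by move=> /andP[/eqP-> /eqP->].
  congr ((gamma \x gamma) _).
  by apply/seteqP; split => -[x y] /=; rewrite rn0 !mul0r addr0// => -[].
have cs : ((p / r) ^+ 2 + (- q / r) ^+ 2 = 1)%R.
  by rewrite !exprMn sqrrN -mulrDl pqr exprVn divff// expf_neq0.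
rewrite -(normal_prob_rotation cs (measurableX mrD measurableT)).
congr ((gamma \x gamma) _); apply/seteqP; split => -[x y];
  rewrite /rotation /=; have -> : (r * (p / r * x - - q / r * y) = p * x + q * y)%R by field.
  by [].
by case.
Qed.

(** A linear combination of two independent centered Gaussian variables is a
    coordinate of a rotation of a pair of independent standard ones. *)
Lemma centered_gaussian_lin U V (u v p q : R) :
  measurable_fun [set: T] U -> measurable_fun [set: T] V ->
  (0 <= u)%R -> (0 <= v)%R ->
  centered_gaussian U u -> centered_gaussian V v -> indep_vars U V ->
  centered_gaussian (fun w => p * U w + q * V w)%R (p ^+ 2 * u + q ^+ 2 * v).
Proof.
move=> mU mV u0 v0 Uu Vv UV D mD.
have w0 : (0 <= p ^+ 2 * u + q ^+ 2 * v)%R.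
  by rewrite addr_ge0// mulr_ge0// sqr_ge0.
rewrite normal_lawE//.
have -> : P ((fun w => p * U w + q * V w)%R @^-1` D) =
    P [set w | [set z | D (p * z.1 + q * z.2)%R] (U w, V w)] by [].
rewrite (indep_gaussian_joint mU mV u0 v0 Uu Vv UV (measurable_joint_lin p q mD)).
have := @normal_prob2_proj1 (Num.sqrt (p ^+ 2 * u + q ^+ 2 * v))
  (p * Num.sqrt u) (q * Num.sqrt v) D.
rewrite !exprMn !sqr_sqrtr// => /(_ erefl (sqrtr_ge0 _) mD) E.
transitivity (gamma [set x | D (Num.sqrt (p ^+ 2 * u + q ^+ 2 * v) * x)%R]).
  rewrite -E; congr ((gamma \x gamma) _); apply/seteqP; split => z /=;
  by rewrite !mulrA.
by congr (gamma _); apply/seteqP; split=> x /=; rewrite add0r.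
Qed.

(** Two independent Gaussian variables with a common variance are multiples of
    standard ones, and the combinations are the coordinates of a rotation. *)
Lemma indep_rotation U V (a b v : R) :
  measurable_fun [set: T] U -> measurable_fun [set: T] V ->
  (0 < a ^+ 2 + b ^+ 2)%R -> (0 <= v)%R ->
  centered_gaussian U v -> centered_gaussian V v -> indep_vars U V ->
  indep_vars (fun w => a * U w + b * V w)%R (fun w => - b * U w + a * V w)%R.
Proof.
move=> mU mV ab0 v0 Uv Vv UV D E mD mE.
set r := Num.sqrt (a ^+ 2 + b ^+ 2).
have r2 : (r ^+ 2 = a ^+ 2 + b ^+ 2)%R by rewrite sqr_sqrtr// ltW.
have r0 : r != 0%R by rewrite gt_eqF// sqrtr_gt0.
have w0 : (0 <= (a ^+ 2 + b ^+ 2) * v)%R by rewrite mulr_ge0// ltW.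
have sw : (Num.sqrt ((a ^+ 2 + b ^+ 2) * v) = r * Num.sqrt v)%R.
  by rewrite sqrtrM// ltW.
have G1 := centered_gaussian_lin a b mU mV v0 v0 Uv Vv UV.
have G2 := centered_gaussian_lin (- b) a mU mV v0 v0 Uv Vv UV.
move: G1 G2; rewrite sqrrN [X in _ -> centered_gaussian _ X -> _]addrC -!mulrDl.
move=> G1 G2.
rewrite (centered_gaussianE w0 mD G1) (centered_gaussianE w0 mE G2) sw.
set D' := [set x | D _]; set E' := [set x | E _].
have mD' : measurable D' by exact: measurable_scale_preimage.
have mE' : measurable E' by exact: measurable_scale_preimage.
rewrite -normal_prob2E//.
pose A := [set z : R * R | D (a * z.1 + b * z.2)%R] `&`
          [set z : R * R | E (- b * z.1 + a * z.2)%R].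
have mA : measurable A by apply: measurableI; exact: measurable_joint_lin.
transitivity (P [set w | A (U w, V w)]); first by [].
rewrite (indep_gaussian_joint mU mV v0 v0 Uv Vv UV mA).
have cs : ((a / r) ^+ 2 + (- b / r) ^+ 2 = 1)%R.
  by rewrite !exprMn sqrrN -mulrDl -r2 exprVn divff// expf_neq0.
rewrite -(normal_prob_rotation cs (measurableX mD' mE')).
congr ((gamma \x gamma) _); apply/funext => -[x y].
rewrite /A /D' /E' /rotation /preimage /mkset /setI /setX /mkset /=.
set q := Num.sqrt v.
have -> : (r * q * (a / r * x - - b / r * y) = a * (q * x) + b * (q * y))%R by field.
by have -> : (r * q * (- b / r * x + a / r * y) = - b * (q * x) + a * (q * y))%R by field.
Qed.

Lemma centered_gaussian0 : centered_gaussian (cst 0%R) 0.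
Proof.
move=> D mD; rewrite /normal_law eqxx diracE.
have [/set_mem D0|nD0] := boolP (0%R \in D).
  by rewrite preimage_cst mem_set// probability_setT.
by rewrite preimage_cst (negbTE nD0) measure0.
Qed.

(** By induction: the partial sum of the first [m] terms lives on the first [m]
    systems, hence is independent of the next term. *)
Lemma centered_gaussian_sum n (K : nat -> set (set T)) (X : nat -> T -> R)
    (v : nat -> R) :
  (forall i, setI_closed (K i)) -> (forall i, K i setT) ->
  (forall i, K i `<=` measurable) -> indep_family P n K ->
  (forall i D, (i < n)%N -> measurable D -> K i (X i @^-1` D)) ->
  (forall i, (i < n)%N -> (0 <= v i)%R) ->
  (forall i, (i < n)%N -> centered_gaussian (X i) (v i)) ->
  centered_gaussian (fun w => \sum_(i < n) X i w)%R (\sum_(i < n) v i)%R.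
Proof.
move=> KI KT Km indK KX v0 Xv.
have mX i : (i < n)%N -> measurable_fun [set: T] (X i).
  by move=> ni _ D mD; rewrite setTI; apply: (Km i); exact: KX.
suff H m : (m <= n)%N ->
  centered_gaussian (fun w => \sum_(i < m) X i w)%R (\sum_(i < m) v i)%R by exact: H.
elim: m => [_|m IH mn].
  rewrite big_ord0 (_ : (fun _ => _) = cst 0%R); first exact: centered_gaussian0.
  by apply/funext => w; rewrite big_ord0.
have mn' := ltnW mn.
pose L i := if (i < m)%N then K i else [set setT].
pose M i := if i == m then K i else [set setT].
have LK i : L i `<=` K i by rewrite /L; case: ifP => _ A// ->; exact: KT.
have MK i : M i `<=` K i by rewrite /M; case: ifP => _ A// ->; exact: KT.
have oneI : setI_closed [set setT : set T] by move=> _ _ -> ->; rewrite setIT.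
have LI i : setI_closed (L i) by rewrite /L; case: ifP.
have MI i : setI_closed (M i) by rewrite /M; case: ifP.
have LT i : L i setT by rewrite /L; case: ifP => // _; exact: KT.
have MT i : M i setT by rewrite /M; case: ifP => // _; exact: KT.
have LM i : (i < n)%N -> indep_sets P (L i) (M i).
  move=> ni A B; rewrite /L /M; case: ltngtP => [im|im|im].
  - by move=> _ ->; rewrite setIT probability_setT mule1.
  - by move=> -> ->; rewrite setIT probability_setT mule1.
  - by move=> -> _; rewrite setTI probability_setT mul1e.
have ind := indep_family_split KI Km LK MK LI MI LT MT LM indK.
pose SL := rectangles n L; pose SM := rectangles n M.
have mS : measurable_fun [set: g_sigma_algebraType SL] (fun w => \sum_(i < m) X i w)%R.
  apply: measurable_sum => i _ D mD; rewrite setTI.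
  apply: sub_sigma_algebra; apply: (@sub_rectangles _ _ _ _ i) => //.
    by rewrite (leq_trans _ mn')//.
  by rewrite /L ltn_ord; apply: KX => //; rewrite (leq_trans _ mn').
have mXm D : measurable D -> <<s SM >> (X m @^-1` D).
  move=> mD; apply: sub_sigma_algebra; apply: (@sub_rectangles _ _ _ _ m) => //.
  by rewrite /M eqxx; exact: KX.
have mSD D : measurable D -> <<s SL >> ((fun w => \sum_(i < m) X i w)%R @^-1` D).
  by move=> mD; have := mS measurableT D mD; rewrite setTI.
have SLm : <<s SL >> `<=` measurable.
  by apply: sigma_measurable; apply: rectangles_measurable => i; exact: (subset_trans (LK i)).
rewrite big_ord_recr/=.
have -> : (fun w => \sum_(i < m.+1) X i w)%R =
   (fun w => 1 * (\sum_(i < m) X i w) + 1 * X m w)%R.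
  by apply/funext => w; rewrite big_ord_recr/= !mul1r.
have -> : (\sum_(i < m) v i + v m =
    1 ^+ 2 * (\sum_(i < m) v i) + 1 ^+ 2 * v m)%R by rewrite expr1n !mul1r.
apply: centered_gaussian_lin.
- by move=> _ D mD; rewrite setTI; apply: SLm; exact: mSD.
- exact: mX.
- by apply: sumr_ge0 => i _; apply: v0; rewrite (leq_trans _ mn').
- exact: v0.
- exact: IH.
- exact: Xv.
- by move=> D E mD mE; apply: ind; [exact: mSD|exact: mXm].
Qed.

End gaussian_variables.

(** * Grids of times *)

Section grids.
Context {R : realType}.
Implicit Types (s : seq R) (g : R -> R).

(** The time 0 is added, so that there are exactly [size s] cells; repeated times
    give cells of length zero. *)
Definition grid s (i : nat) : R := nth 0 (sort <=%R (0 :: s)) i.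

Lemma size_grid s : size (sort <=%R (0 :: s)) = (size s).+1.
Proof. by rewrite size_sort. Qed.

Lemma gridP s x : x \in 0 :: s -> exists2 p, (p <= size s)%N & x = grid s p.
Proof.
rewrite -(mem_sort <=%R) => xs; exists (index x (sort <=%R (0 :: s))).
  by rewrite -ltnS -size_grid index_mem.
by rewrite /grid nth_index.
Qed.

Lemma le_grid s i j : (i <= j)%N -> (j <= size s)%N -> grid s i <= grid s j.
Proof.
move=> ij js; apply: (sorted_leq_nth le_trans lexx) => //.
- exact: (sort_sorted le_total).
- by rewrite inE size_grid ltnS (leq_trans ij).
- by rewrite inE size_grid ltnS.
Qed.

Lemma grid_le s i : (i < size s)%N -> grid s i <= grid s i.+1.
Proof. by move=> si; apply: le_grid. Qed.

Lemma grid0_ge0 s : (forall x, x \in s -> 0 <= x) -> 0 <= grid s 0.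
Proof.
move=> s0; have : grid s 0 \in 0 :: s.
  by rewrite -(mem_sort <=%R) mem_nth// size_grid.
by rewrite inE => /predU1P[-> //|]; exact: s0.
Qed.

(** A cell that ends at or before [grid s q] although its index is at least [q]
    has length zero. *)
Lemma grid_telescope_le s g q : (q <= size s)%N ->
  \sum_(i < size s) (grid s i.+1 <= grid s q)%R%:R * (g (grid s i.+1) - g (grid s i)) =
  g (grid s q) - g (grid s 0).
Proof.
move=> qs; rewrite -(big_mkord xpredT (fun i =>
  (grid s i.+1 <= grid s q)%R%:R * (g (grid s i.+1) - g (grid s i)))).
rewrite (@big_cat_nat _ _ _ q)//= [X in _ + X]big1_seq ?addr0; last first.
  move=> i /=; rewrite mem_index_iota => /andP[qi is_].
  have [le|] := boolP (grid s i.+1 <= grid s q); last by rewrite mul0r.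
  have -> : grid s i.+1 = grid s i; last by rewrite subrr mulr0.
  apply/eqP; rewrite eq_le (grid_le is_) andbT (le_trans le)//.
  by apply: le_grid => //; exact: ltnW.
rewrite -(telescope_sumr (fun i => g (grid s i)))//.
rewrite !big_nat; apply: eq_bigr => i /andP[_ iq].
by rewrite le_grid// mul1r.
Qed.

(** The sum is weighted by an indicator rather than restricted to a range of
    indices: the weight is the value of the step function of the interval from [x]
    to [y] at the right end of the cell. *)
Lemma grid_telescope s g x y : x \in 0 :: s -> y \in 0 :: s -> x <= y ->
  \sum_(i < size s) (x < grid s i.+1 <= y)%R%:R * (g (grid s i.+1) - g (grid s i)) =
  g y - g x.
Proof.
move=> /gridP[p ps ->] /gridP[q qs ->] pq.
have -> : g (grid s q) - g (grid s p) =
    g (grid s q) - g (grid s 0) - (g (grid s p) - g (grid s 0)) by ring.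
rewrite -!grid_telescope_le// -sumrB; apply: eq_bigr => i _.
rewrite -mulrBl; congr (_ * _).
have [zp|pz] := leP (grid s i.+1) (grid s p); last by rewrite subr0.
by rewrite (le_trans zp pq) subrr.
Qed.

End grids.

(** * Increments of two independent Brownian motions *)

Lemma bigsetI_ord_bigcap (T : Type) n (A : nat -> set T) :
  \big[setI/setT]_(i < n) A i = \bigcap_(i in [set: 'I_n]) A i.
Proof.
rewrite -bigcap_mkord; apply/seteqP; split => w H i /=.
  by move=> _; exact: (H i (ltn_ord i)).
by move=> ni; exact: (H (Ordinal ni) I).
Qed.

Section brownian_cells.
Context {R : realType} d (T : measurableType d) (P : probability T R).
Variables W W' : R -> {RV P >-> R}.
Hypotheses (bW : brownian_motion W) (bW' : brownian_motion W').
Hypothesis WW' : independent_processes P W W'.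
Local Open Scope ereal_scope.

Definition increment (X : R -> T -> R) (x y : R) (w : T) : R := (X y w - X x w)%R.

Lemma measurable_increment (X : R -> {RV P >-> R}) x y :
  measurable_fun [set: T] (increment X x y).
Proof. exact: measurable_funB. Qed.

Lemma increment_process_events (X : R -> T -> R) x y D : (0 <= x)%R -> (0 <= y)%R ->
  measurable D -> <<s process_events `[0%R, +oo[ X >> (increment X x y @^-1` D).
Proof.
move=> x0 y0 mD; pose G := process_events `[0%R, +oo[ X.
have mX v : (0 <= v)%R -> measurable_fun [set: g_sigma_algebraType G] (X v).
  move=> v0 _ B mB; rewrite setTI; apply: sub_sigma_algebra.
  by exists v; [rewrite /= in_itv/= v0|exists B].
have m : measurable_fun [set: g_sigma_algebraType G] (increment X x y).
  by apply: measurable_funB; exact: mX.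
by have := m measurableT D mD; rewrite setTI.
Qed.

Lemma increment_gaussian (X : R -> {RV P >-> R}) x y : brownian_motion X ->
  (0 <= x)%R -> (x <= y)%R -> centered_gaussian P (increment X x y) (y - x).
Proof. by move=> [_ _ gX _] x0 xy D mD; exact: gX. Qed.

Lemma indep_increments x y x' y' : (0 <= x)%R -> (0 <= y)%R -> (0 <= x')%R ->
  (0 <= y')%R -> indep_vars P (increment W x y) (increment W' x' y').
Proof.
by move=> x0 y0 x0' y0' D E mD mE; apply: WW'; exact: increment_process_events.
Qed.

Section cells.
Variable s : seq R.
Hypothesis s0 : forall x, x \in s -> (0 <= x)%R.

Lemma grid_ge0 i : (i <= size s)%N -> (0 <= grid s i)%R.
Proof. by move=> is_; rewrite (le_trans (grid0_ge0 s0))// le_grid. Qed.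

Definition cell_increment (X : R -> T -> R) i := increment X (grid s i) (grid s i.+1).

Lemma cell_increments_indep (X : R -> {RV P >-> R}) (D : nat -> set R) :
  brownian_motion X -> (forall i, (i < size s)%N -> measurable (D i)) ->
  P (\big[setI/setT]_(i < size s) (cell_increment X i @^-1` D i)) =
  \prod_(i < size s) P (cell_increment X i @^-1` D i).
Proof.
move=> [_ _ _ iX] mD; rewrite (bigsetI_ord_bigcap _ (fun i => cell_increment X i @^-1` D i)).
apply: (iX (size s) (grid s) _ _ (fun i : 'I_(size s) => D i)).
- exact: grid0_ge0.
- exact: grid_le.
- by move=> i; exact: mD.
Qed.

(** Rectangles rather than the whole sigma-algebra: a pi-system on which
    independence of the cells can be read off the hypotheses. *)
Definition cell_events i : set (set T) :=
  [set A | exists D E, [/\ measurable D, measurable E &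
     A = cell_increment W i @^-1` D `&` cell_increment W' i @^-1` E]].

Lemma cell_eventsI i : setI_closed (cell_events i).
Proof.
move=> _ _ [D [E [mD mE ->]]] [D' [E' [mD' mE' ->]]].
exists (D `&` D'), (E `&` E'); split; [exact: measurableI|exact: measurableI|].
by rewrite !preimage_setI setIACA.
Qed.

Lemma cell_eventsT i : cell_events i setT.
Proof. by exists setT, setT; rewrite !preimage_setT setIT. Qed.

Lemma cell_events_measurable i : cell_events i `<=` measurable.
Proof.
move=> _ [D [E [mD mE ->]]].
by apply: measurableI; rewrite -[X in measurable X]setTI; exact: measurable_increment.
Qed.

(** Independence of [W] and [W'] separates the two intersections, independence of
    increments separates the cells, and each factor is put together again. *)
Lemma indep_cell_events : indep_family P (size s) cell_events.
Proof.
move=> A cA.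
have /choice[F HF] : forall i, exists DE : set R * set R, (i < size s)%N ->
   [/\ measurable DE.1, measurable DE.2 &
    A i = cell_increment W i @^-1` DE.1 `&` cell_increment W' i @^-1` DE.2].
  move=> i; have [is_|_] := ltnP i (size s); last by exists (setT, setT).
  by have [D [E H]] := cA i is_; exists (D, E).
have AE (i : 'I_(size s)) : A i =
    cell_increment W i @^-1` (F i).1 `&` cell_increment W' i @^-1` (F i).2.
  by have [] := HF i (ltn_ord i).
have mF1 i : (i < size s)%N -> measurable (F i).1 by move=> /HF[].
have mF2 i : (i < size s)%N -> measurable (F i).2 by move=> /HF[].
have sI (X : R -> T -> R) (D : nat -> set R) :
    (forall i, (i < size s)%N -> measurable (D i)) ->
    <<s process_events `[0%R, +oo[ X >>
      (\big[setI/setT]_(i < size s) (cell_increment X i @^-1` D i)).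
  move=> mD; pose TX := g_sigma_algebraType (process_events `[0%R, +oo[ X).
  suff : @measurable _ TX (\big[setI/setT]_(i < size s) (cell_increment X i @^-1` D i)) by [].
  apply: bigsetI_measurable => i _; apply: increment_process_events.
  - by apply: grid_ge0; exact: ltnW.
  - exact: grid_ge0.
  - exact: mD.
under eq_bigr do rewrite AE.
under [in RHS]eq_bigr do rewrite AE.
rewrite big_split/= (WW' (sI W _ mF1) (sI W' _ mF2)).
rewrite (cell_increments_indep bW mF1) (cell_increments_indep bW' mF2).
rewrite -big_split/=; apply: eq_bigr => i _.
rewrite indep_increments//; by [exact: mF1|exact: mF2|exact/grid_ge0/ltnW|exact: grid_ge0].
Qed.

Definition cell_sigma i := <<s cell_events i >>.

Lemma cell_sigma_measurable i : cell_sigma i `<=` measurable.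
Proof. by apply: sigma_measurable; exact: cell_events_measurable. Qed.

Lemma cell_sigmaI i : setI_closed (cell_sigma i).
Proof. by move=> A B; exact: (@measurableI _ (g_sigma_algebraType (cell_events i))). Qed.

Lemma cell_sigmaT i : cell_sigma i setT.
Proof. exact: (@measurableT _ (g_sigma_algebraType (cell_events i))). Qed.

Lemma indep_cell_sigma : indep_family P (size s) cell_sigma.
Proof.
apply: indep_family_sigma; [exact: cell_eventsI|exact: cell_eventsT|
  exact: cell_events_measurable|exact: indep_cell_events].
Qed.

Lemma cell_sigma_lin i (p q : R) D : measurable D ->
  cell_sigma i ((fun w => p * cell_increment W i w + q * cell_increment W' i w)%R @^-1` D).
Proof.
move=> mD; pose TX := g_sigma_algebraType (cell_events i).
have m1 : measurable_fun [set: TX] (cell_increment W i).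
  move=> _ E mE; rewrite setTI; apply: sub_sigma_algebra.
  by exists E, setT; rewrite preimage_setT setIT.
have m2 : measurable_fun [set: TX] (cell_increment W' i).
  move=> _ E mE; rewrite setTI; apply: sub_sigma_algebra.
  by exists setT, E; rewrite preimage_setT setTI.
have m : measurable_fun [set: TX]
    (fun w => p * cell_increment W i w + q * cell_increment W' i w)%R.
  exact: measurable_fun_lin.
by have := m measurableT D mD; rewrite setTI.
Qed.

Lemma cell_gaussian_lin i (p q : R) : (i < size s)%N ->
  centered_gaussian P (fun w => p * cell_increment W i w + q * cell_increment W' i w)%R
   ((p ^+ 2 + q ^+ 2) * (grid s i.+1 - grid s i))%R.
Proof.
move=> is_; have d0 : (0 <= grid s i.+1 - grid s i)%R by rewrite subr_ge0 grid_le.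
have g0 := grid_ge0 (ltnW is_); have g1 := grid_ge0 is_.
rewrite mulrDl; apply: centered_gaussian_lin => //.
- exact: measurable_increment.
- exact: measurable_increment.
- by apply: increment_gaussian => //; exact: grid_le.
- by apply: increment_gaussian => //; exact: grid_le.
- exact: indep_increments.
Qed.

Lemma grid_gaussian (al be : nat -> R) :
  centered_gaussian P (fun w => \sum_(i < size s)
     (al i * cell_increment W i w + be i * cell_increment W' i w))%R
   (\sum_(i < size s) (al i ^+ 2 + be i ^+ 2) * (grid s i.+1 - grid s i))%R.
Proof.
apply: (centered_gaussian_sum (K := cell_sigma)
  (X := fun i w => (al i * cell_increment W i w + be i * cell_increment W' i w)%R)
  (v := fun i => ((al i ^+ 2 + be i ^+ 2) * (grid s i.+1 - grid s i))%R)).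
- exact: cell_sigmaI.
- exact: cell_sigmaT.
- exact: cell_sigma_measurable.
- exact: indep_cell_sigma.
- by move=> i D _; exact: cell_sigma_lin.
- move=> i is_; apply: mulr_ge0; first by rewrite addr_ge0// sqr_ge0.
  by rewrite subr_ge0 grid_le.
- by move=> i; exact: cell_gaussian_lin.
Qed.

End cells.

End brownian_cells.

(** * Step functions and their integrals *)

Section step_functions.
Context {R : realType}.
Implicit Types (s : step (R := R)) (e : seq R).
Notation mu := (@lebesgue_measure R).

Definition endpoints s : seq R := [seq p.2.1 | p <- s] ++ [seq p.2.2 | p <- s].

Definition ordered_step s := forall p, p \in s -> 0 <= p.2.1 <= p.2.2.

Lemma endpoints_ge0 s x : ordered_step s -> x \in endpoints s -> 0 <= x.
Proof.
move=> os; rewrite mem_cat => /orP[] /mapP[p ps ->].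
  by have /andP[] := os p ps.
by have /andP[x0 xy] := os p ps; rewrite (le_trans x0).
Qed.

Lemma step_telescope s e (g : R -> R) : ordered_step s ->
  {subset endpoints s <= e} ->
  \sum_(p <- s) p.1 * (g p.2.2 - g p.2.1) =
  \sum_(i < size e) step_fun s (grid e i.+1) * (g (grid e i.+1) - g (grid e i)).
Proof.
move=> os se; under [RHS]eq_bigr do rewrite /step_fun mulr_suml.
rewrite exchange_big/= !big_seq; apply: eq_bigr => p ps.
under eq_bigr do rewrite -mulrA.
rewrite -mulr_sumr grid_telescope//.
- by rewrite inE se ?orbT// mem_cat (map_f (fun q : R * (R * R) => q.2.1) ps).
- by rewrite inE se ?orbT// mem_cat (map_f (fun q : R * (R * R) => q.2.2) ps) orbT.
- by have /andP[] := os p ps.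
Qed.

Lemma step_integral_grid d (T : measurableType d) (X : R -> T -> R) s e w : ordered_step s ->
  {subset endpoints s <= e} ->
  step_integral X s w = \sum_(i < size e) step_fun s (grid e i.+1) *
    (X (grid e i.+1) w - X (grid e i) w).
Proof. by move=> os se; exact: (step_telescope (fun z => X z w)). Qed.

Lemma step_fun_grid s e v : ordered_step s -> {subset endpoints s <= e} ->
  step_fun s v = \sum_(i < size e) step_fun s (grid e i.+1) *
    (grid e i < v <= grid e i.+1)%R%:R.
Proof.
have E (x y : R) : x <= y -> (x < v <= y)%R%:R = (v <= y)%R%:R - (v <= x)%R%:R :> R.
  move=> xy; case: (leP v x) => vx; last by rewrite subr0.
  by rewrite (le_trans vx xy) subrr.
move=> os se.
have := step_telescope (fun z => (v <= z)%R%:R) os se.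
rewrite /step_fun => H.
transitivity (\sum_(p <- s) p.1 * ((v <= p.2.2)%R%:R - (v <= p.2.1)%R%:R)).
  by rewrite !big_seq; apply: eq_bigr => p ps; rewrite E//; have /andP[] := os p ps.
by rewrite H; apply: eq_bigr => i _; rewrite -E// grid_le.
Qed.

Lemma grid_cell_disjoint e (i j : nat) v : (i < size e)%N -> (j < size e)%N ->
  (grid e i < v <= grid e i.+1)%R -> (grid e j < v <= grid e j.+1)%R -> i = j.
Proof.
have H k l : (k < l)%N -> (l < size e)%N ->
   (grid e k < v <= grid e k.+1)%R -> (grid e l < v <= grid e l.+1)%R -> False.
  move=> kl le_ /andP[_ vk] /andP[lv _].
  by have := lt_le_trans lv (le_trans vk (le_grid kl (ltnW le_))); rewrite ltxx.
move=> ie je vi vj; case: (ltngtP i j) => // ij.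
  by case: (H _ _ ij je vi vj).
by case: (H _ _ ij ie vj vi).
Qed.

(** The cells of a grid are disjoint, so the cross terms of the square vanish. *)
Lemma integral_step_sqr s e : ordered_step s -> {subset endpoints s <= e} ->
  (\int[mu]_v ((step_fun s v) ^+ 2)%:E =
  (\sum_(i < size e) step_fun s (grid e i.+1) ^+ 2 * (grid e i.+1 - grid e i))%:E)%E.
Proof.
move=> os se; set c := fun i => step_fun s (grid e i.+1).
have sq v : ((step_fun s v) ^+ 2)%:E =
    (\sum_(i < size e) (c i ^+ 2)%:E * (\1_(`]grid e i, grid e i.+1]) v)%:E)%E.
  under eq_bigr do rewrite -EFinM.
  rewrite sumEFin (step_fun_grid v os se); congr (_%:E).
  under eq_bigr do rewrite -/(c _).
  under [RHS]eq_bigr do rewrite indicE mem_setE in_itv/=.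
  have [[j vj]|nj] := pselect (exists j : 'I_(size e), (grid e j < v <= grid e j.+1)%R).
    have z (i : 'I_(size e)) : i != j -> (grid e i < v <= grid e i.+1)%R = false.
      move=> ij; apply/negP => vi.
      have := grid_cell_disjoint (ltn_ord i) (ltn_ord j) vi vj.
      by move=> /val_inj/eqP; rewrite (negbTE ij).
    rewrite (bigD1 j)//= [in RHS](bigD1 j)//= vj !mulr1 big1 ?addr0; last first.
      by move=> i /z ->; rewrite mulr0.
    by rewrite big1 ?addr0// => i /z ->; rewrite mulr0.
  rewrite !big1 ?expr0n// => i _.
    by case: (boolP (_ && _)) => [vi|_]; [case: nj; exists i|rewrite mulr0].
  by case: (boolP (_ && _)) => [vi|_]; [case: nj; exists i|rewrite mulr0].
under eq_integral do rewrite sq.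
rewrite ge0_integral_sum//; last 2 first.
- by move=> i; apply: emeasurable_funM; apply/measurable_EFinP.
- by move=> i v _; rewrite mule_ge0// lee_fin ?sqr_ge0.
rewrite -sumEFin; apply: eq_bigr => i _.
rewrite ge0_integralZl_EFin ?sqr_ge0//; last first.
  exact/measurable_EFinP/measurable_indic.
rewrite integral_indic//= setIT lebesgue_measure_itv/= lte_fin [RHS]EFinM; congr (_ * _)%E.
have := grid_le (ltn_ord i); rewrite le_eqVlt => /predU1P[->|->//].
by rewrite ltxx subrr.
Qed.

End step_functions.

Section step_integrals.
Context {R : realType} d (T : measurableType d) (P : probability T R).
Variables W W' : R -> {RV P >-> R}.
Hypotheses (bW : brownian_motion W) (bW' : brownian_motion W').
Hypothesis WW' : independent_processes P W W'.
Notation mu := (@lebesgue_measure R).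

Lemma measurable_step_integral (X : R -> {RV P >-> R}) (s : step) :
  measurable_fun [set: T] (step_integral X s).
Proof.
apply: measurable_sum => p; apply: measurable_funM => //.
exact: measurable_funB.
Qed.

(** On a grid that contains the endpoints of both step functions, the sum of the
    step integrals is a combination of the independent increments over the cells. *)
Lemma step_gaussian (s s' : step) : ordered_step s -> ordered_step s' ->
  centered_gaussian P (fun w => step_integral W s w + step_integral W' s' w)
   (fine (\int[mu]_v ((step_fun s v) ^+ 2)%:E)%E +
    fine (\int[mu]_v ((step_fun s' v) ^+ 2)%:E)%E).
Proof.
move=> os os'; pose e := endpoints s ++ endpoints s'.
have se : {subset endpoints s <= e} by move=> x xs; rewrite mem_cat xs.
have s'e : {subset endpoints s' <= e} by move=> x xs; rewrite mem_cat xs orbT.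
have e0 x : x \in e -> 0 <= x.
  by rewrite mem_cat => /orP[]; exact: endpoints_ge0.
rewrite (integral_step_sqr os se) (integral_step_sqr os' s'e)/=.
have := grid_gaussian bW bW' WW' e0 (fun i => step_fun s (grid e i.+1))
  (fun i => step_fun s' (grid e i.+1)).
under [X in centered_gaussian _ _ X]eq_bigr do rewrite mulrDl.
rewrite big_split/=; congr (centered_gaussian P _ _).
apply/funext => w.
rewrite (step_integral_grid _ _ os se) (step_integral_grid _ _ os' s'e).
by rewrite -big_split.
Qed.

End step_integrals.

(** * The observed past and the orthogonal noise *)

Section past_and_future.
Context {R : realType} d (T : measurableType d) (P : probability T R).
Variables W W' : R -> {RV P >-> R}.
Hypotheses (bW : brownian_motion W) (bW' : brownian_motion W').
Hypothesis WW' : independent_processes P W W'.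
Variables (a b u : R).
Hypotheses (ab0 : 0 < a ^+ 2 + b ^+ 2) (u0 : 0 <= u).

Definition lin_process (p q : R) (v : R) (w : T) : R := p * W v w + q * W' v w.
Let Y := lin_process a b.
Let V := lin_process (- b) a.

Definition events_of (X : T -> R) : set (set T) :=
  [set A | exists2 D, measurable D & A = X @^-1` D].

Lemma events_ofI X : setI_closed (events_of X).
Proof.
move=> _ _ [D mD ->] [E mE ->]; exists (D `&` E); first exact: measurableI.
by rewrite preimage_setI.
Qed.

Lemma events_ofT X : events_of X setT.
Proof. by exists setT; rewrite ?preimage_setT. Qed.

Lemma events_of_measurable X : measurable_fun [set: T] X ->
  events_of X `<=` measurable.
Proof. by move=> mX _ [D mD ->]; rewrite -[X in measurable X]setTI; exact: mX. Qed.

Definition past_events : set (set T) := [set A | exists x y,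
  [/\ 0 <= x, x <= y, y <= u & events_of (increment Y x y) A]].

Definition future_events : set (set T) := [set A | exists x y,
  [/\ 0 <= x, x <= y, y <= u & events_of (increment V x y) A]] `|`
  [set A | exists x y, [/\ u <= x, x <= y & events_of (increment W x y) A]].

Lemma increment_lin p q x y : increment (lin_process p q) x y =
  (fun w => p * increment W x y w + q * increment W' x y w).
Proof. by apply/funext => w; rewrite /increment /lin_process; ring. Qed.

Lemma measurable_increment_lin p q x y :
  measurable_fun [set: T] (increment (lin_process p q) x y).
Proof. by rewrite increment_lin; apply: measurable_fun_lin; exact: measurable_increment. Qed.

Lemma past_events_measurable : past_events `<=` measurable.
Proof.
move=> A [x [y [_ _ _]]]; apply: events_of_measurable.
exact: measurable_increment_lin.
Qed.

Lemma future_events_measurable : future_events `<=` measurable.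
Proof.
move=> A [] [x [y]]; first by move=> [_ _ _]; apply: events_of_measurable;
  exact: measurable_increment_lin.
by move=> [_ _]; apply: events_of_measurable; exact: measurable_increment.
Qed.

Section fixed_grid.
Variable e : seq R.
Hypothesis e0 : forall x, x \in e -> 0 <= x.

(* A cell that straddles [u] contributes nothing to the past. *)
Let past_cell i : set (set T) := if grid e i.+1 <= u
  then events_of (cell_increment e Y i) else [set setT].
Let future_cell i : set (set T) := if grid e i.+1 <= u
  then events_of (cell_increment e V i) else events_of (cell_increment e W i).

Definition past_grid := rectangles (size e) past_cell.
Definition future_grid := rectangles (size e) future_cell.

Let K := cell_sigma W W' e.

Let lin_cell p q i : events_of (cell_increment e (lin_process p q) i) `<=` K i.
Proof.
by move=> _ [D mD ->]; rewrite /cell_increment increment_lin; exact: cell_sigma_lin.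
Qed.

(** Cells are independent of each other; inside a cell before [u], the increments
    of [Y] and [V] are independent because they are a rotated pair. *)
Lemma indep_grid : indep_sets P <<s past_grid >> <<s future_grid >>.
Proof.
have W1 : W = lin_process 1 0 :> (R -> T -> R).
  by apply/funext => v; apply/funext => w; rewrite /lin_process mul1r mul0r addr0.
apply: (@indep_family_split _ _ _ P (size e) K).
- exact: cell_sigmaI.
- exact: cell_sigma_measurable.
- move=> i; rewrite /past_cell; case: ifP => _; first exact: lin_cell.
  by move=> _ ->; exact: cell_sigmaT.
- move=> i; rewrite /future_cell; case: ifP => _; first exact: lin_cell.
  by rewrite {1}W1; exact: lin_cell.
- move=> i; rewrite /past_cell; case: ifP => _; first exact: events_ofI.
  by move=> _ _ -> ->; rewrite setIT.
- by move=> i; rewrite /future_cell; case: ifP => _; exact: events_ofI.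
- by move=> i; rewrite /past_cell; case: ifP => _ //; exact: events_ofT.
- by move=> i; rewrite /future_cell; case: ifP => _ //; exact: events_ofT.
- move=> i ie; rewrite /past_cell /future_cell; case: ifP => _; last first.
    by move=> _ A -> _; rewrite setTI probability_setT mul1e.
  move=> _ _ [D mD ->] [E mE ->]; rewrite /cell_increment !increment_lin.
  have g0 := grid_ge0 e0 (ltnW ie); have g1 := grid_ge0 e0 ie.
  have gg := grid_le ie.
  apply: (@indep_rotation _ _ _ _ _ _ a b (grid e i.+1 - grid e i)) => //.
  + exact: measurable_increment.
  + exact: measurable_increment.
  + by rewrite subr_ge0.
  + exact: increment_gaussian.
  + exact: increment_gaussian.
  + exact: indep_increments.
- exact: indep_cell_sigma.
Qed.

Let measurable_increment_grid (G : set (set T)) (X : R -> T -> R) x y :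
  x \in 0 :: e -> y \in 0 :: e -> x <= y ->
  (forall i, (i < size e)%N -> x < grid e i.+1 <= y ->
     measurable_fun [set: g_sigma_algebraType G] (cell_increment e X i)) ->
  forall A, events_of (increment X x y) A -> <<s G >> A.
Proof.
move=> xe ye xy mX _ [D mD ->].
have m : measurable_fun [set: g_sigma_algebraType G] (increment X x y).
  have -> : increment X x y = (fun w => \sum_(i < size e)
      (x < grid e i.+1 <= y)%R%:R * cell_increment e X i w).
    apply/funext => w; apply/esym.
    exact: (grid_telescope (fun z => X z w)).
  apply: measurable_sum => i; have [xiy|_] := boolP (x < grid e i.+1 <= y).
    by apply: measurable_funM => //; exact: mX.
  rewrite (_ : (fun _ => _) = cst 0); first exact: measurable_cst.
  by apply/funext => w; rewrite mul0r.
by have := m measurableT D mD; rewrite setTI.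
Qed.

Let events_of_rectangles (C : nat -> set (set T)) i (X : T -> R) :
  (forall i, C i setT) -> (i < size e)%N -> events_of X `<=` C i ->
  measurable_fun [set: g_sigma_algebraType (rectangles (size e) C)] X.
Proof.
move=> CT ie XC _ D mD; rewrite setTI; apply: sub_sigma_algebra.
by apply: (sub_rectangles CT ie); apply: XC; exists D.
Qed.

Lemma past_increment_grid x y A : x \in 0 :: e -> y \in 0 :: e -> x <= y -> y <= u ->
  events_of (increment Y x y) A -> <<s past_grid >> A.
Proof.
move=> xe ye xy yu; apply: measurable_increment_grid => // i ie /andP[_ gy].
apply: (events_of_rectangles _ ie).
  by move=> j; rewrite /past_cell; case: ifP => _//; exact: events_ofT.
by rewrite /past_cell (le_trans gy yu).
Qed.

Lemma future_increment_grid x y A : x \in 0 :: e -> y \in 0 :: e -> x <= y ->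
  (y <= u /\ events_of (increment V x y) A) \/
  (u <= x /\ events_of (increment W x y) A) -> <<s future_grid >> A.
Proof.
have FT j : future_cell j setT.
  by rewrite /future_cell; case: ifP => _//; exact: events_ofT.
move=> xe ye xy [[yu]|[ux]]; apply: measurable_increment_grid => // i ie /andP[xg gy];
  apply: (events_of_rectangles FT ie); rewrite /future_cell.
  by rewrite (le_trans gy yu).
by rewrite leNgt (le_lt_trans ux xg).
Qed.

End fixed_grid.

Let pi_closure_grid (E : set (set T)) (G : seq R -> set (set T)) :
  (forall A, E A -> exists x y, [/\ 0 <= x, x <= y &
     forall e, x \in 0 :: e -> y \in 0 :: e -> <<s G e >> A]) ->
  forall A, pi_closure E A -> exists2 e0 : seq R, (forall x, x \in e0 -> 0 <= x) &
    forall e, {subset e0 <= e} -> <<s G e >> A.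
Proof.
move=> EG A; elim=> [|B C /EG[x [y [x0 xy H]]] _ [e0 e00 IH]].
  by exists [::] => // e _; exact: (@measurableT _ (g_sigma_algebraType (G e))).
exists [:: x, y & e0].
  move=> z; rewrite !inE => /or3P[/eqP->//|/eqP->|/e00//].
  exact: le_trans xy.
move=> e sub; apply: (@measurableI _ (g_sigma_algebraType (G e))).
  by apply: H; rewrite inE sub ?orbT// !inE eqxx ?orbT.
by apply: IH => z ze; apply: sub; rewrite !inE ze !orbT.
Qed.

(** Finite intersections generate both sides, and the times of two of them fit in
    one grid. *)
Lemma indep_past_future :
  indep_sets P <<s past_events `|` null_events P >>
               <<s future_events `|` null_events P >>.
Proof.
apply: indep_sigma_null; [exact: past_events_measurable|
  exact: future_events_measurable|].
move=> A B pA pB.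
have [|e1 e10 H1] := @pi_closure_grid _ past_grid _ _ pA.
  move=> C [x [y [x0 xy yu HC]]]; exists x, y; split => // e xe ye.
  exact: (past_increment_grid (x := x) (y := y)).
have [|e2 e20 H2] := @pi_closure_grid _ future_grid _ _ pB.
  move=> C [[x [y [x0 xy yu HC]]]|[x [y [ux xy HC]]]]; exists x, y.
    by split => // e xe ye; apply: (future_increment_grid xe ye xy); left.
  split=> [||e xe ye]; [exact: le_trans ux|exact: xy|].
  by apply: (future_increment_grid xe ye xy); right.
apply: (@indep_grid (e1 ++ e2)).
- by move=> x; rewrite mem_cat => /orP[/e10|/e20].
- by apply: H1 => x xe; rewrite mem_cat xe.
- by apply: H2 => x xe; rewrite mem_cat xe orbT.
Qed.

End past_and_future.

(** * Almost everywhere convergence *)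

Section convergence_to_zero.
Context {R : realType}.
Local Open Scope ereal_scope.

Lemma ge0_cvge0P (u : (\bar R)^nat) : (forall n, 0 <= u n) ->
  u n @[n --> \oo] --> 0 <->
  (forall e : R, (0 < e)%R -> exists N, forall n, (N <= n)%N -> u n <= e%:E).
Proof.
move=> u0; split.
  move=> /fine_cvgP[[N1 _ fin] /cvgrPdist_le cv] e e0.
  have [N2 _ H] := cv e e0; exists (maxn N1 N2) => n; rewrite geq_max => /andP[n1 n2].
  rewrite -(fineK (fin n n1)) lee_fin.
  have := H n n2; rewrite /= sub0r normrN ger0_norm//.
  by rewrite fine_ge0.
move=> H; apply/fine_cvgP; split.
  have [N HN] := H 1%R ltr01; exists N => // n /= Nn.
  by rewrite ge0_fin_numE// (le_lt_trans (HN n Nn))// ltry.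
apply/cvgrPdist_le => e e0; have [N HN] := H e e0; exists N => // n /= Nn.
have fn : u n \is a fin_num by rewrite ge0_fin_numE// (le_lt_trans (HN n Nn))// ltry.
rewrite sub0r normrN ger0_norm ?fine_ge0//.
by rewrite -lee_fin fineK//; exact: HN.
Qed.

Lemma cvge0_le (u v : (\bar R)^nat) : (forall n, 0 <= u n) ->
  (forall n, u n <= v n) -> v n @[n --> \oo] --> 0 -> u n @[n --> \oo] --> 0.
Proof.
move=> u0 uv v0; apply: (@squeeze_cvge _ _ _ _ (cst 0) u v) => //.
  by apply: nearW => n; rewrite u0 uv.
exact: cvg_cst.
Qed.

Lemma cvge0_lin (u v : (\bar R)^nat) (p q : R) :
  u n @[n --> \oo] --> 0 -> v n @[n --> \oo] --> 0 ->
  p%:E * u n + q%:E * v n @[n --> \oo] --> 0.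
Proof.
move=> u0 v0; rewrite -[X in _ --> X](adde0 0).
apply: cvgeD => //.
  by rewrite -[X in _ --> X](mule0 p%:E); apply: cvgeZl.
by rewrite -[X in _ --> X](mule0 q%:E); apply: cvgeZl.
Qed.

End convergence_to_zero.

Section ae_convergence.
Context {R : realType} d (T : measurableType d) (mu : {measure set T -> \bar R}).
Local Open Scope ereal_scope.

(** The sum of the series is integrable, hence finite almost everywhere. *)
Lemma ae_cvg_series (h : nat -> T -> R) :
  (forall n, measurable_fun [set: T] (h n)) -> (forall n w, (0 <= h n w)%R) ->
  \sum_(n <oo) \int[mu]_w (h n w)%:E < +oo ->
  {ae mu, forall w, cvgn (series (h ^~ w))}.
Proof.
move=> mh h0 hoo; pose g w := \sum_(n <oo) (h n w)%:E.
have mg : measurable_fun [set: T] g.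
  by apply: ge0_emeasurable_sum => n *; [rewrite lee_fin|exact/measurable_EFinP].
have gE : \int[mu]_w g w = \sum_(n <oo) \int[mu]_w (h n w)%:E.
  by rewrite integral_nneseries// => n *; [exact/measurable_EFinP|rewrite lee_fin].
have g0 w : 0 <= g w by apply: nneseries_ge0 => n _ _; rewrite lee_fin.
have ig : mu.-integrable [set: T] g.
  apply/integrableP; split => //.
  by under eq_integral do rewrite gee0_abs//; rewrite gE.
have := integrable_ae measurableT ig.
apply: filterS => w /(_ I) gw.
apply: nondecreasing_is_cvgn.
  by apply: nondecreasing_series => n _ _; exact: h0.
exists (fine (g w)) => _ [n _ <-].
rewrite -lee_fin fineK// /series/= -sumEFin.
by apply: nneseries_lim_ge => k _ _; rewrite lee_fin.
Qed.

Lemma geometric_majorant (h : nat -> T -> R) :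
  (forall n, measurable_fun [set: T] (h n)) -> (forall n w, (0 <= h n w)%R) ->
  (forall n, \int[mu]_w (h n w)%:E <= (1 / (2 ^ n.+1)%:R)%:E) ->
  {ae mu, forall w, cvgn (series (h ^~ w))}.
Proof.
move=> mh h0 hle; apply: ae_cvg_series => //.
apply: (@le_lt_trans _ _ (\sum_(n <oo) (1 / (2 ^ n.+1)%:R)%:E)).
  apply: lee_nneseries => n _; last exact: hle.
  by move=> _; apply: integral_ge0 => w _; rewrite lee_fin.
by apply: (le_lt_trans (epsilon_trick0 _ ler01)); rewrite ltry.
Qed.

Lemma ae_cvg0_subseq (h : nat -> T -> R) :
  (forall n, measurable_fun [set: T] (h n)) -> (forall n w, (0 <= h n w)%R) ->
  \int[mu]_w (h n w)%:E @[n --> \oo] --> 0 ->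
  exists2 f : nat -> nat, (forall k, (k <= f k)%N) &
    {ae mu, forall w, h (f k) w @[k --> \oo] --> (0 : R)%R}.
Proof.
move=> mh h0 /ge0_cvge0P H.
have /choice[N HN] : forall k, exists N, forall n, (N <= n)%N ->
    \int[mu]_w (h n w)%:E <= (1 / (2 ^ k.+1)%:R)%:E.
  move=> k; apply: H; first by move=> n; apply: integral_ge0 => w _; rewrite lee_fin.
  by rewrite divr_gt0// ltr0n expn_gt0.
exists (fun k => maxn k (N k)); first by move=> k; rewrite leq_maxl.
have := @geometric_majorant (fun k => h (maxn k (N k))) (fun k => mh _)
  (fun k w => h0 _ _) (fun k => HN k _ (leq_maxr _ _)).
by apply: filterS => w; exact: cvg_series_cvg_0.
Qed.

(** Fatou's lemma, for a sequence that converges almost everywhere. *)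
Lemma fatou_bound (f : nat -> T -> R) (g : T -> R) (C : \bar R) N :
  (forall n, measurable_fun [set: T] (f n)) -> measurable_fun [set: T] g ->
  (forall n w, (0 <= f n w)%R) -> (forall w, (0 <= g w)%R) ->
  {ae mu, forall w, f n w @[n --> \oo] --> g w} ->
  (forall n, (N <= n)%N -> \int[mu]_w (f n w)%:E <= C) ->
  \int[mu]_w (g w)%:E <= C.
Proof.
move=> mf mg f0 g0 fg fC.
pose F n w := (f n w)%:E.
have mF n : measurable_fun [set: T] (F n) by exact/measurable_EFinP.
have F0 n w : [set: T] w -> 0 <= F n w by move=> _; rewrite lee_fin.
have -> : \int[mu]_w (g w)%:E = \int[mu]_w limn_einf (F^~ w).
  apply: ge0_ae_eq_integral => //.
  - exact/measurable_EFinP.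
  - rewrite /limn_einf; apply: measurableT_comp => //.
    apply: measurable_fun_limn_esup => n.
    exact: measurableT_comp.
  - by move=> w _; rewrite lee_fin.
  - move=> w _; rewrite limn_einf_lim; apply: lime_ge; first exact: is_cvg_einfs.
    by apply: nearW => n; apply: le_ereal_inf_tmp => _ [m _ <-]; rewrite lee_fin.
  - apply: filterS fg => w fgw _; apply/esym.
    have /cvg_einfs/cvg_lim <-// : F n w @[n --> \oo] --> (g w)%:E.
      by apply: cvg_EFin => //; exact: nearW.
    by rewrite limn_einf_lim.
apply: (le_trans (fatou mu measurableT mF F0)).
rewrite limn_einf_lim; apply: lime_le; first exact: is_cvg_einfs.
exists N => // n /= Nn; apply: le_trans (fC n Nn).
by apply: ereal_inf_lbound; exists n => /=.
Qed.

End ae_convergence.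

(** * Mean-square convergence *)

Section mean_square.
Context {R : realType} d (T : measurableType d) (mu : {measure set T -> \bar R}).
Local Open Scope ereal_scope.
Implicit Types f g h : T -> R.

Definition sqr_norm f := \int[mu]_w ((f w) ^+ 2)%:E.
Definition sqr_dist f g := sqr_norm (fun w => f w - g w)%R.

Lemma measurable_sqr f : measurable_fun [set: T] f ->
  measurable_fun [set: T] (fun w => ((f w) ^+ 2)%:E).
Proof. by move=> mf; apply/measurable_EFinP; exact: measurable_funX. Qed.

Lemma sqr_norm_ge0 f : 0 <= sqr_norm f.
Proof. by apply: integral_ge0 => w _; rewrite lee_fin sqr_ge0. Qed.

Lemma sqr_dist_ge0 f g : 0 <= sqr_dist f g.
Proof. exact: sqr_norm_ge0. Qed.

Lemma sqr_distC f g : sqr_dist f g = sqr_dist g f.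
Proof. by apply: eq_integral => w _; rewrite -sqrrN opprB. Qed.

(** Pointwise quadratic inequalities replace Minkowski's: they hold in [\bar R]
    whether or not the norms are finite. *)
Lemma sqr_norm_le f g h (p q : R) : (0 <= p)%R -> (0 <= q)%R ->
  measurable_fun [set: T] f -> measurable_fun [set: T] g ->
  measurable_fun [set: T] h ->
  (forall w, f w ^+ 2 <= p * g w ^+ 2 + q * h w ^+ 2)%R ->
  sqr_norm f <= p%:E * sqr_norm g + q%:E * sqr_norm h.
Proof.
move=> p0 q0 mf mg mh fgh.
have mz (r : R) (k : T -> R) : measurable_fun [set: T] k ->
    measurable_fun [set: T] (fun w => r%:E * ((k w) ^+ 2)%:E).
  by move=> mk; apply: emeasurable_funM => //; exact: measurable_sqr.
rewrite /sqr_norm -!ge0_integralZl_EFin//; try exact: measurable_sqr;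
  try by move=> w _; rewrite lee_fin sqr_ge0.
rewrite -ge0_integralD//; try exact: mz;
  try by move=> w _; rewrite mule_ge0// lee_fin ?sqr_ge0.
apply: ge0_le_integral => //.
- by move=> w _; rewrite lee_fin sqr_ge0.
- exact: measurable_sqr.
- by apply: emeasurable_funD; exact: mz.
- by move=> w _; rewrite -!EFinM -EFinD lee_fin.
Qed.

Lemma sqr_normD f g : measurable_fun [set: T] f -> measurable_fun [set: T] g ->
  sqr_norm (fun w => f w + g w)%R <= 2%:E * sqr_norm f + 2%:E * sqr_norm g.
Proof.
move=> mf mg; apply: sqr_norm_le => //; first exact: measurable_funD.
move=> w; rewrite -subr_ge0.
have -> : (2 * f w ^+ 2 + 2 * g w ^+ 2 - (f w + g w) ^+ 2 = (f w - g w) ^+ 2)%R.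
  by ring.
exact: sqr_ge0.
Qed.

Lemma sqr_dist_triangle f g h : measurable_fun [set: T] f ->
  measurable_fun [set: T] g -> measurable_fun [set: T] h ->
  sqr_dist f h <= 2%:E * sqr_dist f g + 2%:E * sqr_dist g h.
Proof.
move=> mf mg mh.
rewrite /sqr_dist.
rewrite (_ : (fun w => f w - h w)%R = (fun w => (f w - g w) + (g w - h w))%R).
  by apply: sqr_normD; exact: measurable_funB.
by apply/funext => w; ring.
Qed.

Lemma sqr_normZ f (p : R) : measurable_fun [set: T] f ->
  sqr_norm (fun w => p * f w)%R = (p ^+ 2)%:E * sqr_norm f.
Proof.
move=> mf; rewrite /sqr_norm -ge0_integralZl_EFin ?sqr_ge0//; last 2 first.
  by move=> w _; rewrite lee_fin sqr_ge0.
  exact: measurable_sqr.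
by apply: eq_integral => w _; rewrite exprMn EFinM.
Qed.

Lemma eq_sqr_norm f g : f =1 g -> sqr_norm f = sqr_norm g.
Proof. by move=> fg; apply: eq_integral => w _; rewrite fg. Qed.

Lemma ae_eq_sqr_norm f g : measurable_fun [set: T] f -> measurable_fun [set: T] g ->
  {ae mu, forall w, f w = g w} -> sqr_norm f = sqr_norm g.
Proof.
move=> mf mg fg; apply: ge0_ae_eq_integral => //; try exact: measurable_sqr;
  try by move=> w _; rewrite lee_fin sqr_ge0.
by apply: filterS fg => w -> _.
Qed.

Lemma sqr_dist_lin f g f' g' (p q : R) :
  measurable_fun [set: T] f -> measurable_fun [set: T] g ->
  measurable_fun [set: T] f' -> measurable_fun [set: T] g' ->
  sqr_dist (fun w => p * f w + q * g w)%R (fun w => p * f' w + q * g' w)%R <=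
  (2 * p ^+ 2)%:E * sqr_dist f f' + (2 * q ^+ 2)%:E * sqr_dist g g'.
Proof.
move=> mf mg mf' mg'; apply: sqr_norm_le.
- by rewrite mulr_ge0// sqr_ge0.
- by rewrite mulr_ge0// sqr_ge0.
- by apply: measurable_funB; apply: measurable_funD; apply: measurable_funM.
- exact: measurable_funB.
- exact: measurable_funB.
move=> w; rewrite -subr_ge0; set x := f w; set y := f' w; set z := g w; set t := g' w.
have -> : (2 * p ^+ 2 * (x - y) ^+ 2 + 2 * q ^+ 2 * (z - t) ^+ 2 -
  (p * x + q * z - (p * y + q * t)) ^+ 2 = (p * (x - y) - q * (z - t)) ^+ 2)%R by ring.
exact: sqr_ge0.
Qed.

Definition L2cvg (F : nat -> T -> R) f := sqr_dist f (F n) @[n --> \oo] --> 0.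

Lemma L2cvg_lin (F G : nat -> T -> R) f g (p q : R) :
  measurable_fun [set: T] f -> measurable_fun [set: T] g ->
  (forall n, measurable_fun [set: T] (F n)) -> (forall n, measurable_fun [set: T] (G n)) ->
  L2cvg F f -> L2cvg G g ->
  L2cvg (fun n w => p * F n w + q * G n w)%R (fun w => p * f w + q * g w)%R.
Proof.
move=> mf mg mF mG Ff Gg.
apply: (cvge0_le (v := fun n => (2 * p ^+ 2)%:E * sqr_dist f (F n) +
  (2 * q ^+ 2)%:E * sqr_dist g (G n))); first by move=> n; exact: sqr_dist_ge0.
  by move=> n; exact: sqr_dist_lin.
exact: cvge0_lin.
Qed.

Lemma L2cvg_close (F G : nat -> T -> R) f :
  measurable_fun [set: T] f ->
  (forall n, measurable_fun [set: T] (F n)) -> (forall n, measurable_fun [set: T] (G n)) ->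
  L2cvg F f -> sqr_dist (F n) (G n) @[n --> \oo] --> 0 -> L2cvg G f.
Proof.
move=> mf mF mG Ff FG.
apply: (cvge0_le (v := fun n => 2%:E * sqr_dist f (F n) +
  2%:E * sqr_dist (F n) (G n))); first by move=> n; exact: sqr_dist_ge0.
  by move=> n; exact: sqr_dist_triangle.
exact: cvge0_lin.
Qed.

Lemma L2cvg_dist (F G : nat -> T -> R) f :
  measurable_fun [set: T] f ->
  (forall n, measurable_fun [set: T] (F n)) -> (forall n, measurable_fun [set: T] (G n)) ->
  L2cvg F f -> L2cvg G f -> sqr_dist (F n) (G n) @[n --> \oo] --> 0.
Proof.
move=> mf mF mG Ff Gf.
apply: (cvge0_le (v := fun n => 2%:E * sqr_dist f (F n) +
  2%:E * sqr_dist f (G n))); first by move=> n; exact: sqr_dist_ge0.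
  by move=> n; rewrite (sqr_distC f (F n)); exact: sqr_dist_triangle.
exact: cvge0_lin.
Qed.

Lemma L2cvg_ae_subseq (F : nat -> T -> R) f :
  measurable_fun [set: T] f -> (forall n, measurable_fun [set: T] (F n)) ->
  L2cvg F f -> exists2 j : nat -> nat, (forall k, (k <= j k)%N) &
    {ae mu, forall w, F (j k) w @[k --> \oo] --> f w}.
Proof.
move=> mf mF Ff.
have [j jk H] := @ae_cvg0_subseq R _ _ mu (fun n w => (f w - F n w) ^+ 2)%R
  (fun n => measurable_funX _ (measurable_funB mf (mF n))) (fun n w => sqr_ge0 _) Ff.
exists j => //; apply: filterS H => w /= H.
apply/cvgrPdist_lt => e e0; have e20 : (0 < e ^+ 2)%R by rewrite exprn_gt0.
have [N _ HN] := (cvgrPdist_lt _ _).1 H _ e20; exists N => // n /HN.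
rewrite /= sub0r normrN normrX ltr_pXn2r ?nnegrE//.
exact: ltW.
Qed.

(** A subsequence converges outside a null event [N]. On the complement of [N] the
    limit is measurable, and what happens on [N] is a null event again. *)
Lemma L2cvg_measurable (G : set (set T)) (F : nat -> T -> R) f :
  G `<=` measurable -> [set N | measurable N /\ mu N = 0] `<=` <<s G >> ->
  measurable_fun [set: T] f ->
  (forall n, measurable_fun [set: g_sigma_algebraType G] (F n)) ->
  L2cvg F f -> measurable_fun [set: g_sigma_algebraType G] f.
Proof.
move=> Gm Gn mf mF Ff.
have sGm A : <<s G >> A -> measurable A.
  by apply: smallest_sub; [exact: sigma_algebra_measurable|].
have mF' n : measurable_fun [set: T] (F n).
  by move=> _ B mB; rewrite setTI; apply: sGm; have := mF n measurableT B mB; rewrite setTI.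
have [j _ [N [mN N0 HN]]] := L2cvg_ae_subseq mf mF' Ff.
have GN : @measurable _ (g_sigma_algebraType G) N by exact: Gn.
have GNC : @measurable _ (g_sigma_algebraType G) (~` N) by exact: measurableC.
have mc : measurable_fun (~` N : set (g_sigma_algebraType G)) f.
  apply: (@measurable_fun_cvg _ (g_sigma_algebraType G) R (~` N) (fun k => F (j k)) f).
    by move=> k; exact: measurable_funTS.
  by move=> w Nw; apply: contrapT => H; apply: Nw; exact: HN.
move=> _ B mB; rewrite setTI -(setIT (f @^-1` B)) -(setUv N) setIUr.
apply: measurableU.
  apply: Gn; split.
    by apply: measurableI => //; rewrite -[X in measurable X]setTI; exact: mf.
  apply: (subset_measure0 _ mN _ N0) => //.
  by apply: measurableI => //; rewrite -[X in measurable X]setTI; exact: mf.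
by rewrite setIC; exact: mc.
Qed.

End mean_square.

Section mean_square_probability.
Context {R : realType} d (T : measurableType d) (P : probability T R).
Local Open Scope ereal_scope.

(** From [2 * x <= l * x ^+ 2 + l^-1]; the parameter [l] makes up for the lack of a
    square root. *)
Lemma integral_abs_le (f : T -> R) (l : R) : (0 < l)%R -> measurable_fun [set: T] f ->
  \int[P]_w `|f w|%:E <= (l / 2)%:E * sqr_norm P f + (l^-1 / 2)%:E.
Proof.
move=> l0 mf.
have -> : (l^-1 / 2)%:E = \int[P]_w (cst (l^-1 / 2)%:E w).
  by rewrite integral_cst//= probability_setT mule1.
have l20 : (0 <= l / 2)%R by rewrite divr_ge0// ltW.
rewrite /sqr_norm -ge0_integralZl_EFin//; last 2 first.
  by move=> w _; rewrite lee_fin sqr_ge0.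
  exact: measurable_sqr.
rewrite -ge0_integralD//; last 3 first.
- by move=> w _; rewrite mule_ge0// lee_fin ?sqr_ge0// divr_ge0// ltW.
- by apply: emeasurable_funM => //; exact: measurable_sqr.
- by move=> w _; rewrite lee_fin divr_ge0// invr_ge0 ltW.
apply: ge0_le_integral => //.
- by apply/measurable_EFinP; exact: measurableT_comp.
- by apply: emeasurable_funD => //; apply: emeasurable_funM => //; exact: measurable_sqr.
- move=> w _; rewrite /= -EFinM -EFinD lee_fin -subr_ge0 -(real_normK (num_real (f w))).
  set x := `|f w|%R.
  have -> : (l / 2 * x ^+ 2 + l^-1 / 2 - x = l / 2 * (x - l^-1) ^+ 2)%R.
    by field; rewrite gt_eqF.
  by rewrite mulr_ge0 ?sqr_ge0// divr_ge0// ltW.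
Qed.

(** A subsequence whose consecutive distances decrease
    geometrically converges almost surely, and Fatou's lemma identifies its
    limit as the limit in mean square. *)
Lemma L2_complete (F : nat -> T -> R) :
  (forall n, measurable_fun [set: T] (F n)) ->
  (forall e : R, (0 < e)%R -> exists N, forall n m, (N <= n)%N -> (N <= m)%N ->
     sqr_dist P (F n) (F m) <= e%:E) ->
  exists J : {mfun T >-> R}, L2cvg P F J.
Proof.
move=> mF cauchy.
have /choice[N HN] : forall k, exists N, forall n m, (N <= n)%N -> (N <= m)%N ->
    sqr_dist P (F n) (F m) <= ((1 / (2 ^ k.+1)%:R) ^+ 2)%:E.
  by move=> k; apply: cauchy; rewrite exprn_gt0// divr_gt0// ltr0n expn_gt0.
(* The index is nondecreasing, at least [k] and beyond [N k]. *)
pose j k := (\sum_(i < k.+1) N i + k)%N.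
have jN k : (N k <= j k)%N by rewrite /j big_ord_recr/= -addnA addnCA leq_addr.
have jS k : (j k <= j k.+1)%N.
  by rewrite /j [in leqRHS]big_ord_recr/= -addnA leq_add2l (leq_trans (leqnSn k))// leq_addl.
have jk k : (k <= j k)%N by rewrite /j leq_addl.
pose D k w := (F (j k.+1) w - F (j k) w)%R.
have mD k : measurable_fun [set: T] (D k) by exact: measurable_funB.
have Dle k : \int[P]_w `|D k w|%:E <= (1 / (2 ^ k.+1)%:R)%:E.
  set l : R := (2 ^ k.+1)%:R.
  have l0 : (0 < l)%R by rewrite ltr0n expn_gt0.
  apply: (le_trans (integral_abs_le l0 (mD k))).
  have Ek : sqr_norm P (D k) <= ((1 / l) ^+ 2)%:E.
    by apply: HN; rewrite ?jN// (leq_trans (jN k)).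
  apply: (@le_trans _ _ ((l / 2)%:E * ((1 / l) ^+ 2)%:E + (l^-1 / 2)%:E)).
    by rewrite leeD2r// lee_wpmul2l// lee_fin divr_ge0// ltW.
  by rewrite -EFinM -EFinD lee_fin le_eqVlt; apply/orP; left; apply/eqP; field; rewrite gt_eqF.
have mnD k : measurable_fun [set: T] (fun w => `|D k w|%R) by exact: measurableT_comp.
have [N0 [mN0 PN0 HN0]] := geometric_majorant mnD (fun _ _ => normr_ge0 _) Dle.
have cv w : ~ N0 w -> cvgn (fun k => F (j k) w).
  move=> nw; have : cvgn [normed series (D ^~ w)].
    by apply: contrapT => nc; apply: nw; exact: HN0.
  move=> /normed_cvg.
  rewrite (_ : D ^~ w = telescope (fun k => F (j k) w))// telescopeK.
  move=> /cvg_ex[l Hl]; apply/cvg_ex; exists (l + F (j 0%N) w)%R.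
  rewrite (_ : (fun k => F (j k) w) =
    (fun k => (F (j k) w - F (j 0%N) w) + F (j 0%N) w)%R); last first.
    by apply/funext => k; rewrite subrK.
  by apply: cvgD => //; exact: cvg_cst.
pose J0 w := limn (fun k => F (j k) w * \1_(~` N0) w)%R.
have cv0 w : (fun k => F (j k) w * \1_(~` N0) w)%R @ \oo --> J0 w.
  rewrite /J0; have [nw|nw] := pselect (N0 w).
    rewrite (_ : (fun k => _) = cst 0%R); first exact: is_cvg_cst.
    by apply/funext => k; rewrite indicE memNset ?mulr0// => /(_ nw).
  rewrite (_ : (fun k => _) = (fun k => F (j k) w)); first exact: cv.
  by apply/funext => k; rewrite indicE mem_set ?mulr1.
have mJ : measurable_fun [set: T] J0.
  apply: (measurable_fun_cvg (h := fun k w => F (j k) w * \1_(~` N0) w)%R).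
    move=> k; apply: measurable_funM => //.
    by apply: measurable_indic; exact: measurableC.
  by move=> w _; exact: cv0.
have JE w : ~ N0 w -> (fun k => F (j k) w) @ \oo --> J0 w.
  move=> nw; have := cv0 w; rewrite indicE mem_set//.
  by under [X in X @ _ --> _]eq_fun do rewrite mulr1.
exists (mfun_Sub (mem_set mJ)).
rewrite /L2cvg; apply/ge0_cvge0P; first by move=> n; exact: sqr_dist_ge0.
move=> e e0; have [M HM] := cauchy e e0; exists M => n Mn.
apply: (@fatou_bound _ _ _ _ (fun k w => (F (j k) w - F n w) ^+ 2)%R _ _ M).
- by move=> k; apply: measurable_funX; exact: measurable_funB.
- by apply: measurable_funX; exact: measurable_funB.
- by move=> k w; exact: sqr_ge0.
- by move=> w; exact: sqr_ge0.
- exists N0; split => // w /= nH; apply: contrapT => nw; apply: nH.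
  have := JE w nw => H.
  apply: (cvg_comp (fun k => F (j k) w - F n w)%R (fun x => x ^+ 2)%R).
    by apply: cvgB; [exact: H|exact: cvg_cst].
  exact: sqr_continuous.
- by move=> k Mk; apply: HM => //; exact: leq_trans (jk k).
Qed.

End mean_square_probability.

(** * Limits of Gaussian variables *)

Section laws_on_the_line.
Context {R : realType}.
Local Open Scope ereal_scope.

Let ramp (q : R) (n : nat) (x : R) : R := Num.min 1%R (n%:R * Num.max 0 (q - x))%R.

Let ramp01 q n x : (0 <= ramp q n x <= 1)%R.
Proof.
by rewrite /ramp ge_min lexx andbT le_min ler01/= mulr_ge0// le_max lexx.
Qed.

Let continuous_ramp q n : continuous (ramp q n).
Proof.
move=> x; apply: (@continuous_min R R (fun=> 1%R)
  (fun y => n%:R * Num.max 0 (q - y))%R x); first exact: cvg_cst.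
apply: cvgM; first exact: cvg_cst.
apply: (@continuous_max R R (fun=> 0%R) (fun y => q - y)%R x); first exact: cvg_cst.
by apply: cvgB; [exact: cvg_cst|exact: cvg_id].
Qed.

Let cvg_ramp q x : ramp q n x @[n --> \oo] --> (\1_(`]-oo, q[) x : R)%R.
Proof.
rewrite indicE mem_setE in_itv/=; have [xq|qx] := ltP x q.
  apply: cvg_near_cst; exists (Num.truncn (q - x)^-1).+1 => // n /= nq.
  apply/eqP; rewrite /ramp max_r ?subr_ge0 ?ltW// min_l//.
  rewrite -ler_pdivrMr ?subr_gt0// div1r ltW//.
  rewrite (lt_le_trans (truncnS_gt _))// ler_nat//.
rewrite (_ : (fun n => _) = cst 0%R); first exact: cvg_cst.
by apply/funext => n; rewrite /ramp max_l ?subr_le0// mulr0 min_r.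
Qed.

(** Continuous ramps converge to the indicators of the open left rays, which form
    a generating pi-system. *)
Lemma eq_measure_continuous (m1 m2 : probability (measurableTypeR R) R) :
  (forall g : R -> R, continuous g -> (forall x, 0 <= g x <= 1)%R ->
     \int[m1]_x (g x)%:E = \int[m2]_x (g x)%:E) ->
  forall D, measurable D -> m1 D = m2 D.
Proof.
move=> m12.
have ray (m : probability (measurableTypeR R) R) q :
    \int[m]_x (ramp q n x)%:E @[n --> \oo] --> m `]-oo, q[%classic.
  have -> : m `]-oo, q[%classic = \int[m]_x (\1_(`]-oo, q[) x)%:E.
    by rewrite integral_indic// setIT.
  apply: (@dominated_cvg _ _ _ m _ measurableT _ _ (cst 1)) => //.
  - by move=> n; apply/measurable_EFinP; apply: continuous_measurable_fun; exact: continuous_ramp.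
  - move=> x _; apply: cvg_EFin; first exact: nearW.
    exact: cvg_ramp.
  - exact: finite_measure_integrable_cst.
  - move=> n x _; have /andP[r0 r1] := ramp01 q n x.
    by rewrite gee0_abs ?lee_fin.
pose G : set (set R) := [set A | A = setT \/ exists q, A = `]-oo, q[%classic].
move=> D mD; apply: (@eq_prob_sigma _ _ _ m1 m2 G) => //.
- move=> _ _ [->|[q ->]] [->|[r ->]]; rewrite ?setTI ?setIT; [by left|
    by right; exists r|by right; exists q|right; exists (Num.min q r)].
  apply/seteqP; split=> x /=; rewrite !in_itv/= lt_min; first by move=> [-> ->].
  by move=> /andP[].
- by left.
- by move=> _ [->|[q ->]].
- move=> _ [->|[q ->]]; first exact: (etrans (probability_setT m1) (esym (probability_setT m2))).
  apply: (cvg_unique _ (ray m1 q)) => //.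
  rewrite (_ : (fun n => _) = (fun n => \int[m2]_x (ramp q n x)%:E)); first exact: ray.
  by apply/funext => n; apply: m12; [exact: continuous_ramp|exact: ramp01].
- by rewrite [X in X < _](probability_setT m1) ltey.
- move: mD; rewrite RGenInftyO.measurableE; apply: sub_sigma_algebra2.
  by move=> _ [q ->]; right; exists q.
Qed.

End laws_on_the_line.

Section gaussian_limits.
Context {R : realType} d (T : measurableType d) (P : probability T R).
Notation gamma := (normal_prob (0 : R) 1).
Local Open Scope ereal_scope.

(** Along an almost surely convergent subsequence, dominated convergence applies
    on both sides of [E g(F n) = \int g(sqrt (v n) x) d gamma] for a bounded
    continuous [g], and such [g] determine the law. *)
Lemma centered_gaussian_limit (F : nat -> T -> R) (f : T -> R) (v : nat -> R) (l : R) :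
  (forall n, measurable_fun [set: T] (F n)) -> measurable_fun [set: T] f ->
  (forall n, 0 <= v n)%R -> (0 <= l)%R ->
  (forall n, centered_gaussian P (F n) (v n)) -> v n @[n --> \oo] --> l ->
  L2cvg P F f -> centered_gaussian P f l.
Proof.
move=> mF mf v0 l0 Fv vl Ff.
have [j jk Fjf] := L2cvg_ae_subseq mf mF Ff.
have vjl : v (j k) @[k --> \oo] --> l.
  apply/cvgrPdist_lt => e e0; have [N _ HN] := (cvgrPdist_lt _ _).1 vl e e0.
  by exists N => // k /= Nk; apply: HN; exact: leq_trans (jk k).
have mfR : @measurable_fun _ _ T (measurableTypeR R) setT f by [].
pose X := @mfun_Sub _ _ T (measurableTypeR R) f (mem_set mfR).
have msc (r : R) :
    @measurable_fun _ _ (measurableTypeR R) (measurableTypeR R) setT (fun x : R => r * x)%R.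
  exact: measurable_funM.
pose S r := @mfun_Sub _ _ (measurableTypeR R) (measurableTypeR R) _ (mem_set (msc r)).
have law (Z : T -> R) (r : R) (g : R -> R) : measurable_fun [set: T] Z ->
    (0 <= r)%R -> centered_gaussian P Z r ->
    continuous g -> (forall x, 0 <= g x <= 1)%R ->
    \int[P]_w (g (Z w))%:E = \int[gamma]_x (g (Num.sqrt r * x)%R)%:E.
  move=> mZ r0 Zr cg g01.
  have mg : measurable_fun [set: R] (fun x => (g x)%:E).
    by apply/measurable_EFinP; exact: continuous_measurable_fun.
  have g0 x : 0 <= (g x)%:E by rewrite lee_fin; have /andP[] := g01 x.
  rewrite -(@ge0_integral_image_measure _ _ _ T (measurableTypeR R) P _ mZ _ mg g0).
  rewrite -(@ge0_integral_image_measure _ _ _ (measurableTypeR R) (measurableTypeR R)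
    gamma _ (msc (Num.sqrt r)) _ mg g0).
  apply: eq_measure_integral => D mD _.
  exact: (centered_gaussianE r0 mD Zr).
move=> D mD; rewrite normal_lawE//.
have -> : [set x | D (0 + Num.sqrt l * x)%R] = S (Num.sqrt l) @^-1` D.
  by apply/seteqP; split => x /=; rewrite add0r.
apply: (@eq_measure_continuous R (distribution P X) (distribution gamma (S (Num.sqrt l)))) => //.
move=> g cg g01.
have mg : measurable_fun [set: R] (fun x => (g x)%:E).
  by apply/measurable_EFinP; exact: continuous_measurable_fun.
have g0 x : 0 <= (g x)%:E by rewrite lee_fin; have /andP[] := g01 x.
have -> : \int[distribution P X]_x (g x)%:E = \int[P]_w (g (f w))%:E.
  exact: ge0_integral_distribution.
have -> : \int[distribution gamma (S (Num.sqrt l))]_x (g x)%:E =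
    \int[gamma]_x (g (Num.sqrt l * x)%R)%:E.
  exact: ge0_integral_distribution.
have i1 (d' : measure_display) (U : measurableType d') (Q : probability U R) :
    Q.-integrable [set: U] (cst 1 : U -> \bar R).
  exact: finite_measure_integrable_cst.
have bg (x : R) : `|(g x)%:E| <= 1.
  by rewrite gee0_abs// lee_fin; have /andP[] := g01 x.
have c1 : \int[P]_w (g (F (j k) w))%:E @[k --> \oo] --> \int[P]_w (g (f w))%:E.
  have [|||||_ _ H] := @dominated_convergence _ _ _ P _ measurableT
    (fun k w => (g (F (j k) w))%:E) (fun w => (g (f w))%:E) (cst 1); last exact: H.
  - by move=> k; exact: (measurableT_comp mg (mF (j k))).
  - exact: (measurableT_comp mg mf).
  - apply: filterS Fjf => w H _; apply: cvg_EFin; first exact: nearW.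
    exact: (cvg_comp _ _ H (cg (f w))).
  - exact: i1.
  - by apply: aeW => w n _; exact: bg.
have c2 : \int[gamma]_x (g (Num.sqrt (v (j k)) * x)%R)%:E @[k --> \oo] -->
    \int[gamma]_x (g (Num.sqrt l * x)%R)%:E.
  apply: (@dominated_cvg _ _ _ gamma _ measurableT _ _ (cst 1)) => //.
  - by move=> k; exact: (measurableT_comp mg (msc _)).
  - move=> x _; apply: cvg_EFin; first exact: nearW.
    have c : (Num.sqrt (v (j k)) * x)%R @[k --> \oo] --> (Num.sqrt l * x)%R.
      apply: cvgM; last exact: cvg_cst.
      exact: (cvg_comp _ _ vjl (@sqrt_continuous R l)).
    exact: (cvg_comp _ _ c (cg _)).
  - exact: i1.
apply: (cvg_unique _ c1) => //.
rewrite (_ : (fun k => _) = (fun k => \int[gamma]_x (g (Num.sqrt (v (j k)) * x)%R)%:E))//.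
by apply/funext => k; exact: law.
Qed.

End gaussian_limits.

(** * Density of step functions *)

Section dominated.
Context {R : realType} d (T : measurableType d) (mu : {measure set T -> \bar R}).

Lemma L2cvg_dominated (F : nat -> T -> R) (f h : T -> R) :
  (forall n, measurable_fun [set: T] (F n)) -> measurable_fun [set: T] f ->
  measurable_fun [set: T] h -> (forall w, 0 <= h w) ->
  (forall w, F n w @[n --> \oo] --> f w) ->
  (forall n w, (f w - F n w) ^+ 2 <= h w) ->
  (\int[mu]_w (h w)%:E < +oo)%E -> L2cvg mu F f.
Proof.
move=> mF mf mh h0 Ff Fh hoo; rewrite /L2cvg /sqr_dist /sqr_norm.
have -> : 0%E = (\int[mu]_w (cst 0%E w))%E by rewrite integral0.
apply: (@dominated_cvg _ _ _ mu _ measurableT _ _ (EFin \o h)) => //.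
- by move=> n; apply: measurable_sqr; exact: measurable_funB.
- move=> w _; apply: cvg_EFin; first exact: nearW.
  have c : (f w - F n w) @[n --> \oo] --> (0 : R).
    by rewrite -[X in _ --> X](subrr (f w)); apply: cvgB; [exact: cvg_cst|exact: Ff].
  have H : ((f w - F n w) ^+ 2 @[n --> \oo] --> (0 : R) ^+ 2).
    exact: (cvg_comp _ _ c (@sqr_continuous R 0)).
  by move: H; rewrite expr0n.
- apply/integrableP; split; first exact/measurable_EFinP.
  by under eq_integral do rewrite /= ger0_norm//.
- by move=> n w _; rewrite gee0_abs ?lee_fin ?sqr_ge0.
Qed.

End dominated.

Section step_density.
Context {R : realType}.
Notation mu := (@lebesgue_measure R).
Notation step := (step (R := R)).
Implicit Types (f g : R -> R) (s : step).

Definition scale_step (c : R) s : step := [seq (c * p.1, p.2) | p <- s].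

Lemma step_fun_cat s s' v : step_fun (s ++ s') v = step_fun s v + step_fun s' v.
Proof. by rewrite /step_fun big_cat. Qed.

Lemma step_fun_scale c s v : step_fun (scale_step c s) v = c * step_fun s v.
Proof. by rewrite /step_fun big_map mulr_sumr; apply: eq_bigr => p _; rewrite mulrA. Qed.

Lemma step_integral_cat d (T : measurableType d) (X : R -> T -> R) s s' w :
  step_integral X (s ++ s') w = step_integral X s w + step_integral X s' w.
Proof. by rewrite /step_integral big_cat. Qed.

Lemma step_integral_scale d (T : measurableType d) (X : R -> T -> R) c s w :
  step_integral X (scale_step c s) w = c * step_integral X s w.
Proof. by rewrite /step_integral big_map mulr_sumr; apply: eq_bigr => p _; rewrite mulrA. Qed.

Lemma step_on_cat u s s' : step_on u s -> step_on u s' -> step_on u (s ++ s').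
Proof. by move=> us us' p; rewrite mem_cat => /orP[/us|/us']. Qed.

Lemma step_on_scale u c s : step_on u s -> step_on u (scale_step c s).
Proof. by move=> us _ /mapP[p ps ->] /=; exact: us. Qed.

Lemma measurable_step_fun s : measurable_fun [set: R] (step_fun s).
Proof.
apply: measurable_sum => p; apply: measurable_funM => //.
rewrite (_ : (fun _ => _) = \1_(`]p.2.1, p.2.2])); first exact: measurable_indic.
by apply/funext => v; rewrite indicE mem_setE in_itv.
Qed.

Section bounded_interval.
Variable M : R.
Let I : set R := `]0, M]%classic.

Definition step_approx f := forall e : R, 0 < e -> exists2 s, step_on M s &
  (sqr_dist mu f (step_fun s) <= e%:E)%E.

Lemma step_approx_step s : step_on M s -> step_approx (step_fun s).
Proof.
move=> Ms e e0; exists s => //; rewrite /sqr_dist /sqr_norm integral0_eq ?lee_fin ?ltW//.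
by move=> v _; rewrite subrr expr0n.
Qed.

Lemma step_approx_lim f : measurable_fun [set: R] f ->
  (forall e : R, 0 < e -> exists g, [/\ measurable_fun [set: R] g, step_approx g &
     (sqr_dist mu f g <= e%:E)%E]) -> step_approx f.
Proof.
move=> mf H e e0; have e4 : 0 < e / 4 by rewrite divr_gt0.
have [g [mg ag fg]] := H _ e4; have [s Ms gs] := ag _ e4.
exists s => //; apply: (le_trans (sqr_dist_triangle mu mf mg (measurable_step_fun s))).
apply: (@le_trans _ _ (2%:E * (e / 4)%:E + 2%:E * (e / 4)%:E)%E).
  by apply: leeD; rewrite lee_wpmul2l.
by rewrite -!EFinM -EFinD lee_fin le_eqVlt; apply/orP; left; apply/eqP; field.
Qed.

(** The constant [c] below is chosen so that both errors, multiplied by the factors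
    of the quadratic inequality, add up to at most [e]. *)
Lemma step_approx_lin f g (p q : R) : measurable_fun [set: R] f ->
  measurable_fun [set: R] g -> step_approx f -> step_approx g ->
  step_approx (fun v => p * f v + q * g v).
Proof.
move=> mf mg af ag e e0.
pose c := 2 * p ^+ 2 + 2 * q ^+ 2 + 1.
have c0 : 0 < c by rewrite ltr_wpDl// addr_ge0// mulr_ge0// sqr_ge0.
have ec : 0 < e / c by rewrite divr_gt0.
have [s Ms fs] := af _ ec; have [s' Ms' gs'] := ag _ ec.
exists (scale_step p s ++ scale_step q s').
  by apply: step_on_cat; exact: step_on_scale.
rewrite (_ : step_fun _ = (fun v => p * step_fun s v + q * step_fun s' v)); last first.
  by apply/funext => v; rewrite step_fun_cat !step_fun_scale.
apply: (le_trans (sqr_dist_lin mu p q mf mg (measurable_step_fun s) (measurable_step_fun s'))).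
apply: (@le_trans _ _ ((2 * p ^+ 2)%:E * (e / c)%:E + (2 * q ^+ 2)%:E * (e / c)%:E)%E).
  by apply: leeD; rewrite lee_wpmul2l// lee_fin mulr_ge0// sqr_ge0.
rewrite -!EFinM -EFinD lee_fin -mulrDl mulrCA ler_piMr ?(ltW e0)//.
by rewrite ler_pdivrMr// mul1r /c lerDl.
Qed.

Lemma step_approx_sum (J : Type) (r : seq J) (F : J -> R -> R) :
  (forall j, measurable_fun [set: R] (F j)) -> (forall j, step_approx (F j)) ->
  step_approx (fun v => \sum_(j <- r) F j v).
Proof.
move=> mF aF; elim: r => [|j r IH].
  rewrite (_ : (fun _ => _) = step_fun [::]); first exact: step_approx_step.
  by apply/funext => v; rewrite /step_fun !big_nil.
rewrite (_ : (fun _ => _) = (fun v => 1 * F j v + 1 * (\sum_(j <- r) F j v))).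
  by apply: step_approx_lin => //; exact: measurable_sum.
by apply/funext => v; rewrite big_cons !mul1r.
Qed.

Lemma step_approx_L2cvg (F : nat -> R -> R) f : measurable_fun [set: R] f ->
  (forall n, measurable_fun [set: R] (F n)) -> (forall n, step_approx (F n)) ->
  L2cvg mu F f -> step_approx f.
Proof.
move=> mf mF aF Ff; apply: step_approx_lim => // e e0.
have [N HN] := (ge0_cvge0P (fun n => sqr_dist_ge0 mu f (F n))).1 Ff e e0.
by exists (F N); split=> //; exact: HN.
Qed.

Let mI : measurable I. Proof. exact: measurable_itv. Qed.

Let muI : (\int[mu]_v (\1_I v)%:E < +oo)%E.
Proof.
rewrite integral_indic//= setIT lebesgue_measure_itv/= lte_fin; case: ifP => _.
  by rewrite ltry.
by rewrite ltry.
Qed.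

Let ind_approx (A : set R) := step_approx (\1_(A `&` I)).

Let indU (A B : set R) : measurable A -> measurable B -> [disjoint A & B] ->
  ind_approx A -> ind_approx B -> ind_approx (A `|` B).
Proof.
move=> mA mB AB aA aB; rewrite /ind_approx.
rewrite (_ : \1_ _ = (fun v => 1 * \1_(A `&` I) v + 1 * \1_(B `&` I) v)).
  by apply: step_approx_lin => //; apply: measurable_indic; exact: measurableI.
apply/funext => v; rewrite !mul1r setIUl !indicE in_setU.
have [vA|nvA] := boolP (v \in A `&` I); have [vB|nvB] := boolP (v \in B `&` I);
  rewrite ?addr0 ?add0r//.
by move/disj_setPS : AB => /(_ v) AB; case: AB; split;
  [case/set_mem: vA|case/set_mem: vB].
Qed.

Let ind0 : ind_approx set0.
Proof.
rewrite /ind_approx set0I (_ : \1_ _ = step_fun [::]); first exact: step_approx_step.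
by apply/funext => v; rewrite indic0 /step_fun big_nil.
Qed.

Let ind_itv x y : ind_approx `]x, y]%classic.
Proof.
rewrite /ind_approx; pose x' := Num.max x 0; pose y' := Num.min y M.
have E : `]x, y]%classic `&` I = `]x', y']%classic.
  apply/seteqP; split => v; rewrite /I /= !in_itv/= gt_max le_min.
    by move=> [/andP[-> ->] /andP[-> ->]].
  by move=> /andP[/andP[-> ->] /andP[-> ->]].
rewrite E; have [xy|yx] := leP x' y'; last first.
  rewrite (_ : \1_ _ = step_fun [::]); first exact: step_approx_step.
  apply/funext => v; rewrite indicE mem_setE in_itv/= /step_fun big_nil.
  case: (boolP (_ && _)) => // /andP[xv vy].
  by have := lt_le_trans xv (le_trans vy (ltW yx)); rewrite ltxx.
rewrite (_ : \1_ _ = step_fun [:: (1, (x', y'))]).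
  apply: step_approx_step => _ /[!inE] /eqP -> /=.
  by rewrite xy le_max lexx orbT ge_min lexx orbT.
by apply/funext => v; rewrite indicE mem_setE in_itv/= /step_fun big_seq1 mul1r.
Qed.

(** The sets whose indicators can be approximated form a Dynkin system that
    contains the intervals. *)
Lemma step_approx_indic (A : set R) : measurable A -> ind_approx A.
Proof.
move=> mA; pose J := (@ocitv R).
have JI : setI_closed J.
  move=> _ _ [[x y] _ <-] [[z t] _ <-]; exists (Num.max x z, Num.min y t) => //=.
  apply/seteqP; split => v /=; rewrite !in_itv/= gt_max le_min.
    by move=> /andP[/andP[-> ->] /andP[-> ->]].
  by move=> [/andP[-> ->] /andP[-> ->]].
have indT : ind_approx setT.
  rewrite /ind_approx setTI -(setIid I); exact: ind_itv.
apply: (@dynkin_induction _ (measurableTypeR R) J (ind_approx)) => //.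
- by move=> _ [[x y] _ <-]; exact: ind_itv.
- move=> S mS aS; rewrite /ind_approx.
  rewrite (_ : \1_ _ = (fun v => 1 * \1_(setT `&` I) v + -1 * \1_(S `&` I) v)).
    by apply: step_approx_lin => //; apply: measurable_indic; exact: measurableI.
  apply/funext => v; rewrite mul1r mulN1r setTI !indicE !in_setI in_setC.
  by case: (v \in S); case: (v \in I); rewrite /= ?subr0 ?subrr.
- move=> F mF tF aF; rewrite /ind_approx.
  pose U n := \bigcup_(k < n) F k.
  have mU n : measurable (U n) by apply: fin_bigcup_measurable.
  have aU n : ind_approx (U n).
    elim: n => [|n IH]; first by rewrite /U bigcup0// => i; rewrite /= ltn0.
    have -> : U n.+1 = U n `|` F n.
      rewrite /U !bigcup_mkord big_ord_recr//.
    apply: (indU (mU n) (mF n) _ IH (aF n)); apply/disj_setPS => v [[k /= kn Fk] Fn].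
    have := tF k n Logic.I Logic.I (ex_intro _ v (conj Fk Fn)) => kE.
    by rewrite kE ltnn in kn.
  have mF' : measurable (\bigcup_k F k) by exact: bigcupT_measurable.
  apply: (step_approx_L2cvg (F := fun n => \1_(U n `&` I))).
  + exact: (measurable_indic (measurableI _ _ mF' mI)).
  + by move=> n; exact: (measurable_indic (measurableI _ _ (mU n) mI)).
  + exact: aU.
  apply: (@L2cvg_dominated R _ (measurableTypeR R) mu (fun n => \1_(U n `&` I)) _ (\1_I)) => //.
  + by move=> n; exact: (measurable_indic (measurableI _ _ (mU n) mI)).
  + exact: (measurable_indic (measurableI _ _ mF' mI)).
  + move=> v; apply: cvg_near_cst.
    have [[k _ Fk]|nF] := pselect ((\bigcup_k F k) v).
      exists k.+1 => // n /= kn; rewrite !indicE !in_setI; congr ((nat_of_bool (_ && _))%:R).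
      by rewrite !mem_set//; exists k.
    apply: nearW => n; rewrite !indicE !in_setI; congr ((nat_of_bool (_ && _))%:R).
    by rewrite !memNset// => -[k _ Fk]; apply: nF; exists k.
  + move=> n v; rewrite !indicE !in_setI.
    have [vI|_] := boolP (v \in I); last by rewrite !andbF subrr expr0n.
    rewrite !andbT; case: (_ \in _); case: (_ \in _);
      by rewrite ?subrr ?subr0 ?sub0r ?sqrrN ?expr1n ?expr0n.
Qed.

Import HBNNSimple.

Lemma step_approx_nnsfun (h : {nnsfun (measurableTypeR R) >-> R}) :
  step_approx (fun v => h v * \1_I v).
Proof.
have mh y : measurable (h @^-1` [set y] `&` I : set R).
  apply: measurableI => //; rewrite -[X in measurable X]setTI.
  by apply: (measurable_funP h) => //; exact: measurable_set1.
rewrite (_ : (fun _ => _) = (fun v => \sum_(y <- finmap.enum_fset (fset_set (range h)))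
  (y * \1_((h @^-1` [set y]) `&` I) v + 0 * 0))).
  apply: step_approx_sum => y.
    apply: measurable_funD => //; exact: measurable_funM.
  apply: (step_approx_lin (g := fun=> 0)) => //.
  - apply: step_approx_indic; rewrite -[X in measurable X]setTI.
    by apply: (measurable_funP h) => //; exact: measurable_set1.
  - rewrite (_ : (fun _ => _) = step_fun [::]); first exact: step_approx_step.
    by apply/funext => v; rewrite /step_fun big_nil.
apply/funext => v; rewrite {1}fimfunE fsbig_finite//= mulr_suml.
apply: eq_bigr => y _; rewrite mulr0 addr0 -mulrA; congr (_ * _).
by rewrite indicI.
Qed.

Let step_approx_ge0 f : measurable_fun [set: R] f -> (forall v, 0 <= f v) ->
  (forall v, ~ I v -> f v = 0) -> (sqr_norm mu f < +oo)%E -> step_approx f.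
Proof.
move=> mf f0 fI foo.
have mf' : @measurable_fun _ _ (measurableTypeR R) _ setT (EFin \o f).
  exact/measurable_EFinP.
pose h := nnsfun_approx measurableT mf'.
have hf n v : h n v <= f v.
  rewrite -lee_fin /h nnsfun_approxE.
  by apply: (@le_approx _ _ _ setT (EFin \o f)) => // w _ /=; rewrite lee_fin.
have h0 n v : 0 <= h n v by [].
have mhn n : @measurable_fun _ _ (measurableTypeR R) R setT (h n) by exact: measurable_funP.
apply: (step_approx_L2cvg (F := fun n v => h n v * \1_I v)) => //.
- by move=> n; apply: measurable_funM => //; exact: mhn.
- by move=> n; exact: step_approx_nnsfun.
have E n v : h n v * \1_I v = h n v.
  rewrite indicE; have [_|/negP nI] := boolP (v \in I); first by rewrite mulr1.
  have fv : f v = 0 by apply: fI => vI; apply: nI; exact: mem_set.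
  by rewrite mulr0; apply/eqP; rewrite eq_le h0 -{1}fv hf.
apply: (@L2cvg_dominated R _ (measurableTypeR R) mu (fun n v => h n v * \1_I v) f
  (fun v => f v ^+ 2)) => //.
- by move=> n; apply: measurable_funM; [exact: measurable_funP|exact: measurable_indic].
- exact: measurable_funX.
- by move=> v; exact: sqr_ge0.
- move=> v; rewrite (_ : (fun n => _) = (fun n => h n v)); last by apply/funext => n.
  have H : (h n v)%:E @[n --> \oo] --> (f v)%:E.
    apply: (@cvg_nnsfun_approx _ (measurableTypeR R) R setT measurableT (EFin \o f) mf') => //.
    by move=> w _ /=; rewrite lee_fin.
  by move/fine_cvgP : H => [].
- move=> n v; rewrite E ler_pXn2r ?nnegrE ?subr_ge0//.
  by rewrite gerBl.
Qed.

(** Positive and negative parts are increasing limits of simple functions, and the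
    convergence is dominated by [f ^+ 2]. *)
Lemma step_approx_L2 f : measurable_fun [set: R] f ->
  (forall v, ~ I v -> f v = 0) -> (sqr_norm mu f < +oo)%E -> step_approx f.
Proof.
move=> mf fI foo.
rewrite (_ : f = (fun v => 1 * f^\+ v + -1 * f^\- v)).
  have le (g : R -> R) : measurable_fun [set: R] g -> (forall v, 0 <= g v) ->
      (forall v, g v <= `|f v|) -> step_approx g.
    move=> mg g0 gf; apply: step_approx_ge0 => //.
      move=> v /fI fv; apply/eqP; rewrite eq_le g0 andbT.
      by rewrite (le_trans (gf v))// fv normr0.
    apply: le_lt_trans foo; apply: ge0_le_integral => //.
    - by move=> v _; rewrite lee_fin sqr_ge0.
    - exact: measurable_sqr.
    - exact: measurable_sqr.
    - by move=> v _; rewrite lee_fin -(real_normK (num_real (f v))) ler_pXn2r ?nnegrE.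
  have mp : measurable_fun [set: R] f^\+ by exact: measurable_funrpos.
  have mn : measurable_fun [set: R] f^\- by exact: measurable_funrneg.
  apply: step_approx_lin => //; apply: le => // v.
  - by rewrite /numfun.funrpos ge_max ler_norm normr_ge0.
  - by rewrite /numfun.funrneg ge_max normr_ge0 -normrN ler_norm.
by apply/funext => v; rewrite mul1r mulN1r -{1}(funrposBneg f).
Qed.

End bounded_interval.
End step_density.

(** * Wiener integrals *)

Section gaussian_moments.
Context {R : realType} d (T : measurableType d) (P : probability T R).
Notation gamma := (normal_prob (0 : R) 1).
Local Open Scope ereal_scope.

(** Change of variables along the standardization. *)
Lemma ge0_integral_gaussian (X : T -> R) (v : R) (g : R -> \bar R) :
  measurable_fun [set: T] X -> (0 <= v)%R -> centered_gaussian P X v ->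
  measurable_fun [set: R] g -> (forall x, 0 <= g x) ->
  \int[P]_w g (X w) = \int[gamma]_x g (Num.sqrt v * x)%R.
Proof.
move=> mX v0 Xv mg g0.
have msc : @measurable_fun _ _ (measurableTypeR R) (measurableTypeR R) setT
    (fun x : R => Num.sqrt v * x)%R.
  exact: measurable_funM.
rewrite -(@ge0_integral_image_measure _ _ _ T (measurableTypeR R) P _ mX _ mg g0).
rewrite -(@ge0_integral_image_measure _ _ _ (measurableTypeR R) (measurableTypeR R)
    gamma _ msc _ mg g0).
apply: eq_measure_integral => D mD _.
exact: (centered_gaussianE v0 mD Xv).
Qed.

Lemma sqr_norm_gaussian (X : T -> R) (v : R) : measurable_fun [set: T] X ->
  (0 <= v)%R -> centered_gaussian P X v -> sqr_norm P X = v%:E.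
Proof.
move=> mX v0 Xv.
have msq : measurable_fun [set: R] (fun x : R => (x ^+ 2)%:E).
  by apply/measurable_EFinP; exact: measurable_funX.
rewrite /sqr_norm (ge0_integral_gaussian mX v0 Xv msq); last first.
  by move=> x; rewrite lee_fin sqr_ge0.
under eq_integral do rewrite exprMn sqr_sqrtr// EFinM.
rewrite ge0_integralZl_EFin//; last by move=> x _; rewrite lee_fin sqr_ge0.
by rewrite integral_sqr_normal mule1.
Qed.

Lemma centered_gaussianN (X : T -> R) (v : R) : measurable_fun [set: T] X ->
  (0 <= v)%R -> centered_gaussian P X v -> centered_gaussian P (fun w => - X w)%R v.
Proof.
move=> mX v0 Xv.
have m0 : measurable_fun [set: T] (cst 0%R : T -> R) by [].
have ind : indep_vars P X (cst 0%R).
  move=> D E mD mE; rewrite [X in _ `&` X]preimage_cst [in RHS]preimage_cst.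
  by case: ifPn => _; rewrite ?setIT ?setI0 ?probability_setT ?measure0 ?mule1 ?mule0.
have H := centered_gaussian_lin (-1)%R 0%R mX m0 v0 (lexx 0%R) Xv (centered_gaussian0 P) ind.
have E : ((-1) ^+ 2 * v + 0 ^+ 2 * 0 = v)%R by ring.
have F : (fun w => -1 * X w + 0 * cst 0 w)%R = (fun w => - X w)%R.
  by apply/funext => w; rewrite mulN1r mul0r addr0.
by move: H; rewrite E F.
Qed.

Lemma integrable_gaussian (X : T -> R) (v : R) : measurable_fun [set: T] X ->
  (0 <= v)%R -> centered_gaussian P X v -> P.-integrable [set: T] (EFin \o X).
Proof.
move=> mX v0 Xv; apply/integrableP; split; first exact/measurable_EFinP.
have := integral_abs_le P (@ltr01 R) mX; rewrite (sqr_norm_gaussian mX v0 Xv).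
by move=> /le_lt_trans; apply; rewrite -EFinM -EFinD ltry.
Qed.

(** [X] and [- X] have the same law, so the positive and negative parts have the
    same finite integral. *)
Lemma integral_gaussian (X : T -> R) (v : R) : measurable_fun [set: T] X ->
  (0 <= v)%R -> centered_gaussian P X v -> \int[P]_w (X w)%:E = 0.
Proof.
move=> mX v0 Xv; have iX := integrable_gaussian mX v0 Xv.
have pos (Z : T -> R) : measurable_fun [set: T] Z -> centered_gaussian P Z v ->
    \int[P]_w (Num.max (Z w) 0)%:E = \int[gamma]_x (Num.max (Num.sqrt v * x) 0)%:E.
  move=> mZ Zv; apply: (ge0_integral_gaussian (g := fun x => (Num.max x 0)%:E) mZ v0 Zv).
    by apply/measurable_EFinP; exact: measurable_maxr.
  by move=> x; rewrite lee_fin le_max lexx orbT.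
rewrite integralE.
have -> : \int[P]_x (fun w => (X w)%:E)^\+ x = \int[P]_w (Num.max (X w) 0)%:E.
  by apply: eq_integral => w _; rewrite funeposE -EFin_max.
have -> : \int[P]_x (fun w => (X w)%:E)^\- x = \int[P]_w (Num.max (- X w) 0)%:E.
  by apply: eq_integral => w _; rewrite funenegE -EFin_max.
rewrite (pos _ mX Xv) (pos (fun w => - X w)%R).
- rewrite subee// -(pos _ mX Xv).
  have mp : measurable_fun [set: T] (fun w => Num.max (X w) 0)%R.
    exact: measurable_maxr.
  rewrite ge0_fin_numE.
    case/integrableP : iX => _; apply: le_lt_trans; apply: ge0_le_integral => //.
    + by move=> w _; rewrite lee_fin le_max lexx orbT.
    + exact/measurable_EFinP.
    + by apply/measurable_EFinP; exact: measurableT_comp.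
    + by move=> w _; rewrite /= lee_fin ge_max ler_norm normr_ge0.
  by apply: integral_ge0 => w _; rewrite lee_fin le_max lexx orbT.
- exact: measurableT_comp.
- exact: centered_gaussianN.
Qed.

End gaussian_moments.

Section isometry.
Context {R : realType} d (T : measurableType d) (P : probability T R).
Variables W W' : R -> {RV P >-> R}.
Hypotheses (bW : brownian_motion W) (bW' : brownian_motion W').
Hypothesis WW' : independent_processes P W W'.
Notation mu := (@lebesgue_measure R).
Notation step := (step (R := R)).
Local Open Scope ereal_scope.

Lemma sqr_norm_step_fin (s : step) : ordered_step s ->
  sqr_norm mu (step_fun s) \is a fin_num.
Proof.
move=> os; rewrite /sqr_norm (integral_step_sqr os (e := endpoints s)) //.
Qed.

Lemma ordered_cat (s s' : step) : ordered_step s -> ordered_step s' ->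
  ordered_step (s ++ s').
Proof. by move=> os os' p; rewrite mem_cat => /orP[/os|/os']. Qed.

Lemma ordered_scale c (s : step) : ordered_step s -> ordered_step (scale_step c s).
Proof. by move=> os _ /mapP[p ps ->] /=; exact: os. Qed.

(** The variance of a Gaussian variable is its second moment. *)
Lemma step_isometry (s s' : step) : ordered_step s -> ordered_step s' ->
  sqr_norm P (fun w => step_integral W s w + step_integral W' s' w)%R =
  sqr_norm mu (step_fun s) + sqr_norm mu (step_fun s').
Proof.
move=> os os'; have g := step_gaussian bW bW' WW' os os'.
rewrite (sqr_norm_gaussian _ _ g).
- by rewrite EFinD -/(sqr_norm mu (step_fun s)) -/(sqr_norm mu (step_fun s'))
    !fineK// sqr_norm_step_fin.
- by apply: measurable_funD; exact: measurable_step_integral.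
- by rewrite addr_ge0// fine_ge0//; exact: sqr_norm_ge0.
Qed.

Lemma step_isometry_dist (s1 s2 : step) : ordered_step s1 -> ordered_step s2 ->
  sqr_dist P (step_integral W s1) (step_integral W s2) =
  sqr_dist mu (step_fun s1) (step_fun s2).
Proof.
move=> os1 os2.
have os : ordered_step (s1 ++ scale_step (-1)%R s2).
  by apply: ordered_cat => //; exact: ordered_scale.
have on : ordered_step ([::] : step) by [].
have := step_isometry os on.
rewrite [X in _ = _ + X](_ : _ = 0); last first.
  by rewrite /sqr_norm integral0_eq// => v _; rewrite /step_fun big_nil expr0n.
rewrite adde0 => E; transitivity (sqr_norm P (fun w =>
    step_integral W (s1 ++ scale_step (-1)%R s2) w + step_integral W' [::] w)%R).
  apply: eq_sqr_norm => w; rewrite step_integral_cat step_integral_scale.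
  by rewrite /step_integral big_nil addr0 mulN1r.
rewrite E; apply: eq_sqr_norm => v.
by rewrite step_fun_cat step_fun_scale mulN1r.
Qed.

End isometry.

Section wiener_integrals.
Context {R : realType} d (T : measurableType d) (P : probability T R).
Variable X : R -> {RV P >-> R}.
Notation mu := (@lebesgue_measure R).
Notation step := (step (R := R)).
Hypothesis isoX : forall s1 s2 : step, ordered_step s1 -> ordered_step s2 ->
  sqr_dist P (step_integral X s1) (step_integral X s2) =
  sqr_dist mu (step_fun s1) (step_fun s2).
Local Open Scope ereal_scope.

(** The left end 0 is excluded to match the half-open intervals of step
    functions. *)
Definition truncation (u : R) (f : R -> R) (v : R) : R := (f v * (0 < v <= u)%R%:R)%R.

Lemma measurable_truncation (u : R) (f : R -> R) : measurable_fun [set: R] f ->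
  measurable_fun [set: R] (truncation u f).
Proof.
move=> mf; apply: measurable_funM => //.
rewrite (_ : (fun _ => _) = \1_(`]0%R, u])); first exact: measurable_indic.
by apply/funext => v; rewrite indicE mem_setE in_itv.
Qed.

Lemma step_fun_out u (s : step) v : step_on u s -> ~ (0 < v <= u)%R -> step_fun s v = 0%R.
Proof.
move=> us nv; rewrite /step_fun big_seq big1// => p ps.
case: (boolP (_ && _)) => [/andP[xv vy]|_]; last by rewrite mulr0.
have [/andP[x0 xy] yu] := us p ps; case: nv.
by rewrite (le_lt_trans x0 xv) (le_trans vy yu).
Qed.

Lemma step_on_ordered u (s : step) : step_on u s -> ordered_step s.
Proof. by move=> us p /us[]. Qed.

Lemma integral_truncation (u : R) (f g : R -> R) : measurable_fun [set: R] f ->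
  measurable_fun [set: R] g -> (forall v, ~ (0 < v <= u)%R -> g v = 0%R) ->
  \int[mu]_(v in `[0%R, u]) ((f v - g v) ^+ 2)%:E = sqr_dist mu (truncation u f) g.
Proof.
move=> mf mg g0.
rewrite -integral_itv_obnd_cbnd; last first.
  apply/measurable_EFinP; apply: measurable_funTS.
  by apply: measurable_funX; exact: measurable_funB.
rewrite integral_mkcond; apply: eq_integral => v _.
rewrite patchE mem_setE in_itv/= /truncation; case: (boolP (_ && _)) => [_|/negP nv].
  by rewrite mulr1.
by rewrite mulr0 sub0r sqrrN g0// expr0n.
Qed.

Lemma sqr_norm_truncation (u : R) (f : R -> R) : measurable_fun [set: R] f ->
  sqr_norm mu (truncation u f) = \int[mu]_(v in `[0%R, u]) ((f v) ^+ 2)%:E.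
Proof.
move=> mf.
transitivity (sqr_dist mu (truncation u f) (cst 0%R)).
  by apply: eq_sqr_norm => v; rewrite subr0.
rewrite -integral_truncation//.
by apply: eq_integral => v _; rewrite subr0.
Qed.

Section existence.
Variables (u : R) (f : R -> R).
Hypothesis mf : measurable_fun [set: R] f.
Hypothesis f2 : \int[mu]_(v in `[0%R, u]) ((f v) ^+ 2)%:E < +oo.

Let F := truncation u f.
Let mF : measurable_fun [set: R] F. Proof. exact: measurable_truncation. Qed.

Lemma exists_step_approximation : exists2 s : nat -> step,
  forall n, step_on u (s n) & L2cvg mu (fun n => step_fun (s n)) F.
Proof.
have aF : step_approx u F.
  apply: step_approx_L2 => //; last by rewrite sqr_norm_truncation.
  move=> v nv; rewrite /F /truncation; case: (boolP (_ && _)) => [vu|]; last by rewrite mulr0.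
  by case: nv; rewrite /= in_itv.
have pos n : (0 < n.+1%:R^-1 :> R)%R by rewrite invr_gt0 ltr0n.
have /choice[s Hs] : forall n, exists s, step_on u s /\
    sqr_dist mu F (step_fun s) <= (n.+1%:R^-1)%:E.
  by move=> n; have [s us sF] := aF _ (pos n); exists s.
exists s; first by move=> n; exact: (Hs n).1.
apply/ge0_cvge0P => [n|e e0]; first exact: sqr_dist_ge0.
exists (Num.truncn e^-1) => n Nn; apply: (le_trans (Hs n).2); rewrite lee_fin.
rewrite -[leRHS]invrK lef_pV2 ?posrE ?invr_gt0 ?ltr0n//.
by rewrite (le_trans (ltW (truncnS_gt _)))// ler_nat.
Qed.

(** By the isometry, the step integrals of an approximating sequence form a
    Cauchy sequence. *)
Lemma wiener_integral_exists : exists I : {RV P >-> R}, is_wiener_integral X u f I.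
Proof.
have [s us cF] := exists_step_approximation.
have [J HJ] : exists J : {mfun T >-> R}, L2cvg P (fun n => step_integral X (s n)) J.
  apply: L2_complete; first by move=> n; exact: measurable_step_integral.
  have /ge0_cvge0P cF' := cF.
  move=> e e0; have [||N HN] := cF' _ (e / 4)%R; rewrite ?divr_gt0//.
    by move=> n; exact: sqr_dist_ge0.
  exists N => n m /HN ne /HN me.
  rewrite isoX; [|exact: step_on_ordered (us n)|exact: step_on_ordered (us m)].
  apply: (le_trans (sqr_dist_triangle mu (measurable_step_fun _) mF (measurable_step_fun _))).
  rewrite (sqr_distC mu (step_fun (s n)) F).
  apply: (@le_trans _ _ (2%:E * (e / 4)%:E + 2%:E * (e / 4)%:E)).
    by apply: leeD; rewrite lee_wpmul2l.
  by rewrite -!EFinM -EFinD lee_fin le_eqVlt; apply/orP; left; apply/eqP; field.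
exists J, s; split => //.
rewrite (_ : (fun n => _) = (fun n => sqr_dist mu F (step_fun (s n))))//.
apply/funext => n; apply: integral_truncation => //; first exact: measurable_step_fun.
by move=> v; exact: step_fun_out.
Qed.

(** By the isometry, step integrals along two sequences with the same limit merge
    in mean square; hence the choice made in [wiener_integral] does not matter. *)
Lemma wiener_integral_limit (s : nat -> step) : (forall n, ordered_step (s n)) ->
  L2cvg mu (fun n => step_fun (s n)) F ->
  L2cvg P (fun n => step_integral X (s n)) (wiener_integral P X u f).
Proof.
move=> os sF.
have [s' [us' s'f I]] : is_wiener_integral X u f (wiener_integral P X u f).
  by apply: (@xgetPex _ _ [set I : {RV P >-> R} | is_wiener_integral X u f I]);
     exact: wiener_integral_exists.
have s'F : L2cvg mu (fun n => step_fun (s' n)) F.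
  move: s'f; rewrite (_ : (fun n => _) = (fun n => sqr_dist mu F (step_fun (s' n))))//.
  apply/funext => n; apply: integral_truncation => //; first exact: measurable_step_fun.
  by move=> v; apply: step_fun_out.
apply: (L2cvg_close (F := fun n => step_integral X (s' n))) => //.
- by move=> n; exact: measurable_step_integral.
- by move=> n; exact: measurable_step_integral.
rewrite (_ : (fun n => _) = (fun n => sqr_dist mu (step_fun (s' n)) (step_fun (s n)))).
  apply: (@L2cvg_dist R _ (measurableTypeR R) mu (fun n => step_fun (s' n))
    (fun n => step_fun (s n)) F) => // n; exact: measurable_step_fun.
apply/funext => n; apply: isoX => //; exact: step_on_ordered (us' n).
Qed.

End existence.

End wiener_integrals.

(** * Integration over independent sigma-algebras *)

Section sub_sigma_algebras.
Context {R : realType} d (T : measurableType d) (P : probability T R).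
Variables G H : set (set T).
Hypotheses (Gm : G `<=` measurable) (Hm : H `<=` measurable).
Hypothesis GH : indep_sets P <<s G >> <<s H >>.
Local Open Scope ereal_scope.

Let TG := g_sigma_algebraType G.
Let TH := g_sigma_algebraType H.

Lemma measurable_fun_sigma (K : set (set T)) d' (U : measurableType d') (f : T -> U) :
  K `<=` measurable -> measurable_fun [set: g_sigma_algebraType K] f ->
  measurable_fun [set: T] f.
Proof.
move=> Km mf _ B mB; rewrite setTI; apply: (sigma_measurable Km).
by have := mf measurableT B mB; rewrite setTI.
Qed.

Let mG : @measurable_fun _ _ T TG setT idfun.
Proof. by move=> _ B mB; rewrite setTI; exact: (sigma_measurable Gm). Qed.

Let mH : @measurable_fun _ _ T TH setT idfun.
Proof. by move=> _ B mB; rewrite setTI; exact: (sigma_measurable Hm). Qed.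

(** Independence says that the image of [P] under the diagonal is the product of
    the restrictions of [P] to the two sigma-algebras. *)
Lemma indep_integral_diag (f : TG * TH -> \bar R) :
  measurable_fun [set: TG * TH] f -> (forall z, 0 <= f z) ->
  \int[P]_w f (w, w) = \int[P]_w \int[P]_w' f (w, w').
Proof.
move=> mf f0.
pose XG := @mfun_Sub _ _ T TG idfun (mem_set mG).
pose XH := @mfun_Sub _ _ T TH idfun (mem_set mH).
have mD : @measurable_fun _ _ T (TG * TH)%type setT (fun w => (w, w)).
  by apply/measurable_fun_pair.
rewrite -(ge0_integral_image_measure P mD mf f0).
pose PG := distribution P XG; pose PH := distribution P XH.
have -> : \int[image_measure P mD]_z f z = \int[PG \x PH]_z f z.
  apply: eq_measure_integral => A mA _; apply/esym.
  apply: (@product_measure_unique _ _ TG TH R PG PH (image_measure P mD)) => //.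
rewrite (@fubini_tonelli1 _ _ TG TH R PG PH f mf f0).
rewrite [LHS]ge0_integral_distribution//; last 2 first.
- exact: measurable_fun_fubini_tonelli_F.
- by move=> x; exact: integral_ge0.
apply: eq_integral => w _ /=.
rewrite /fubini_F [LHS]ge0_integral_distribution//.
exact: measurableT_comp.
Qed.

Lemma indep_ge0_integral (h : T -> R) (B : set T) : <<s G >> B ->
  measurable_fun [set: TH] h -> (forall w, (0 <= h w)%R) ->
  \int[P]_(w in B) (h w)%:E = P B * \int[P]_w (h w)%:E.
Proof.
move=> GB mh h0.
have mB : measurable B by exact: (sigma_measurable Gm).
have mB' : @measurable _ TG B by [].
have mh' := measurable_fun_sigma Hm mh.
rewrite integral_mkcond.
transitivity (\int[P]_w ((\1_B w)%:E * (h w)%:E)).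
  apply: eq_integral => w _; rewrite patchE indicE.
  by case: ifPn => _; rewrite ?mul1e ?mul0e.
have := @indep_integral_diag (fun z => (\1_B z.1)%:E * (h z.2)%:E).
move=> ->; last by move=> z; rewrite mule_ge0// lee_fin.
  transitivity (\int[P]_w ((\1_B w)%:E * \int[P]_w' (h w')%:E)).
    apply: eq_integral => w _ /=; rewrite ge0_integralZl_EFin//.
      by move=> w' _; rewrite lee_fin.
    exact/measurable_EFinP.
  rewrite ge0_integralZr//; last 2 first.
  - by apply/measurable_EFinP; exact: measurable_indic.
  - by apply: integral_ge0 => w' _; rewrite lee_fin.
  by rewrite integral_indic// setIT.
by apply: emeasurable_funM; apply/measurable_EFinP; apply: measurableT_comp.
Qed.

Lemma indep_integral (h : T -> R) (B : set T) : <<s G >> B ->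
  measurable_fun [set: TH] h -> P.-integrable [set: T] (EFin \o h) ->
  \int[P]_(w in B) (h w)%:E = P B * \int[P]_w (h w)%:E.
Proof.
move=> GB mh ih.
have mB : measurable B by exact: (sigma_measurable Gm).
rewrite integralE [in RHS]integralE.
have pE (f : T -> R) : (fun w => (f w)%:E)^\+ = (fun w => (Num.max (f w) 0)%:E).
  by apply/funext => w; rewrite funeposE -EFin_max.
have nE (f : T -> R) : (fun w => (f w)%:E)^\- = (fun w => (Num.max (- f w) 0)%:E).
  by apply/funext => w; rewrite funenegE -EFin_max.
rewrite !pE !nE.
have mp : measurable_fun [set: TH] (fun w => Num.max (h w) 0)%R.
  exact: measurable_maxr.
have mn : measurable_fun [set: TH] (fun w => Num.max (- h w) 0)%R.
  by apply: measurable_maxr => //; exact: measurableT_comp.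
have max0 (x : R) : (0 <= Num.max x 0)%R by rewrite le_max lexx orbT.
rewrite (indep_ge0_integral GB mp (fun w => max0 _)).
rewrite (indep_ge0_integral GB mn (fun w => max0 _)).
apply/esym/muleBr; first by apply: fin_num_measure.
apply: fin_num_adde_defr; rewrite -pE.
exact: (integrable_pos_fin_num measurableT ih).
Qed.

End sub_sigma_algebras.

(** * Conditional law of a known part plus an independent part *)

Section path_space.
Context {R : realType}.
Notation path := (g_sigma_algebraType (@cylinders R)).

Lemma measurable_coordinate (t : {nonneg R}) :
  @measurable_fun _ _ path R setT (fun x => x t).
Proof.
move=> _ B mB; rewrite setTI; apply: sub_sigma_algebra.
by exists t; exists B.
Qed.

Lemma measurable_path d (T : measurableType d) (f : T -> path) :
  (forall t, measurable_fun [set: T] (fun w => f w t)) ->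
  @measurable_fun _ _ T path setT f.
Proof.
move=> mf; apply: (@measurability _ _ T path setT f (@cylinders R) erefl).
move=> _ [_ [t [B mB ->]] <-]; rewrite setTI -[X in measurable X]setTI.
exact: (mf t measurableT B mB).
Qed.

(** A countable pi-system that generates the events depending on the coordinates
    [t i]: two kernels that agree on each member almost surely agree on all of
    them simultaneously. *)
Section rational_halfspaces.
Variables (n : nat) (t : 'I_n -> {nonneg R}).

Definition halfspaces (s : seq ('I_n * rat)) : set path :=
  [set x | forall p, p \in s -> x (t p.1) <= ratr p.2].

Definition halfspace_events : set (set path) := range halfspaces.

Lemma measurable_halfspaces s : @measurable _ path (halfspaces s).
Proof.
rewrite (_ : halfspaces s = \big[setI/setT]_(p <- s)
   ((fun x : path => x (t p.1)) @^-1` `]-oo, ratr p.2])).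
  apply: bigsetI_measurable => p _; rewrite -[X in measurable X]setTI.
  exact: measurable_coordinate.
rewrite -bigcap_seq; apply/seteqP; split => x H p /=.
  by move=> ps; rewrite in_itv/=; exact: H.
by move=> ps; have := H p ps; rewrite /= in_itv.
Qed.

Lemma halfspace_eventsI : setI_closed halfspace_events.
Proof.
move=> _ _ [s _ <-] [s' _ <-]; exists (s ++ s') => //.
apply/seteqP; split => x.
  by move=> H; split => p ps; apply: H; rewrite mem_cat ps ?orbT.
by move=> [H H'] p; rewrite mem_cat => /orP[]; [exact: H|exact: H'].
Qed.

Lemma halfspace_eventsT : halfspace_events setT.
Proof. by exists [::] => //; apply/seteqP; split. Qed.

Lemma halfspace_events_measurable : halfspace_events `<=` measurable.
Proof. by move=> _ [s _ <-]; exact: measurable_halfspaces. Qed.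

Lemma measurable_coordinate_halfspace (i : 'I_n) :
  @measurable_fun _ _ (g_sigma_algebraType halfspace_events) R setT
    (fun x : {nonneg R} -> R => x (t i)).
Proof.
apply: (@measurability _ _ (g_sigma_algebraType halfspace_events) R setT
  (fun x : {nonneg R} -> R => x (t i)) (@RGenInftyO.G R)).
  exact: RGenInftyO.measurableE.
move=> _ [_ [y ->] <-]; rewrite setTI.
rewrite (_ : _ @^-1` _ = \bigcup_q
    (if ratr q < y then halfspaces [:: (i, q)] else set0)).
  apply: bigcupT_measurable_rat => q; case: ifP => _; last exact: measurable0.
  by apply: sub_sigma_algebra; exists [:: (i, q)].
apply/seteqP; split => x /=; rewrite in_itv/=.
  move=> xy; have [q] := rat_in_itvoo xy; rewrite in_itv/= => /andP[xq qy].
  by exists q => //; rewrite qy => p; rewrite inE => /eqP -> /=; exact: ltW.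
move=> [q _]; case: ifP => // qy /(_ (i, q) (mem_head _ _)) H.
exact: le_lt_trans qy.
Qed.

Lemma measurable_combination (c : 'I_n -> R) (B : set R) : measurable B ->
  <<s halfspace_events >> [set x : {nonneg R} -> R | B (\sum_(i < n) c i * x (t i))].
Proof.
move=> mB.
have m : @measurable_fun _ _ (g_sigma_algebraType halfspace_events) R setT
    (fun x : {nonneg R} -> R => \sum_(i < n) c i * x (t i)).
  apply: measurable_sum => i; apply: measurable_funM => //.
  exact: measurable_coordinate_halfspace.
by have := m measurableT B mB; rewrite setTI.
Qed.

End rational_halfspaces.

End path_space.

Lemma measure_integral_indic {R : realType} d (T : measurableType d)
    (mu : {measure set T -> \bar R}) (A : set T) : measurable A ->
  mu A = (\int[mu]_w (\1_A w)%:E)%E.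
Proof. by move=> mA; rewrite integral_indic// setIT. Qed.

Section conditional_law.
Context {R : realType} d (T : measurableType d) (P : probability T R).
Variables (F H : set (set T)) (X m : R -> T -> R) (r : R -> R -> R).
Notation path := (g_sigma_algebraType (@cylinders R)).
Hypotheses (Fm : F `<=` measurable) (Hm : H `<=` measurable).
Hypothesis FH : indep_sets P <<s F >> <<s H >>.
Let TF := g_sigma_algebraType F.
Let TH := g_sigma_algebraType H.
Let Z t w := X t w - m t w.
Hypothesis mm : forall t, 0 <= t -> measurable_fun [set: TF] (m t).
Hypothesis mZ : forall t, 0 <= t -> measurable_fun [set: TH] (Z t).
Hypothesis iX : forall t, 0 <= t -> P.-integrable [set: T] (EFin \o X t).
Let variance_of n (t : 'I_n -> {nonneg R}) (c : 'I_n -> R) :=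
  \sum_(i < n) \sum_(j < n) c i * c j * r (t i)%:num (t j)%:num.
Hypothesis v0 : forall n (t : 'I_n -> {nonneg R}) c, 0 <= variance_of t c.
Hypothesis gZ : forall n (t : 'I_n -> {nonneg R}) c,
  centered_gaussian P (fun w => \sum_(i < n) c i * Z (t i)%:num w) (variance_of t c).

Let mZT t : 0 <= t -> measurable_fun [set: T] (Z t).
Proof. by move=> t0; apply: (measurable_fun_sigma Hm); exact: mZ. Qed.

Let mmT t : 0 <= t -> measurable_fun [set: T] (m t).
Proof. by move=> t0; apply: (measurable_fun_sigma Fm); exact: mm. Qed.

Let measurable_sample_path : @measurable_fun _ _ T path setT (sample_path X).
Proof.
apply: measurable_path => t.
rewrite (_ : (fun w => _) = (fun w => Z t%:num w + m t%:num w)).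
  by apply: measurable_funD; [exact: mZT|exact: mmT].
by apply/funext => w; rewrite /Z subrK.
Qed.

Let measurable_path_event (A : set path) : measurable A ->
  measurable (sample_path X @^-1` A).
Proof.
by move=> mA; rewrite -[X in measurable X]setTI; exact: measurable_sample_path.
Qed.

Definition shifted_path (w w' : T) : path := fun t => m t%:num w + Z t%:num w'.

Lemma measurable_shifted_path w : @measurable_fun _ _ T path setT (shifted_path w).
Proof. by apply: measurable_path => t; apply: measurable_funD => //; exact: mZT. Qed.

Lemma measurable_shifted_path2 :
  @measurable_fun _ _ (TF * TH)%type path setT (fun z => shifted_path z.1 z.2).
Proof.
apply: measurable_path => t; apply: measurable_funD.
  by apply: measurableT_comp; [exact: mm|exact: measurable_fst].
by apply: measurableT_comp; [exact: mZ|exact: measurable_snd].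
Qed.

(** The part known to [F] is frozen at [w], the independent part is drawn anew. *)
Definition shift_kernel (w : TF) : {measure set path -> \bar R} :=
  image_measure P (measurable_shifted_path w).

Let measurable_shift_kernel U : measurable U ->
  measurable_fun [set: TF] (shift_kernel ^~ U).
Proof.
move=> mU.
have mS : @measurable_fun _ _ (TF * T)%type path setT (fun z => shifted_path z.1 z.2).
  apply: measurable_path => t; apply: measurable_funD.
    by apply: measurableT_comp; [exact: mm|exact: measurable_fst].
  by apply: measurableT_comp; [exact: mZT|exact: measurable_snd].
have mA := mS measurableT U mU; rewrite setTI in mA.
have := @measurable_fun_xsection _ _ TF T R P _ mA.
congr (measurable_fun _ _); apply/funext => w /=.
by congr (P _); apply/seteqP; split => w'; rewrite /xsection/= inE.
Qed.

HB.instance Definition _ := isKernel.Build _ _ TF path R shift_kernel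
  measurable_shift_kernel.

Let shift_kernel_prob w : shift_kernel w [set: path] = 1%E.
Proof. by rewrite /shift_kernel image_measureE preimage_setT; exact: probability_setT. Qed.

HB.instance Definition _ := Kernel_isProbability.Build _ _ TF path R shift_kernel
  shift_kernel_prob.

(** [P (B `&` X^-1 A)] is the probability that [(w, w)] belongs to a measurable
    subset of the product space, and the diagonal has the product law. *)
Lemma shift_kernel_regular :
  @regular_conditional_law R d T P F X shift_kernel.
Proof.
move=> A B mA FB.
have mB : measurable B by exact: (sigma_measurable Fm).
pose S : set (TF * TH) := [set z | B z.1] `&`
  ((fun z => shifted_path z.1 z.2) @^-1` A).
have mS : measurable S.
  apply: measurableI; rewrite -[X in measurable X]setTI.
    exact: (@measurable_fst _ _ TF TH measurableT B FB).
  exact: measurable_shifted_path2.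
have zz w : shifted_path w w = sample_path X w.
  by apply/funext => t; rewrite /shifted_path /Z /sample_path addrC subrK.
have mST : measurable (B `&` sample_path X @^-1` A).
  by apply: measurableI => //; exact: measurable_path_event.
transitivity (\int[P]_w (\1_S (w, w))%:E)%E.
  rewrite (measure_integral_indic P mST); apply: eq_integral => w _.
  rewrite !indicE; congr ((nat_of_bool _)%:R%:E); apply/idP/idP; rewrite !inE /S /=.
    by move=> [Bw Aw]; split => //; rewrite /preimage /= zz.
  by move=> [Bw]; rewrite /preimage /= zz.
have mindS : measurable_fun [set: TF * TH] (fun z => (\1_S z)%:E : \bar R).
  exact/measurable_EFinP/measurable_indic.
rewrite (indep_integral_diag Fm Hm FH mindS); last by move=> z; rewrite lee_fin.
rewrite [RHS]integral_mkcond; apply: eq_integral => w _.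
rewrite patchE; case: ifPn => [/set_mem Bw|/negP nBw].
  have mA' : measurable (shifted_path w @^-1` A).
    by rewrite -[X in measurable X]setTI; exact: measurable_shifted_path.
  rewrite /shift_kernel image_measureE (measure_integral_indic P mA').
  apply: eq_integral => w' _; rewrite !indicE; congr ((nat_of_bool _)%:R%:E).
  by apply/idP/idP; rewrite !inE /S /=; [move=> []|move=> ?; split].
rewrite integral0_eq// => w' _; rewrite indicE memNset// => -[Bw _].
by apply: nBw; exact: mem_set.
Qed.

(** Both sides are [F]-measurable and have the same integral over each event of
    [F]; the comparison takes place in the sub-sigma-algebra, on which they are
    measurable. *)
Lemma regular_conditional_law_ae_eq (k1 k2 : R.-pker TF ~> path) (A : set path) :
  @regular_conditional_law R d T P F X k1 -> @regular_conditional_law R d T P F X k2 ->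
  measurable A -> {ae P, forall w, k1 w A = k2 w A}.
Proof.
move=> r1 r2 mA.
have mF : @measurable_fun _ _ T TF setT idfun.
  by move=> _ B mB; rewrite setTI; exact: (sigma_measurable Fm).
pose XF := @mfun_Sub _ _ T TF idfun (mem_set mF).
pose PF := distribution P XF.
have mk (k : R.-pker TF ~> path) : measurable_fun [set: TF] (k ^~ A).
  exact: measurable_kernel.
have iE (k : R.-pker TF ~> path) E : measurable E ->
    (\int[PF]_(w in E) k w A = \int[P]_(w in E) k w A)%E.
  move=> mE; rewrite (ge0_integral_pushforward mF)//.
  exact: measurable_funTS.
have ik : PF.-integrable [set: TF] (k1 ^~ A).
  apply/integrableP; split => //.
  under eq_integral do rewrite gee0_abs//.
  rewrite iE// -(r1 A setT mA (@measurableT _ TF)) ltey_eq fin_num_measure//.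
  by apply: measurableI => //; exact: measurable_path_event.
have : ae_eq PF setT (k1 ^~ A) (k2 ^~ A).
  apply: integral_ae_eq => // E _ mE.
  by rewrite !iE// -(r1 A E mA mE) -(r2 A E mA mE).
move=> [N [mN N0 HN]]; exists N; split.
- exact: (sigma_measurable Fm).
- exact: N0.
- by move=> w nw; apply: HN => h; apply: nw; exact: h.
Qed.

Lemma shift_kernel_gaussian (w : T) n (t : 'I_n -> {nonneg R}) :
  gaussian_vector (shift_kernel w) (fun i (x : path) => x (t i))
    (fun i => m (t i)%:num w) (fun i j => r (t i)%:num (t j)%:num).
Proof.
move=> c B mB; rewrite -/(variance_of t c).
set M := \sum_(i < n) c i * m (t i)%:num w.
transitivity (P ((fun w' => \sum_(i < n) c i * Z (t i)%:num w') @^-1`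
    [set x | B (M + x)])).
  rewrite /shift_kernel image_measureE; congr (P _); apply/funext => w'.
  rewrite /preimage /mkset /=; congr (B _).
  by rewrite /M -big_split/=; apply: eq_bigr => i _; rewrite mulrDr.
have mBM : measurable [set x | B (M + x)].
  have mf : measurable_fun [set: R] (fun x => M + x) by exact: measurable_funD.
  by rewrite -[X in measurable X]setTI; exact: mf.
rewrite gZ// !normal_lawE//; congr (normal_prob 0 1 _).
by apply/seteqP; split => x /=; rewrite add0r.
Qed.

Lemma regular_conditional_law_gaussian (k : R.-pker TF ~> path) :
  @regular_conditional_law R d T P F X k ->
  forall n (t : 'I_n -> {nonneg R}),
  {ae P, forall w, gaussian_vector (k w) (fun i (x : path) => x (t i))
    (fun i => m (t i)%:num w) (fun i j => r (t i)%:num (t j)%:num)}.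
Proof.
move=> rk n t.
have ae_eq_k (j : nat) : {ae P, forall w, forall s, unpickle j = Some s ->
    k w (halfspaces t s) = shift_kernel w (halfspaces t s)}.
  case Es : (unpickle j) => [s|]; last by apply: aeW.
  have := @regular_conditional_law_ae_eq k shift_kernel (halfspaces t s) rk
    shift_kernel_regular (measurable_halfspaces t s).
  move=> [N [mN N0 HN]]; exists N; split => // w nw.
  by apply: HN => h; apply: nw => _ [<-]; exact: h.
have [N [mN N0 HN]] := ae_foralln ae_eq_k; exists N; split => // w nw.
apply: HN => kw; apply: nw => c B mB.
rewrite -(shift_kernel_gaussian w t c mB).
apply: (@eq_prob_sigma R _ path (k w) (shift_kernel w) (halfspace_events t)).
- exact: halfspace_eventsI.
- exact: halfspace_eventsT.
- exact: halfspace_events_measurable.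
- by move=> _ [s _ <-]; apply: (kw (pickle s)); exact: pickleK.
- by rewrite prob_kernel ltry.
- exact: measurable_combination.
Qed.

Let Z_gaussian t : 0 <= t -> centered_gaussian P (Z t) (r t t) /\ 0 <= r t t.
Proof.
move=> t0; pose s := fun _ : 'I_1 => NngNum t0.
have := gZ s (fun=> 1); have := v0 s (fun=> 1).
rewrite /variance_of !big_ord1 !mul1r/=.
move=> rt gH; split => //; move: gH; congr (centered_gaussian P _ _).
by apply/funext => w; rewrite big_ord1 mul1r.
Qed.

Let Z_gaussianD t s : 0 <= t -> 0 <= s ->
  centered_gaussian P (fun w => Z t w + Z s w) (r t t + r t s + (r s t + r s s)) /\
  0 <= r t t + r t s + (r s t + r s s).
Proof.
move=> t0 s0; pose ts := fun i : 'I_2 => if i == ord0 then NngNum t0 else NngNum s0.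
have := gZ ts (fun=> 1); have := v0 ts (fun=> 1).
rewrite /variance_of !big_ord_recl !big_ord0/= !mul1r !addr0 /=.
move=> rt gH; split => //; move: gH; congr (centered_gaussian P _ _).
by apply/funext => w; rewrite !big_ord_recl big_ord0 !mul1r addr0.
Qed.

Hypothesis rC : forall t s, r t s = r s t.

Let integrable_Z t : 0 <= t -> P.-integrable [set: T] (EFin \o Z t).
Proof.
move=> t0; have [gt rt] := Z_gaussian t0.
exact: (integrable_gaussian (mZT t0) rt gt).
Qed.

Lemma is_conditional_expectation_mean t : 0 <= t ->
  is_conditional_expectation P F (X t) (m t).
Proof.
move=> t0; have [gt rt] := Z_gaussian t0.
have im : P.-integrable [set: T] (EFin \o m t).
  have := integrableB measurableT (iX t0) (integrable_Z t0).
  by apply: eq_integrable => // w _ /=; rewrite -EFinB /Z opprB addrC subrK.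
split => //; [exact: iX|exact: mm|move=> B FB].
have mB : measurable B by exact: (sigma_measurable Fm).
have -> : (\int[P]_(w in B) (X t w)%:E =
    \int[P]_(w in B) ((m t w)%:E + (Z t w)%:E))%E.
  by apply: eq_integral => w _; rewrite -EFinD /Z addrC subrK.
rewrite integralD//; [|exact: integrableS im|exact: integrableS (integrable_Z t0)].
rewrite (indep_integral Fm Hm FH FB (mZ t0) (integrable_Z t0)).
by rewrite (integral_gaussian (mZT t0) rt gt) mule0 adde0.
Qed.

(** [Z t * Z s] is independent of [F], and polarization gives its integral. *)
Lemma is_conditional_expectation_covariance t s : 0 <= t -> 0 <= s ->
  is_conditional_expectation P F
    (fun w => (X t w - m t w) * (X s w - m s w)) (fun=> r t s).
Proof.
move=> t0 s0; have [gt rt] := Z_gaussian t0; have [gs rs] := Z_gaussian s0.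
have [gts rts] := Z_gaussianD t0 s0.
have mts : measurable_fun [set: T] (fun w => Z t w + Z s w).
  by apply: measurable_funD; exact: mZT.
have msq (f : T -> R) (v : R) : measurable_fun [set: T] f -> 0 <= v ->
    centered_gaussian P f v -> P.-integrable [set: T] (EFin \o (fun w => f w ^+ 2)).
  move=> mf v0' gf; apply/integrableP; split.
    by apply/measurable_EFinP; exact: measurable_funX.
  under eq_integral do rewrite /= ger0_norm ?sqr_ge0//.
  by rewrite -/(sqr_norm P f) (sqr_norm_gaussian mf v0' gf) ltry.
have i1 := msq _ _ mts rts gts.
have i2 := msq _ _ (mZT t0) rt gt.
have i3 := msq _ _ (mZT s0) rs gs.
pose h w := Z t w * Z s w.
have hE w : (h w)%:E = ((2^-1)%:E * ((Z t w + Z s w) ^+ 2)%:E -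
   ((2^-1)%:E * (Z t w ^+ 2)%:E + (2^-1)%:E * (Z s w ^+ 2)%:E))%E.
  by rewrite -!EFinM -EFinD; congr (_%:E); rewrite /h; field.
have j1 := integrableZl measurableT 2^-1 i1.
have j2 := integrableZl measurableT 2^-1 i2.
have j3 := integrableZl measurableT 2^-1 i3.
have ih : P.-integrable [set: T] (EFin \o h).
  have := integrableB measurableT j1 (integrableD measurableT j2 j3).
  by apply: eq_integrable => // w _; rewrite /= hE.
have Eh : (\int[P]_w (h w)%:E = (r t s)%:E)%E.
  under eq_integral do rewrite hE.
  rewrite integralB//; last exact: integrableD.
  rewrite integralD// !integralZl//.
  rewrite -/(sqr_norm P (fun w => Z t w + Z s w)) -/(sqr_norm P (Z t)) -/(sqr_norm P (Z s)).
  rewrite (sqr_norm_gaussian mts rts gts) (sqr_norm_gaussian (mZT t0) rt gt).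
  rewrite (sqr_norm_gaussian (mZT s0) rs gs) -!EFinM -EFinD; congr (_%:E).
  by rewrite (rC s t); field.
have mh : measurable_fun [set: TH] h by apply: measurable_funM; exact: mZ.
split.
- exact: ih.
- exact: finite_measure_integrable_cst.
- exact: measurable_cst.
- move=> B FB; rewrite (indep_integral Fm Hm FH FB mh ih) Eh.
  by rewrite (integral_cst P (sigma_measurable Fm FB) (r t s)%:E) muleC.
Qed.

Lemma gaussian_conditional_law_of_decomposition :
  gaussian_conditional_law P F X m r.
Proof.
split.
- by exists shift_kernel; exact: shift_kernel_regular.
- exact: regular_conditional_law_gaussian.
- exact: is_conditional_expectation_mean.
- exact: is_conditional_expectation_covariance.
Qed.

End conditional_law.

(** * Integrals against a pair of Brownian motions *)

Section norm_continuity.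
Context {R : realType} d (T : measurableType d) (mu : {measure set T -> \bar R}).

(** Young's inequality with a weight [e] close to 0: it gives the continuity of the
    norm without square roots. *)
Lemma sqr_norm_perturb (f g : T -> R) (e : R) : 0 < e ->
  measurable_fun [set: T] f -> measurable_fun [set: T] g ->
  (sqr_norm mu g <= (1 + e)%:E * sqr_norm mu f + (1 + e^-1)%:E * sqr_dist mu f g)%E.
Proof.
move=> e0 mf mg; apply: sqr_norm_le => //.
- by rewrite addr_ge0// ltW.
- by rewrite addr_ge0// invr_ge0 ltW.
- by apply: measurable_funB.
move=> w; rewrite -subr_ge0.
have -> : (1 + e) * f w ^+ 2 + (1 + e^-1) * (f w - g w) ^+ 2 - g w ^+ 2 =
    e^-1 * (e * f w + (f w - g w)) ^+ 2 by field; rewrite gt_eqF.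
by rewrite mulr_ge0 ?sqr_ge0// invr_ge0 ltW.
Qed.

Lemma L2cvg_sqr_norm (F : nat -> T -> R) f (v : nat -> R) (l : R) :
  (forall n, measurable_fun [set: T] (F n)) -> measurable_fun [set: T] f ->
  L2cvg mu F f -> (forall n, sqr_norm mu (F n) = (v n)%:E) ->
  sqr_norm mu f = l%:E -> v n @[n --> \oo] --> l.
Proof.
move=> mF mf /fine_cvgP[fd cd] vE lE.
have l0 : 0 <= l by rewrite -lee_fin -lE sqr_norm_ge0.
apply/cvgrPdist_le => e e0.
(* Near the limit [v n <= 2 * l + 2], so a weight [h] perturbs both norms by at
   most [e / 2]; then [D] bounds the distance so that the last term is also at
   most [e / 2]. *)
pose h := Num.min 1 (e / 2 / (2 * l + 2)).
have l2 : 0 < 2 * l + 2 by rewrite ltr_wpDl// mulr_ge0.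
have h0 : 0 < h by rewrite lt_min ltr01 /= !divr_gt0.
have h1 : h <= 1 by rewrite ge_min lexx.
have hl : h * (2 * l + 2) <= e / 2.
  by rewrite -ler_pdivlMr// ge_min lexx orbT.
have H0 : 0 < 1 + h^-1 by rewrite addr_gt0// invr_gt0.
pose D := Num.min 1 (e / 2 / (1 + h^-1)).
have D0 : 0 < D by rewrite lt_min ltr01 /= !divr_gt0.
have D1 : D <= 1 by rewrite ge_min lexx.
have DH : D * (1 + h^-1) <= e / 2.
  by rewrite -ler_pdivlMr// ge_min lexx orbT.
have /cvgrPdist_le/(_ D D0) cd' := cd.
near=> n.
have fn : sqr_dist mu f (F n) \is a fin_num by near: n.
have := sqr_dist_ge0 mu f (F n).
have : `|0 - fine (sqr_dist mu f (F n))| <= D by near: n.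
have A1 := @sqr_norm_perturb f (F n) 1 ltr01 mf (mF n).
have A2 := @sqr_norm_perturb f (F n) h h0 mf (mF n).
have A3 := @sqr_norm_perturb (F n) f h h0 (mF n) mf.
rewrite (sqr_distC mu (F n) f) in A3.
move: fn A1 A2 A3; rewrite vE lE.
move=> /fineK <-; move: (fine (sqr_dist mu f (F n))) => x.
rewrite -!EFinM -!EFinD !lee_fin invr1 sub0r normrN => A1 A2 A3 + x0.
rewrite (ger0_norm x0) => xD.
have xH : x * (1 + h^-1) <= e / 2.
  by apply: le_trans DH; apply: ler_wpM2r => //; exact: ltW.
have vl : v n <= 2 * l + 2 by lra.
have hv : h * v n <= e / 2 by apply: le_trans hl; apply: ler_wpM2l => //; exact: ltW.
have hl' : h * l <= e / 2.
  by apply: le_trans hl; apply: ler_wpM2l; [exact: ltW|lra].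
rewrite ler_distl; apply/andP; split; lra.
Unshelve. all: end_near.
Qed.

End norm_continuity.

Lemma eq_L2cvg {R : realType} d (T : measurableType d) (mu : {measure set T -> \bar R})
    (F G : nat -> T -> R) f g : (forall n w, F n w = G n w) -> (forall w, f w = g w) ->
  L2cvg mu F f -> L2cvg mu G g.
Proof.
move=> FG fg; have -> : G = F by apply/funext => n; apply/funext => w; rewrite FG.
by have -> : g = f by apply/funext => w; rewrite fg.
Qed.

Lemma L2cvg_cst {R : realType} d' (S : measurableType d') (m : {measure set S -> \bar R})
  (F : nat -> S -> R) f : (forall n w, F n w = f w) -> L2cvg m F f.
Proof.
move=> Ff; rewrite /L2cvg (_ : (fun n => _) = cst 0%E); first exact: cvg_cst.
apply/funext => n; rewrite /sqr_dist /sqr_norm integral0_eq// => w _.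
by rewrite Ff subrr expr0n.
Qed.

Section two_dimensional_integrals.
Context {R : realType} d (T : measurableType d) (P : probability T R).
Variables W W' : R -> {RV P >-> R}.
Hypotheses (bW : brownian_motion W) (bW' : brownian_motion W').
Hypothesis WW' : independent_processes P W W'.
Notation mu := (@lebesgue_measure R).
Notation step := (step (R := R)).

(** [J] is a version of [\int h dW + \int g dW']. Both integrands are carried along
    because the conditional covariance involves the two of them. *)
Definition is_pair_integral (h g : R -> R) (J : T -> R) :=
  exists s s' : nat -> step,
    [/\ forall n, ordered_step (s n) /\ ordered_step (s' n),
        L2cvg mu (fun n => step_fun (s n)) h,
        L2cvg mu (fun n => step_fun (s' n)) g &
        L2cvg P (fun n w => step_integral W (s n) w + step_integral W' (s' n) w) J].

Lemma measurable_pair_step_integral (s s' : step) :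
  measurable_fun [set: T] (fun w => step_integral W s w + step_integral W' s' w).
Proof. by apply: measurable_funD; exact: measurable_step_integral. Qed.

Lemma is_pair_integral_lin h g J h' g' J' (p q : R) :
  measurable_fun [set: R] h -> measurable_fun [set: R] g -> measurable_fun [set: T] J ->
  measurable_fun [set: R] h' -> measurable_fun [set: R] g' -> measurable_fun [set: T] J' ->
  is_pair_integral h g J -> is_pair_integral h' g' J' ->
  is_pair_integral (fun v => p * h v + q * h' v) (fun v => p * g v + q * g' v)
    (fun w => p * J w + q * J' w).
Proof.
move=> mh mg mJ mh' mg' mJ' [s [s' [os sh s'g sJ]]] [z [z' [oz zh z'g zJ]]].
exists (fun n => scale_step p (s n) ++ scale_step q (z n)).
exists (fun n => scale_step p (s' n) ++ scale_step q (z' n)).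
split.
- by move=> n; have [? ?] := os n; have [? ?] := oz n; split;
    apply: ordered_cat; exact: ordered_scale.
- rewrite (_ : (fun n => _) = (fun n v => p * step_fun (s n) v + q * step_fun (z n) v)).
    by apply: L2cvg_lin => // n; exact: measurable_step_fun.
  by apply/funext => n; apply/funext => v; rewrite step_fun_cat !step_fun_scale.
- rewrite (_ : (fun n => _) = (fun n v => p * step_fun (s' n) v + q * step_fun (z' n) v)).
    by apply: L2cvg_lin => // n; exact: measurable_step_fun.
  by apply/funext => n; apply/funext => v; rewrite step_fun_cat !step_fun_scale.
- rewrite (_ : (fun n => _) = (fun n w =>
      p * (step_integral W (s n) w + step_integral W' (s' n) w) +
      q * (step_integral W (z n) w + step_integral W' (z' n) w))).
    by apply: L2cvg_lin => // n; exact: measurable_pair_step_integral.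
  apply/funext => n; apply/funext => w.
  by rewrite !step_integral_cat !step_integral_scale; ring.
Qed.

Lemma is_pair_integral0 : is_pair_integral (fun=> 0) (fun=> 0) (fun=> 0).
Proof.
exists (fun=> [::]), (fun=> [::]); split=> [n| | |]; first by [].
- by apply: L2cvg_cst => n v; rewrite /step_fun big_nil.
- by apply: L2cvg_cst => n v; rewrite /step_fun big_nil.
- by apply: L2cvg_cst => n v; rewrite /step_integral !big_nil addr0.
Qed.

Lemma is_pair_integral_sum n (c : 'I_n -> R) (h g : 'I_n -> R -> R) (J : 'I_n -> T -> R) :
  (forall i, measurable_fun [set: R] (h i)) -> (forall i, measurable_fun [set: R] (g i)) ->
  (forall i, measurable_fun [set: T] (J i)) ->
  (forall i, is_pair_integral (h i) (g i) (J i)) ->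
  is_pair_integral (fun v => \sum_(i < n) c i * h i v) (fun v => \sum_(i < n) c i * g i v)
    (fun w => \sum_(i < n) c i * J i w).
Proof.
move=> mh mg mJ HJ.
suff H : forall r : seq 'I_n, is_pair_integral (fun v => \sum_(i <- r) c i * h i v)
    (fun v => \sum_(i <- r) c i * g i v) (fun w => \sum_(i <- r) c i * J i w) by exact: H.
have ms d' (S : measurableType d') (f : 'I_n -> S -> R) r :
    (forall i, measurable_fun [set: S] (f i)) ->
    measurable_fun [set: S] (fun v => \sum_(i <- r) c i * f i v).
  by move=> mf; apply: measurable_sum => i; exact: measurable_funM.
elim=> [|i r IH].
  have := is_pair_integral0; congr is_pair_integral;
    by apply/funext => v; rewrite big_nil.
have := @is_pair_integral_lin _ _ _ _ _ _ (c i) 1 (mh i) (mg i) (mJ i)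
  (ms _ _ _ r mh) (ms _ _ _ r mg) (ms _ _ _ r mJ) (HJ i) IH.
by congr is_pair_integral; apply/funext => v; rewrite big_cons mul1r.
Qed.

(** Step integrals are Gaussian, and their variances converge to the squared norm
    of the integrands. *)
Lemma is_pair_integral_gaussian h g J (p q : R) :
  measurable_fun [set: R] h -> measurable_fun [set: R] g -> measurable_fun [set: T] J ->
  sqr_norm mu h = p%:E -> sqr_norm mu g = q%:E ->
  is_pair_integral h g J -> centered_gaussian P J (p + q).
Proof.
move=> mh mg mJ hp gq [s [s' [os sh s'g sJ]]].
have fin (z : step) : ordered_step z ->
    sqr_norm mu (step_fun z) = (fine (sqr_norm mu (step_fun z)))%:E.
  by move=> oz; rewrite fineK//; exact: sqr_norm_step_fin.
have n0 d' (S : measurableType d') (m : {measure set S -> \bar R}) f : 0 <= fine (sqr_norm m f).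
  by apply: fine_ge0; exact: sqr_norm_ge0.
apply: (@centered_gaussian_limit _ _ _ P
  (fun n w => step_integral W (s n) w + step_integral W' (s' n) w) J
  (fun n => fine (sqr_norm mu (step_fun (s n))) + fine (sqr_norm mu (step_fun (s' n))))).
- by move=> n; exact: measurable_pair_step_integral.
- exact: mJ.
- by move=> n; rewrite addr_ge0.
- by rewrite -lee_fin EFinD -hp -gq adde_ge0// sqr_norm_ge0.
- by move=> n; apply: step_gaussian => //; case: (os n).
- apply: cvgD.
    apply: (@L2cvg_sqr_norm _ _ _ mu (fun n => step_fun (s n)) h) => //.
      by move=> n; exact: measurable_step_fun.
    by move=> n; apply: fin; case: (os n).
  apply: (@L2cvg_sqr_norm _ _ _ mu (fun n => step_fun (s' n)) g) => //.
    by move=> n; exact: measurable_step_fun.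
  by move=> n; apply: fin; case: (os n).
- exact: sJ.
Qed.

End two_dimensional_integrals.

(** * Cutting step functions, covariances in L2 *)

Section cuts.
Context {R : realType}.
Notation mu := (@lebesgue_measure R).
Notation step := (step (R := R)).
Variable u : R.

Definition cut_past (s : step) : step :=
  [seq (p.1, (Num.min p.2.1 u, Num.min p.2.2 u)) | p <- s].
Definition cut_future (s : step) : step :=
  [seq (p.1, (Num.max p.2.1 u, Num.max p.2.2 u)) | p <- s].

Lemma ordered_cut_past s : 0 <= u -> ordered_step s -> ordered_step (cut_past s).
Proof.
move=> u0 os _ /mapP[p /os /andP[p0 p12] ->] /=.
by rewrite le_min p0 u0 /= le_min !ge_min p12 lexx orbT.
Qed.

Lemma step_fun_cut_past s v : step_fun (cut_past s) v = step_fun s v * (v <= u)%R%:R.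
Proof.
rewrite /step_fun /cut_past big_map mulr_suml; apply: eq_bigr => p _ /=.
rewrite -mulrA -natrM mulnb; congr (_ * (nat_of_bool _)%:R).
by rewrite gt_min le_min; case: (leP v u) => vu; rewrite ?andbT ?andbF ?orbF.
Qed.

Lemma step_integral_cut d (T : measurableType d) (X : R -> T -> R) s w :
  step_integral X s w = step_integral X (cut_past s) w + step_integral X (cut_future s) w.
Proof.
rewrite /step_integral !big_map -big_split/=; apply: eq_bigr => p _.
rewrite -mulrDr; congr (_ * _); rewrite /Num.min /Num.max.
by case: ltP => _; case: ltP => _; ring.
Qed.

Lemma L2cvg_cut_past (s : nat -> step) (f g : R -> R) :
  measurable_fun [set: R] f -> measurable_fun [set: R] g ->
  (forall v, g v = f v * (v <= u)%R%:R) -> L2cvg mu (fun n => step_fun (s n)) f ->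
  L2cvg mu (fun n => step_fun (cut_past (s n))) g.
Proof.
move=> mf mg gE; rewrite /L2cvg => sf; apply: (cvge0_le _ _ sf) => n; first exact: sqr_dist_ge0.
have := @sqr_norm_le _ _ _ mu (fun w => g w - step_fun (cut_past (s n)) w)
  (fun w => f w - step_fun (s n) w) (fun=> 0) 1 0.
rewrite mul1e mul0e adde0; apply => //.
- by apply: measurable_funB => //; exact: measurable_step_fun.
- by apply: measurable_funB => //; exact: measurable_step_fun.
- move=> w; rewrite gE step_fun_cut_past -mulrBl mul1r mul0r addr0 exprMn.
  by case: (w <= u); rewrite ?expr1n ?mulr1// expr0n mulr0 sqr_ge0.
Qed.

End cuts.

Lemma measurable_step_integral_in {R : realType} d (T : measurableType d)
    (X : R -> T -> R) (s : step (R := R)) :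
  (forall p, p \in s -> measurable_fun [set: T] (increment X p.2.1 p.2.2)) ->
  measurable_fun [set: T] (step_integral X s).
Proof.
elim: s => [|p s IH] ms.
  rewrite (_ : step_integral X [::] = cst 0); first exact: measurable_cst.
  by apply/funext => w; rewrite /step_integral big_nil.
rewrite (_ : step_integral X (p :: s) =
    (fun w => p.1 * increment X p.2.1 p.2.2 w + step_integral X s w)); last first.
  by apply/funext => w; rewrite /step_integral big_cons.
apply: measurable_funD.
  by apply: measurable_funM; [exact: measurable_cst|apply: ms; exact: mem_head].
by apply: IH => q qs; apply: ms; rewrite inE qs orbT.
Qed.

Section bilinear.
Context {R : realType} d (T : measurableType d) (mu : {measure set T -> \bar R}).

(** From [2 * |x * y| <= x ^+ 2 + y ^+ 2]. *)
Lemma integrable_mul_L2 (f g : T -> R) :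
  measurable_fun [set: T] f -> measurable_fun [set: T] g ->
  (sqr_norm mu f < +oo)%E -> (sqr_norm mu g < +oo)%E ->
  mu.-integrable [set: T] (EFin \o (fun w => f w * g w)).
Proof.
move=> mf mg f2 g2; apply/integrableP; split.
  by apply/measurable_EFinP; exact: measurable_funM.
apply: (@le_lt_trans _ _ (sqr_norm mu f + sqr_norm mu g)%E); last exact: lte_add_pinfty.
rewrite /sqr_norm -ge0_integralD//; [|by move=> w _; rewrite lee_fin sqr_ge0|
  exact: measurable_sqr|by move=> w _; rewrite lee_fin sqr_ge0|exact: measurable_sqr].
apply: ge0_le_integral => //.
- by apply/measurableT_comp => //; apply/measurable_EFinP; exact: measurable_funM.
- by apply: emeasurable_funD; exact: measurable_sqr.
- move=> w _; rewrite -EFinD lee_fin normrM.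
  rewrite -(ger0_norm (sqr_ge0 (f w))) -(ger0_norm (sqr_ge0 (g w))) !normrX.
  have := normr_ge0 (f w); have := normr_ge0 (g w).
  move: `|f w| `|g w| => x y x0 y0; have := sqr_ge0 (x - y); nra.
Qed.

Lemma sqr_norm_sum n (c : 'I_n -> R) (h : 'I_n -> T -> R) :
  (forall i, measurable_fun [set: T] (h i)) -> (forall i, (sqr_norm mu (h i) < +oo)%E) ->
  sqr_norm mu (fun w => \sum_(i < n) c i * h i w) =
  (\sum_(i < n) \sum_(j < n) c i * c j * \int[mu]_w (h i w * h j w))%:E.
Proof.
move=> mh h2.
have ih i j : mu.-integrable [set: T] (EFin \o (fun w => h i w * h j w)).
  exact: integrable_mul_L2.
have ihc i j : mu.-integrable [set: T] (fun w => ((c i * c j)%:E * (h i w * h j w)%:E)%E).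
  exact: (integrableZl measurableT (c i * c j) (ih i j)).
have E w : ((\sum_(i < n) c i * h i w) ^+ 2)%:E =
    (\sum_(i < n) \sum_(j < n) (c i * c j)%:E * (h i w * h j w)%:E)%E.
  rewrite expr2 mulr_suml -sumEFin; apply: eq_bigr => i _; rewrite mulr_sumr -sumEFin.
  by apply: eq_bigr => j _; rewrite -EFinM; congr (_%:E); ring.
rewrite /sqr_norm; under eq_integral do rewrite E.
rewrite integral_sum//; last by move=> i; apply: integrable_sum => // j _; exact: ihc.
rewrite -sumEFin; apply: eq_bigr => i _.
rewrite integral_sum//.
rewrite -sumEFin; apply: eq_bigr => j _ /=.
rewrite [RHS]EFinM /Rintegral fineK; last exact: (integrable_fin_num measurableT (ih i j)).
exact: (integralZl measurableT (ih i j)).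
Qed.

End bilinear.

(** * The Volterra process *)

Section volterra.
Context {R : realType} d (T : measurableType d) (P : probability T R).
Variables (W W' X : R -> {RV P >-> R}) (k : R -> R -> R) (a b u : R).
Hypotheses (bW : brownian_motion W) (bW' : brownian_motion W').
Hypothesis WW' : independent_processes P W W'.
Hypothesis k_causal : forall t s, t < s -> k t s = 0.
Hypothesis mk : forall t, measurable_fun [set: R] (k t).
Hypothesis k2 : forall t, 0 <= t ->
  (\int[lebesgue_measure]_(s in `[0%R, t]) ((k t s) ^+ 2)%:E < +oo)%E.
Hypothesis XE : forall t, 0 <= t ->
  {ae P, forall w, X t w = wiener_integral P W t (k t) w}.
Hypothesis ab0 : 0 < a ^+ 2 + b ^+ 2.
Hypothesis u0 : 0 < u.
Notation mu := (@lebesgue_measure R).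
Notation step := (step (R := R)).
Let c2 := a ^+ 2 + b ^+ 2.

Let W'W : independent_processes P W' W.
Proof. by move=> A B FA FB; rewrite setIC WW'// muleC. Qed.

Let isoW := step_isometry_dist bW bW' WW'.
Let isoW' := step_isometry_dist bW' bW W'W.

Let full t := truncation t (k t).
Let past t := truncation u (k t).

Let mfull t : measurable_fun [set: R] (full t). Proof. exact: measurable_truncation. Qed.
Let mpast t : measurable_fun [set: R] (past t). Proof. exact: measurable_truncation. Qed.

(** When [t < u], causality of the kernel makes the two truncations agree. *)
Lemma past_cut t v : past t v = full t v * (v <= u)%R%:R.
Proof.
rewrite /past /full /truncation -mulrA -natrM mulnb.
case: (ltP t v) => [/k_causal ->|vt]; first by rewrite !mul0r.
by rewrite andbT.
Qed.

Let full_fin t : 0 <= t -> (sqr_norm mu (full t) < +oo)%E.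
Proof. by move=> t0; rewrite sqr_norm_truncation//; exact: k2. Qed.

Let past_fin t : 0 <= t -> (sqr_norm mu (past t) < +oo)%E.
Proof.
move=> t0; apply: le_lt_trans (full_fin t0).
have := @sqr_norm_le _ _ _ mu (past t) (full t) (fun=> 0) 1 0.
rewrite mul1e mul0e adde0; apply=> [|||||w];
  [by []|by []|exact: mpast|exact: mfull|exact: measurable_cst|].
rewrite past_cut mul1r mul0r addr0 exprMn.
by case: (w <= u); rewrite ?expr1n ?mulr1// expr0n mulr0 sqr_ge0.
Qed.

Let k2u t : 0 <= t ->
  (\int[mu]_(s in `[0%R, u]) ((k t s) ^+ 2)%:E < +oo)%E.
Proof. by move=> t0; rewrite -sqr_norm_truncation//; exact: past_fin. Qed.

Let I t : T -> R := wiener_integral P W u (k t).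
Let I' t : T -> R := wiener_integral P W' u (k t).

Let mI t : measurable_fun [set: T] (I t).
Proof. exact: measurable_funPT. Qed.
Let mI' t : measurable_fun [set: T] (I' t).
Proof. exact: measurable_funPT. Qed.

(** One sequence has to serve for [X t] and, once cut at [u], for the integrals in
    the mean, so that the residual is a limit of differences of step integrals. *)
Lemma approximation t : 0 <= t -> exists s : nat -> step,
  [/\ forall n, ordered_step (s n),
      L2cvg mu (fun n => step_fun (s n)) (full t),
      L2cvg mu (fun n => step_fun (cut_past u (s n))) (past t),
      L2cvg P (fun n => step_integral W (s n)) (X t) &
      L2cvg P (fun n => step_integral W (cut_past u (s n))) (I t) /\
      L2cvg P (fun n => step_integral W' (cut_past u (s n))) (I' t)].
Proof.
move=> t0; have [s st sf] := exists_step_approximation (mk t) (k2 t0).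
have os n : ordered_step (s n) by exact: step_on_ordered (st n).
have ocs n : ordered_step (cut_past u (s n)) by apply: ordered_cut_past => //; exact: ltW.
have cs : L2cvg mu (fun n => step_fun (cut_past u (s n))) (past t).
  by apply: (@L2cvg_cut_past _ u s (full t)) => //; exact: past_cut.
exists s; split => //.
- have := wiener_integral_limit isoW (mk t) (k2 t0) os sf.
  rewrite /L2cvg => H; rewrite (_ : (fun n => _) = (fun n =>
    sqr_dist P (wiener_integral P W t (k t)) (step_integral W (s n))))//.
  apply/funext => n.
  apply: ae_eq_sqr_norm.
  + by apply: measurable_funB => //; exact: measurable_step_integral.
  + by apply: measurable_funB => //; exact: measurable_step_integral.
  have [N [mN N0 HN]] := XE t0; exists N; split => // w nw; apply: HN => h.
  by apply: nw => /=; rewrite h.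
- split.
    exact: (wiener_integral_limit isoW (mk t) (k2u t0) ocs cs).
  exact: (wiener_integral_limit isoW' (mk t) (k2u t0) ocs cs).
Qed.

Let m t w := a / c2 * wiener_integral_comb P a b W W' u (k t) w.
Let Z t w := X t w - m t w.
(* The residual is [\int h t dW + \int g t dW']. *)
Let h t v := 1 * full t v + - (a ^+ 2 / c2) * past t v.
Let g t v := - (a * b / c2) * past t v.

Lemma Z_pair_integral t : 0 <= t -> is_pair_integral W W' (h t) (g t) (Z t).
Proof.
move=> t0; have [s [os sf sp sX [sI sI']]] := approximation t0.
have ocs n : ordered_step (cut_past u (s n)) by apply: ordered_cut_past => //; exact: ltW.
exists (fun n => scale_step 1 (s n) ++ scale_step (- (a ^+ 2 / c2)) (cut_past u (s n))).
exists (fun n => scale_step (- (a * b / c2)) (cut_past u (s n))).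
have msf (z : step) := measurable_step_fun z.
have msi (Y : R -> {RV P >-> R}) (z : step) := measurable_step_integral Y z.
split.
- move=> n; split; last exact: ordered_scale.
  by apply: ordered_cat; exact: ordered_scale.
- rewrite (_ : (fun n => _) = (fun n v => 1 * step_fun (s n) v +
    - (a ^+ 2 / c2) * step_fun (cut_past u (s n)) v)); last first.
    by apply/funext => n; apply/funext => v; rewrite step_fun_cat !step_fun_scale.
  by apply: L2cvg_lin => [||n|n||];
    [exact: mfull|exact: mpast|exact: msf|exact: msf|exact: sf|exact: sp].
- have := @L2cvg_lin _ _ _ mu _ _ _ _ (- (a * b / c2)) 0 (mpast t) (mpast t)
    (fun n => msf (cut_past u (s n))) (fun n => msf (cut_past u (s n))) sp sp.
  apply: eq_L2cvg => [n v|v]; last by rewrite mul0r addr0.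
  by rewrite step_fun_scale mul0r addr0.
- have A := @L2cvg_lin _ _ _ P _ _ _ _ (- (a ^+ 2 / c2)) (- (a * b / c2)) (mI t) (mI' t)
    (fun n => msi W (cut_past u (s n))) (fun n => msi W' (cut_past u (s n))) sI sI'.
  have := @L2cvg_lin _ _ _ P _ _ _ _ 1 1 (measurable_funPT (X t))
    (measurable_fun_lin _ _ (mI t) (mI' t))
    (fun n => msi W (s n)) (fun n => measurable_fun_lin _ _ (msi W (cut_past u (s n)))
    (msi W' (cut_past u (s n)))) sX A.
  apply: eq_L2cvg => [n w|w].
    by rewrite step_integral_cat !step_integral_scale; ring.
  rewrite /Z /m /wiener_integral_comb -/(I t w) -/(I' t w).
  by ring.
Qed.

Let Y := lin_process W W' a b.
Let F := natural_filtration P Y u.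
Let H := future_events W W' a b u `|` null_events P.
Let TF := g_sigma_algebraType F.
Let TH := g_sigma_algebraType H.

Let mY v : measurable_fun [set: T] (Y v).
Proof. by apply: measurable_fun_lin; exact: measurable_funPT. Qed.

Let Hm : H `<=` measurable.
Proof. by move=> A [/future_events_measurable//|[]]. Qed.

Let FmE : process_events `[0, u] Y `|` [set N | measurable N /\ P N = 0%E] `<=` measurable.
Proof.
move=> A [[v _ [B mB ->]]|[]//].
by rewrite -[X in measurable X]setTI; exact: mY.
Qed.

Let Fm : F `<=` measurable.
Proof. exact: sigma_measurable FmE. Qed.

Let nullF : [set N | measurable N /\ P N = 0%E] `<=` <<s F >>.
Proof. by move=> N PN; apply: sub_sigma_algebra; apply: sub_sigma_algebra; right. Qed.

Let nullH : [set N | measurable N /\ P N = 0%E] `<=` <<s H >>.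
Proof. by move=> N PN; apply: sub_sigma_algebra; right. Qed.

(** The observed process is determined by its increments because it vanishes
    almost surely at time 0. *)
Lemma natural_filtration_past : F `<=` <<s past_events W W' a b u `|` null_events P >>.
Proof.
set G := past_events W W' a b u `|` null_events P.
apply: smallest_sub; first exact: smallest_sigma_algebra.
move=> A [[v]|PA]; last by apply: sub_sigma_algebra; right.
rewrite /= in_itv/= => /andP[v0 vu] [B mB ->].
have Gm : G `<=` measurable by move=> E [/past_events_measurable//|[]].
suff mYG : measurable_fun [set: g_sigma_algebraType G] (Y v).
  by rewrite -[X in <<s _ >> X]setTI; exact: (mYG measurableT B mB).
apply: (@L2cvg_measurable _ _ T P G (fun=> increment Y 0 v) (Y v)) => //.
- by move=> N PN; apply: sub_sigma_algebra; right.
- move=> _ _ D mD; rewrite setTI; apply: sub_sigma_algebra; left.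
  by exists 0, v; split => //; exists D.
have mi : measurable_fun [set: T] (increment Y 0 v) by apply: measurable_funB.
rewrite /L2cvg (_ : (fun n => _) = cst 0%E); first exact: cvg_cst.
apply/funext => n; rewrite /sqr_dist.
rewrite (@ae_eq_sqr_norm _ _ _ P _ (fun=> 0)).
- by rewrite /sqr_norm integral0_eq// => w _; rewrite expr0n.
- exact: measurable_funB.
- exact: measurable_cst.
have [[N [mN N0 HN]] _ _ _] := bW; have [[N' [mN' N'0 HN']] _ _ _] := bW'.
exists (N `|` N'); split.
- exact: measurableU.
- exact: null_set_setU.
move=> w nw; apply/not_notP => /not_orP[nN nN']; apply: nw => /=.
have W0 : W 0 w = 0 by apply/not_notP => ?; apply: nN; exact: HN.
have W'0 : W' 0 w = 0 by apply/not_notP => ?; apply: nN'; exact: HN'.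
by rewrite /increment /Y /lin_process W0 W'0; ring.
Qed.

Let indepFH : indep_sets P <<s F >> <<s H >>.
Proof.
move=> A B FA HB.
apply: (indep_past_future bW bW' WW' ab0 (ltW u0)) HB.
by move: FA; apply: smallest_sub; [exact: smallest_sigma_algebra|exact: natural_filtration_past].
Qed.

Let mYF v : 0 <= v <= u -> measurable_fun [set: TF] (Y v).
Proof.
move=> vu _ D mD; rewrite setTI; apply: sub_sigma_algebra; apply: sub_sigma_algebra; left.
by exists v; [rewrite /= in_itv|exists D].
Qed.

Lemma measurable_mean t : 0 <= t -> measurable_fun [set: TF] (m t).
Proof.
move=> t0; have [s [os _ _ _ [sI sI']]] := approximation t0.
have msi (Z' : R -> {RV P >-> R}) (z : step) := measurable_step_integral Z' z.
have A := @L2cvg_lin _ _ _ P _ _ _ _ (a / c2 * a) (a / c2 * b) (mI t) (mI' t)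
  (fun n => msi W (cut_past u (s n))) (fun n => msi W' (cut_past u (s n))) sI sI'.
have B : L2cvg P (fun n w => a / c2 * step_integral Y (cut_past u (s n)) w) (m t).
  move: A; apply: eq_L2cvg => [n w|w]; last first.
    by rewrite /m /wiener_integral_comb -/(I t w) -/(I' t w); ring.
  rewrite /step_integral !mulr_sumr -big_split; apply: eq_bigr => p _.
  by rewrite /Y /lin_process /=; ring.
apply: L2cvg_measurable B => //.
- by rewrite /m; apply: measurable_funM => //; apply: measurable_fun_lin; exact: measurable_funPT.
- move=> n; apply: measurable_funM => //.
  apply: measurable_step_integral_in => p /mapP[q qs ->] /=.
  have /andP[q1 q12] := os n q qs.
  have cut x : 0 <= x -> 0 <= Num.min x u <= u.
    by move=> x0; rewrite le_min x0 (ltW u0) ge_min lexx orbT.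
  by apply: measurable_funB; apply: mYF; apply: cut => //; exact: le_trans q12.
Qed.

Let mZ t : measurable_fun [set: T] (Z t).
Proof.
apply: measurable_funB; first exact: measurable_funPT.
by rewrite /m; apply: measurable_funM => //; apply: measurable_fun_lin; exact: measurable_funPT.
Qed.

(** Before [u], removing the mean from [dW] leaves [- (b / c2) d(- b W + a W')];
    after [u] all of [dW] remains. *)
Lemma measurable_residual t : 0 <= t -> measurable_fun [set: TH] (Z t).
Proof.
move=> t0; have [s [os _ _ sX [sI sI']]] := approximation t0.
have msi (Z' : R -> {RV P >-> R}) (z : step) := measurable_step_integral Z' z.
have A := @L2cvg_lin _ _ _ P _ _ _ _ (- (a / c2 * a)) (- (a / c2 * b)) (mI t) (mI' t)
  (fun n => msi W (cut_past u (s n))) (fun n => msi W' (cut_past u (s n))) sI sI'.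
have A' := @L2cvg_lin _ _ _ P _ _ _ _ 1 1 (measurable_funPT (X t))
    (measurable_fun_lin _ _ (mI t) (mI' t))
    (fun n => msi W (s n)) (fun n => measurable_fun_lin _ _ (msi W (cut_past u (s n)))
    (msi W' (cut_past u (s n)))) sX A.
pose V := lin_process W W' (- b) a.
have B : L2cvg P (fun n w => - (b / c2) * step_integral V (cut_past u (s n)) w +
    1 * step_integral W (cut_future u (s n)) w) (Z t).
  move: A'; apply: eq_L2cvg => [n w|w]; last first.
    by rewrite /Z /m /wiener_integral_comb -/(I t w) -/(I' t w); ring.
  rewrite (step_integral_cut u W (s n) w).
  have -> : step_integral V (cut_past u (s n)) w =
      - b * step_integral W (cut_past u (s n)) w + a * step_integral W' (cut_past u (s n)) w.
    rewrite /step_integral !mulr_sumr -big_split; apply: eq_bigr => p _.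
    by rewrite /V /lin_process /=; ring.
  by rewrite /c2; field; rewrite gt_eqF.
apply: L2cvg_measurable B => // n; apply: measurable_fun_lin.
- apply: measurable_step_integral_in => p /mapP[q qs ->] /=.
  have /andP[q1 q12] := os n q qs.
  move=> _ D mD; rewrite setTI; apply: sub_sigma_algebra; left; left.
  exists (Num.min q.2.1 u), (Num.min q.2.2 u); split.
  + by rewrite le_min q1 ltW.
  + by rewrite le_min !ge_min q12 lexx orbT.
  + by rewrite ge_min lexx orbT.
  + by exists D.
- apply: measurable_step_integral_in => p /mapP[q qs ->] /=.
  have /andP[q1 q12] := os n q qs.
  move=> _ D mD; rewrite setTI; apply: sub_sigma_algebra; left; right.
  exists (Num.max q.2.1 u), (Num.max q.2.2 u); split.
  + by rewrite le_max lexx orbT.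
  + by rewrite ge_max !le_max q12 lexx orbT.
  + by exists D.
Qed.

Let r t s := \int[mu]_(v in `[0, Num.min t s])
    ((1 - a ^+ 2 / c2 * (v < u)%R%:R) ^+ 2 * k t v * k s v) +
  a ^+ 2 * b ^+ 2 / c2 ^+ 2 * \int[mu]_(v in `[0, u]) (k t v * k s v).

Let mh t : measurable_fun [set: R] (h t).
Proof. exact: measurable_fun_lin. Qed.

Let mg t : measurable_fun [set: R] (g t).
Proof. by apply: measurable_funM. Qed.

Let h_fin t : 0 <= t -> (sqr_norm mu (h t) < +oo)%E.
Proof.
move=> t0; have mZf (c : R) (f : R -> R) : measurable_fun [set: R] f ->
    measurable_fun [set: R] (fun v => c * f v) by move=> mf; exact: measurable_funM.
apply: (le_lt_trans (sqr_normD mu (mZf 1 _ (mfull t)) (mZf (- (a ^+ 2 / c2)) _ (mpast t)))).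
rewrite !sqr_normZ; [|exact: mpast|exact: mfull].
have fin2 (c : R) (f : R -> R) : (sqr_norm mu f < +oo)%E ->
    (2%:E * ((c ^+ 2)%:E * sqr_norm mu f) < +oo)%E.
  by move=> ff; rewrite !lte_mul_pinfty ?lee_fin ?sqr_ge0//.
by apply: lte_add_pinfty; apply: fin2; [exact: full_fin|exact: past_fin].
Qed.

Let g_fin t : 0 <= t -> (sqr_norm mu (g t) < +oo)%E.
Proof.
by move=> t0; rewrite sqr_normZ; [rewrite lte_mul_pinfty ?lee_fin ?sqr_ge0// past_fin|exact: mpast].
Qed.

Let h_gt0 t v : 0 < v -> h t v = (1 - a ^+ 2 / c2 * (v <= u)%R%:R) * k t v.
Proof.
move=> v0; rewrite /h /past /full /truncation v0/=.
case: (ltP t v) => [/k_causal ->|_] /=; first by rewrite !mul0r !mulr0 addr0.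
by rewrite mulr1; ring.
Qed.

Let h_out t v : ~~ (0 < v <= t) -> h t v = 0.
Proof.
have [v0 /= |v0 _] := ltP 0 v; last by rewrite /h /past /full /truncation ltNge v0 /= !mulr0 addr0.
by rewrite -ltNge h_gt0// => /k_causal ->; rewrite mulr0.
Qed.

Let integral_hh t s : \int[mu]_v (h t v * h s v) =
  \int[mu]_(v in `[0, Num.min t s])
    ((1 - a ^+ 2 / c2 * (v < u)%R%:R) ^+ 2 * k t v * k s v).
Proof.
rewrite /Rintegral; congr fine.
have mF : measurable_fun [set: R]
    (fun v => (1 - a ^+ 2 / c2 * (v < u)%R%:R) ^+ 2 * k t v * k s v).
  apply: measurable_funM => //; apply: measurable_funM => //.
  apply: measurable_funX; apply: measurable_funB => //; apply: measurable_funM => //.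
  rewrite (_ : (fun v => _) = \1_(`]-oo, u[%classic)); first exact: measurable_indic.
  by apply/funext => v; rewrite indicE mem_setE in_itv.
rewrite -integral_itv_obnd_cbnd; last by apply/measurable_EFinP; exact: measurable_funTS.
transitivity (\int[mu]_(v in `]0%R, Num.min t s]) (h t v * h s v)%:E)%E.
  rewrite [RHS]integral_mkcond; apply: eq_integral => v _.
  rewrite patchE mem_setE in_itv/=; case: ifPn => //.
  rewrite le_min andbA => /nandP nv.
  have [tv|vt] := boolP (0 < v <= t); last by rewrite (h_out vt) mul0r.
  have [sv|vs] := boolP (0 < v <= s); last by rewrite (h_out vs) mulr0.
  by move: tv sv nv => /andP[-> ->] /andP[_ ->] [].
apply: ae_eq_integral => //.
- apply/measurable_EFinP; apply: measurable_funTS; apply: measurable_funM; exact: mh.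
- by apply/measurable_EFinP; exact: measurable_funTS.
(* The covariance has [v < u] where the truncation at [u] has [v <= u]. *)
exists [set u]; split; [exact: measurable_set1|exact: lebesgue_measure_set1|].
move=> v /not_implyP[]; rewrite /= in_itv/= => /andP[v0 _].
have [vu|uv|//] := ltgtP v u; case.
- by rewrite !h_gt0// (ltW vu); congr (_%:E); ring.
- by rewrite !h_gt0// leNgt uv /=; congr (_%:E); ring.
Qed.

Let integral_gg t s : 0 <= t -> 0 <= s -> \int[mu]_v (g t v * g s v) =
  a ^+ 2 * b ^+ 2 / c2 ^+ 2 * \int[mu]_(v in `[0, u]) (k t v * k s v).
Proof.
move=> t0 s0.
have -> : \int[mu]_(v in `[0, u]) (k t v * k s v) = \int[mu]_v (past t v * past s v).
  rewrite /Rintegral; congr fine.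
  rewrite -integral_itv_obnd_cbnd; last first.
    by apply/measurable_EFinP; apply: measurable_funTS; exact: measurable_funM.
  rewrite [LHS]integral_mkcond; apply: eq_integral => v _.
  rewrite patchE mem_setE in_itv/= /past /truncation; case: (0 < v <= u).
    by rewrite !mulr1.
  by rewrite !mulr0.
rewrite -RintegralZl//; last first.
  by apply: integrable_mul_L2; [exact: mpast|exact: mpast|exact: past_fin|exact: past_fin].
apply: eq_Rintegral => v _; rewrite /g; field; by rewrite gt_eqF.
Qed.

Let covarianceE t s : 0 <= t -> 0 <= s ->
  r t s = \int[mu]_v (h t v * h s v) + \int[mu]_v (g t v * g s v).
Proof. by move=> t0 s0; rewrite integral_hh integral_gg. Qed.

Let variance_of n (t : 'I_n -> {nonneg R}) (c : 'I_n -> R) :=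
  \sum_(i < n) \sum_(j < n) c i * c j * r (t i)%:num (t j)%:num.

Let varianceE n (t : 'I_n -> {nonneg R}) (c : 'I_n -> R) :
  exists p q, [/\ sqr_norm mu (fun v => \sum_(i < n) c i * h (t i)%:num v) = p%:E,
    sqr_norm mu (fun v => \sum_(i < n) c i * g (t i)%:num v) = q%:E &
    variance_of t c = p + q].
Proof.
exists (\sum_(i < n) \sum_(j < n) c i * c j * \int[mu]_v (h (t i)%:num v * h (t j)%:num v)).
exists (\sum_(i < n) \sum_(j < n) c i * c j * \int[mu]_v (g (t i)%:num v * g (t j)%:num v)).
split.
- by apply: sqr_norm_sum => i; [exact: mh|exact: h_fin].
- by apply: sqr_norm_sum => i; [exact: mg|exact: g_fin].
- rewrite -big_split; apply: eq_bigr => i _; rewrite -big_split; apply: eq_bigr => j _.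
  by rewrite covarianceE// mulrDr.
Qed.

Lemma volterra_conditional_law : gaussian_conditional_law P F X m r.
Proof.
apply: (@gaussian_conditional_law_of_decomposition _ _ T P F H X m r).
- exact: Fm.
- exact: Hm.
- exact: indepFH.
- exact: measurable_mean.
- exact: measurable_residual.
- move=> t t0; have [s [os sf _ sX _]] := approximation t0.
  have [p pE] : exists p, sqr_norm mu (full t) = p%:E.
    exists (fine (sqr_norm mu (full t))); rewrite fineK// ge0_fin_numE ?full_fin//.
    exact: sqr_norm_ge0.
  apply: (@integrable_gaussian _ _ _ P _ (p + 0)); first exact: measurable_funPT.
    by rewrite addr0 -lee_fin -pE sqr_norm_ge0.
  apply: (is_pair_integral_gaussian bW bW' WW' (h := full t) (g := fun=> 0)) => //.
    by rewrite /sqr_norm integral0_eq// => w _; rewrite expr0n.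
  exists s, (fun=> [::]); split => //.
    by apply: L2cvg_cst => n v; rewrite /step_fun big_nil.
  by apply: eq_L2cvg sX => [n w|w//]; rewrite /step_integral big_nil addr0.
- move=> n t c; have [p [q [pE qE]]] := varianceE t c; rewrite /variance_of => ->.
  by rewrite addr_ge0// -lee_fin -?pE -?qE sqr_norm_ge0.
- move=> n t c; have [p [q [pE qE]]] := varianceE t c; rewrite /variance_of => ->.
  have ms d' (S : measurableType d') (f : R -> S -> R) :
      (forall s, measurable_fun [set: S] (f s)) ->
      measurable_fun [set: S] (fun w => \sum_(i < n) c i * f (t i)%:num w).
    by move=> mf; apply: measurable_sum => i; exact: measurable_funM.
  apply: (is_pair_integral_gaussian bW bW' WW' (ms _ _ h mh) (ms _ _ g mg) (ms _ _ Z mZ) pE qE).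
  apply: is_pair_integral_sum => i; [exact: mh|exact: mg|exact: mZ|exact: Z_pair_integral].
- move=> t s; rewrite /r minC; congr (_ + _ * _); apply: eq_Rintegral => v _; ring.
Qed.

End volterra.

Theorem theorem2p1 (R : realType) (d : measure_display) (T : measurableType d)
  (P : probability T R) (W W' X : R -> {RV P >-> R}) (k : R -> R -> R)
  (a b u : R) :
  brownian_motion W -> brownian_motion W' -> independent_processes P W W' ->
  (forall t s, t < s -> k t s = 0) ->
  (forall t, measurable_fun [set: R] (k t)) ->
  (forall t, 0 <= t ->
     (\int[lebesgue_measure]_(s in `[0%R, t]) ((k t s) ^+ 2)%:E < +oo)%E) ->
  (forall t, 0 <= t ->
     {ae P, forall w, X t w = wiener_integral P W t (k t) w}) ->
  0 < a ^+ 2 + b ^+ 2 ->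
  0 < u ->
  gaussian_conditional_law P
    (natural_filtration P (fun v w => a * W v w + b * W' v w) u)
    X
    (fun t w => a / (a ^+ 2 + b ^+ 2) *
                wiener_integral_comb P a b W W' u (k t) w)
    (fun t s =>
       \int[lebesgue_measure]_(v in `[0, Num.min t s])
          ((1 - a ^+ 2 / (a ^+ 2 + b ^+ 2) * (v < u)%R%:R) ^+ 2
           * k t v * k s v) +
       a ^+ 2 * b ^+ 2 / (a ^+ 2 + b ^+ 2) ^+ 2 *
       \int[lebesgue_measure]_(v in `[0, u]) (k t v * k s v)).
Proof.
by move=> bW bW' WW' k0 mk k2 XE ab0 u0; exact: (volterra_conditional_law bW bW' WW').
Qed.
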